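(* Let $k\ge1$ be an integer, $\mathbf{x},\mathbf{y}\in\mathbb{C}^k$, $\mathbf{a},\mathbf{b},\mathbf{h}\in\mathbb{C}^k$ and $c,d,g\in\mathbb{C}$ with $\Re(\mathbf{a})>\mathbf{0}$, $\Re(c)>\Re(\langle\mathbf{a}\rangle)$, $\Re(\mathbf{b})>\mathbf{0}$, $\Re(d)>\Re(\langle\mathbf{b}\rangle)$, $\Re(\mathbf{h}-\mathbf{1})>\mathbf{0}$ and $\Re(g+k)>\Re(\langle\mathbf{h}\rangle)$. Then $$\Phi_2^{(k)}\big[\mathbf{a};c;\mathbf{x}\big]\,\Phi_2^{(k)}\big[\mathbf{b};d;\mathbf{y}\big]=\int_{E_k\times E_k}\int_{\mathcal{L}^k}\Phi_2^{(k)}\left[\mathbf{h};g;\frac{\mathbf{x}\circ\mathbf{u}+\mathbf{y}\circ\mathbf{v}}{\mathbf{t}}\right]\mathrm{d}\mu_{(\mathbf{a},c-\langle\mathbf{a}\rangle)}(\mathbf{u})\,\mathrm{d}\mu_{(\mathbf{b},d-\langle\mathbf{b}\rangle)}(\mathbf{v})\,\mathrm{d}\widetilde{\mu}_{(\mathbf{h}-\mathbf{1},\,g+k-\langle\mathbf{h}\rangle)}(\mathbf{t}).$$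
   Context: Boldface letters denote vectors of dimension $k$; $\mathbf{1}=(1,\dots,1)$. For $\mathbf{x},\mathbf{y}\in\mathbb{C}^k$ and $\mathbf{m}\in\mathbb{Z}_{\ge0}^k$: $\langle\mathbf{x}\rangle:=x_1+\cdots+x_k$, $\mathbf{x}\circ\mathbf{y}:=(x_1y_1,\dots,x_ky_k)$, $\frac{\mathbf{x}}{\mathbf{y}}:=(x_1/y_1,\dots,x_k/y_k)$, $\mathbf{x}^{\mathbf{m}}:=x_1^{m_1}\cdots x_k^{m_k}$, $\mathbf{m}!:=m_1!\cdots m_k!$; $\Re(\mathbf{a})>\mathbf{0}$ means $\Re(a_i)>0$ for all $i$. $(a)_n=a(a+1)\cdots(a+n-1)$, $(a)_0=1$. For $\mathbf{b}\in\mathbb{C}^k$, $c\in\mathbb{C}\setminus\mathbb{Z}_{\le0}$, $\mathbf{x}\in\mathbb{C}^k$, $$\Phi_2^{(k)}[\mathbf{b};c;\mathbf{x}]=\sum_{\mathbf{m}\in\mathbb{Z}_{\ge0}^k}\frac{(b_1)_{m_1}\cdots(b_k)_{m_k}}{(c)_{\langle\mathbf{m}\rangle}}\frac{\mathbf{x}^{\mathbf{m}}}{\mathbf{m}!}.$$ For $\Re(\boldsymbol{\lambda})>\mathbf{0}$, $\Re(\alpha)>0$, the (complex) Dirichlet measure on the standard simplex $E_k=\{\mathbf{s}\in\mathbb{R}^k: s_i\ge0,\ s_1+\cdots+s_k\le1\}$ is $$\mathrm{d}\mu_{(\boldsymbol{\lambda},\alpha)}(\mathbf{s})=\frac{\Gamma(\langle\boldsymbol{\lambda}\rangle+\alpha)}{\Gamma(\lambda_1)\cdots\Gamma(\lambda_k)\Gamma(\alpha)}\,s_1^{\lambda_1-1}\cdots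 s_k^{\lambda_k-1}(1-\langle\mathbf{s}\rangle)^{\alpha-1}\,\mathrm{d}\mathbf{s}.$$ $\mathcal{L}$ is the vertical line in $\mathbb{C}$ from $\frac{1}{k+1}-\mathrm{i}\infty$ to $\frac{1}{k+1}+\mathrm{i}\infty$ and $\mathcal{L}^k=\mathcal{L}\times\cdots\times\mathcal{L}$ ($k$ factors). For $\Re(\mathbf{a})>\mathbf{0}$, $\Re(c)>0$, on $\mathcal{L}^k$, $$\mathrm{d}\widetilde{\mu}_{(\mathbf{a},c)}(\mathbf{t})=\frac{\Gamma(a_1+1)\cdots\Gamma(a_k+1)\Gamma(c)}{(2\pi\mathrm{i})^k\,\Gamma(\langle\mathbf{a}\rangle+c)}\,t_1^{-a_1-1}\cdots t_k^{-a_k-1}(1-\langle\mathbf{t}\rangle)^{-c}\,\mathrm{d}t_1\cdots\mathrm{d}t_k,$$ with principal branches of the powers (on $\mathcal{L}^k$ all $t_i$ and $1-\langle\mathbf{t}\rangle$ have real part $\frac1{k+1}>0$). *)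

(* Defs.v *)
From HB Require Import structures.
From mathcomp Require Import all_boot all_order all_algebra.
From mathcomp Require Import all_classical all_reals all_analysis.
From mathcomp Require Import complex.
From mathcomp Require summability.

Set Implicit Arguments.
Unset Strict Implicit.
Unset Printing Implicit Defensive.
Import Order.TTheory GRing.Theory Num.Theory.
Import numFieldNormedType.Exports.

Local Open Scope classical_set_scope.
Local Open Scope ring_scope.
Local Open Scope complex_scope.

(* The image of m1 \x m2 under (r, s) |-> r :: s, a product measure carried by
   n.+1-tuples. *)
Section cons_measure.
Context d (T : measurableType d) (R : realType) (n : nat).
Variable m1 : {sigma_finite_measure set T -> \bar R}.
Variable m2 : {sigma_finite_measure set n.-tuple T -> \bar R}.

Definition tuple_cons (p : T * n.-tuple T) : n.+1.-tuple T :=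
  [tuple of p.1 :: p.2].

Lemma measurable_tuple_cons : measurable_fun setT tuple_cons.
Proof. by apply: measurable_cons. Qed.

Lemma measurable_tuple_uncons :
  measurable_fun setT (fun s : n.+1.-tuple T => (thead s, [tuple of behead s])).
Proof.
apply: measurable_fun_pair; first exact: measurable_tnth.
exact: measurable_behead.
Qed.

Definition cons_measure : set (n.+1.-tuple T) -> \bar R :=
  pushforward (m1 \x m2)%E tuple_cons.

Let preimage_cons A : measurable A -> measurable (tuple_cons @^-1` A).
Proof.
by move=> mA; rewrite -[X in measurable X]setTI; exact: measurable_tuple_cons.
Qed.

Let cons_measure0 : cons_measure set0 = 0%E.
Proof. by rewrite /cons_measure /pushforward preimage_set0 measure0. Qed.

Let cons_measure_ge0 A : (0 <= cons_measure A)%E.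
Proof. by rewrite /cons_measure /pushforward measure_ge0. Qed.

Let cons_measure_sigma_additive : semi_sigma_additive cons_measure.
Proof.
move=> F mF tF mUF; rewrite /cons_measure /pushforward preimage_bigcup.
apply: measure_semi_sigma_additive.
- by move=> n0; exact: preimage_cons.
- apply/trivIsetP => /= i j _ _ ij; rewrite -preimage_setI.
  by move/trivIsetP : tF => /(_ _ _ _ _ ij) ->//; rewrite preimage_set0.
- by rewrite -preimage_bigcup; exact: preimage_cons.
Qed.

HB.instance Definition _ := isMeasure.Build _ _ _ cons_measure
  cons_measure0 cons_measure_ge0 cons_measure_sigma_additive.

Let cons_measure_sigma_finite : sigma_finite setT cons_measure.
Proof.
have [F FT Foo] : sigma_finite setT (m1 \x m2)%E.
  have /sigma_finiteP[F [FT ndF Foo]] := sigma_finiteT m1.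
  have /sigma_finiteP[G [GT ndG Goo]] := sigma_finiteT m2.
  exists (fun i => F i `*` G i).
    rewrite -setXTT FT GT predeqE => -[x y]; split.
      move=> [/= [i _ Fix] [j _ Gjy]]; exists (maxn i j) => //; split.
      - by move: x Fix; exact/subsetPset/ndF/leq_maxl.
      - by move: y Gjy; exact/subsetPset/ndG/leq_maxr.
    by move=> [i _ []/= ? ?]; split; exists i.
  move=> i; have [? ?] := Foo i; have [? ?] := Goo i.
  split; first exact: measurableX.
  by rewrite product_measure1E// lte_mul_pinfty// ge0_fin_numE.
pose g (s : n.+1.-tuple T) := (thead s, [tuple of behead s]).
have gK p : g (tuple_cons p) = p.
  by case: p => a b; congr pair; apply: val_inj.
exists (fun i => g @^-1` F i).
  by rewrite -preimage_bigcup -FT.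
move=> i; have [mF Fi] := Foo i; split.
  by rewrite -[X in measurable X]setTI; exact: measurable_tuple_uncons.
rewrite /cons_measure /pushforward -comp_preimage.
by rewrite (_ : g \o tuple_cons = id) //; apply/funext.
Qed.

HB.instance Definition _ := Measure_isSigmaFinite.Build _ _ _ cons_measure
  cons_measure_sigma_finite.
End cons_measure.

Fixpoint lebesgue_tuple (R : realType) (k : nat) :
    {sigma_finite_measure set k.-tuple (measurableTypeR R) -> \bar R} :=
  match k return
    {sigma_finite_measure set k.-tuple (measurableTypeR R) -> \bar R} with
  | 0 => \d_ [tuple]
  | k'.+1 => cons_measure (@lebesgue_measure R) (lebesgue_tuple R k')
  end.

Section complex_analysis.
Context (R : realType).
Implicit Types z w : R[i].

Definition cintegral d (T : measurableType d) (mu : {measure set T -> \bar R})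
    (D : set T) (f : T -> R[i]) : R[i] :=
  (\int[mu]_(x in D) complex.Re (f x)) +i* (\int[mu]_(x in D) complex.Im (f x)).

Definition cmod z : R := Num.sqrt (complex.Re z ^+ 2 + complex.Im z ^+ 2).

Definition cexp z : R[i] :=
  (expR (complex.Re z))%:C * (cos (complex.Im z) +i* sin (complex.Im z)).

(* The principal argument, in ]-pi, pi]. *)
Definition carg z : R :=
  if 0 <= complex.Im z then acos (complex.Re z / cmod z)
  else - acos (complex.Re z / cmod z).

Definition cln z : R[i] := ln (cmod z) +i* carg z.

(* The principal branch of z to the power w. *)
Definition cpow z w : R[i] :=
  if z == 0 then (w == 0)%:R else cexp (w * cln z).

(* Euler's integral, which is the Gamma function on 0 < Re z only. *)
Definition cgamma z : R[i] :=
  cintegral lebesgue_measure `]0, +oo[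
    (fun t : R => cpow t%:C (z - 1) * (expR (- t))%:C).

Definition pochhammer z (n : nat) : R[i] := \prod_(i < n) (z + i%:R).

End complex_analysis.

Section vectors.
Context (K : fieldType) (k : nat).
Implicit Types x y : 'rV[K]_k.

Definition vsum (V : nmodType) (x : 'rV[V]_k) : V := \sum_(i < k) x 0 i.

Definition vmul x y : 'rV[K]_k := \row_i (x 0 i * y 0 i).

Definition vdiv x y : 'rV[K]_k := \row_i (x 0 i / y 0 i).

End vectors.

Section confluent.
Context (R : realType) (k : nat).
Implicit Types (a b x t : 'rV[R[i]]_k) (s : k.-tuple (measurableTypeR R)).

(* [summability.sum] is the unordered sum: the limit of the partial sums along
   the finite sets of multi-indices. *)
Definition Phi2 b (c : R[i]) x : R[i] :=
  @summability.sum 'rV[nat]_k R[i] R[i]^o (fun m =>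
    (\prod_(i < k) pochhammer (b 0 i) (m ord0 i)) / pochhammer c (vsum m)
    * ((\prod_(i < k) x 0 i ^+ m ord0 i) / (\prod_(i < k) (m ord0 i)`!)%N%:R)).

Definition cvec (s : k.-tuple (measurableTypeR R)) : 'rV[R[i]]_k :=
  \row_i (tnth s i : R)%:C.

Definition simplex : set (k.-tuple (measurableTypeR R)) :=
  [set s | (forall i, 0 <= (tnth s i : R)) /\ \sum_(i < k) (tnth s i : R) <= 1].

(* Density of the complex Dirichlet measure with respect to Lebesgue measure. *)
Definition dirichlet_density (lambda : 'rV[R[i]]_k) (alpha : R[i])
    (s : k.-tuple (measurableTypeR R)) : R[i] :=
  cgamma (vsum lambda + alpha)
    / ((\prod_(i < k) cgamma (lambda 0 i)) * cgamma alpha)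
  * (\prod_(i < k) cpow (cvec s 0 i) (lambda 0 i - 1))
  * cpow (1 - vsum (cvec s)) (alpha - 1).

(* Points of the k-fold product of the vertical line at abscissa 1 / (k + 1),
   parametrized by their imaginary parts. *)
Definition line_point (tau : k.-tuple (measurableTypeR R)) : 'rV[R[i]]_k :=
  \row_i (k.+1%:R^-1 +i* (tnth tau i : R)).

(* Density of the measure on the product of vertical lines with respect to
   dt_1 ... dt_k. *)
Definition line_density a (c : R[i]) (t : 'rV[R[i]]_k) : R[i] :=
  (\prod_(i < k) cgamma (a 0 i + 1)) * cgamma c
    / ((2 * pi%:C * 'i) ^+ k * cgamma (vsum a + c))
  * (\prod_(i < k) cpow (t 0 i) (- a 0 i - 1))
  * cpow (1 - vsum t) (- c).

(* The integral over the product of vertical lines of f(t) dt_1 ... dt_k; with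
   t = line_point tau, each dt_i is 'i dtau_i. *)
Definition line_integral (f : 'rV[R[i]]_k -> R[i]) : R[i] :=
  cintegral (lebesgue_tuple R k) setT (fun tau => f (line_point tau) * 'i ^+ k).

End confluent.

(* Main.v *)
(** The integral over the vertical lines does not depend on the parameters: it
   equals the exponential of [<x o u + y o v>]. Indeed, integrating the series
   of Phi2 termwise leaves the moments
     [\int \prod_i t_i^(- h_i - m_i) (1 - <t>)^(- (g + k - <h>)) dt],
   and writing the last factor as the Laplace integral
   [\int_0^oo s^(c - 1) exp (- s (1 - <t>)) ds / Gamma (c)], c = g + k - <h>,
   separates the variables. Each one-dimensional line integral is computed by
   Fourier inversion, and the factors Gamma (h_i + m_i) and Gamma (g + |m|) that
   come out cancel the Pochhammer symbols of Phi2. The exponential splits as a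
   function of u times a function of v, so that it remains to see that the
   Dirichlet average of [exp <x o u>] is Phi2, which is again a termwise
   integration, based on the Dirichlet moments. *)

Require Import Defs.
From HB Require Import structures.
From mathcomp Require Import finmap.
From mathcomp Require Import all_boot all_order all_algebra.
From mathcomp Require Import all_classical all_reals all_analysis.
From mathcomp Require Import complex.
From mathcomp Require Import measurable_realfun ring lra.

Set Implicit Arguments.
Unset Strict Implicit.
Unset Printing Implicit Defensive.
Import Order.TTheory GRing.Theory Num.Theory.
Import numFieldNormedType.Exports.

Local Open Scope classical_set_scope.
Local Open Scope ring_scope.
Local Open Scope complex_scope.

(** * Complex sequences *)

(** No contour is ever moved. For real [s], the modulus of [exp (- z s)] depends on [Re z] only, so
    a vertical line is handled by real analysis in its parameter, with one majorant for the whole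
    line. A single kernel, [gker z q s = s ^ (q - 1) exp (- z s)] on the positive reals, carries the
    proof: its integral is Gamma at [z = 1], a Fourier transform when [z] runs over a vertical line,
    and at [q = 1] it yields the Poisson kernel on which the inversion rests. The nonvanishing of
    Gamma is itself read off the inversion formula.

    The assumption [1 < Re h_i] makes [t_i ^ (- h_i)] absolutely integrable on its line, and
    [k / (k + 1) < 1] keeps [Re (1 - <t>)] positive, as the Laplace integral requires. Both termwise
    integrations use dominated convergence along cubes of multi-indices, on which the exponential
    series factorizes; the bounds are uniform because [1 / t_i] is bounded on the lines and [s_i] on
    the simplex.

    A recurring obstacle is the value of [cpow] at 0 on the boundary of the simplex: identities
    between kernels then hold only away from a null set, which the induction for Dirichlet integrals
    has to respect. *)

Section modulus.
Context {R : realType}.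
Implicit Types (z w : R[i]) (x y : R).

Lemma cmodE z : `|z| = (cmod z)%:C. Proof. by rewrite normc_def. Qed.

Lemma cmod0 : cmod (0 : R[i]) = 0.
Proof. by apply: complexI; rewrite -cmodE normr0. Qed.

Lemma cmod1 : cmod (1 : R[i]) = 1.
Proof. by apply: complexI; rewrite -cmodE normr1. Qed.

Lemma cmod_ge0 z : 0 <= cmod z. Proof. exact: sqrtr_ge0. Qed.

Lemma cmodM z w : cmod (z * w) = cmod z * cmod w.
Proof. by apply: complexI; rewrite rmorphM/= -!cmodE normrM. Qed.

Lemma cmodN z : cmod (- z) = cmod z.
Proof. by apply: complexI; rewrite -!cmodE normrN. Qed.

Lemma cmodV z : cmod z^-1 = (cmod z)^-1.
Proof. by apply: complexI; rewrite fmorphV/= -!cmodE normfV. Qed.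

Lemma cmodX z n : cmod (z ^+ n) = cmod z ^+ n.
Proof. by apply: complexI; rewrite rmorphXn/= -!cmodE normrX. Qed.

Lemma cmod_real x : cmod x%:C = `|x|.
Proof. by rewrite /cmod/= expr0n addr0 sqrtr_sqr. Qed.

Lemma cmod_nat n : cmod (n%:R : R[i]) = n%:R.
Proof. by apply: complexI; rewrite -cmodE normr_nat rmorph_nat. Qed.

Lemma cmod_eq0 z : (cmod z == 0) = (z == 0).
Proof. by rewrite -(inj_eq (@complexI R)) -cmodE normr_eq0. Qed.

Lemma cmod_gt0 z : (0 < cmod z) = (z != 0).
Proof. by rewrite lt_def cmod_ge0 cmod_eq0 andbT. Qed.

Lemma ler_cmodD z w : cmod (z + w) <= cmod z + cmod w.
Proof. by rewrite -lecR rmorphD/= -!cmodE ler_normD. Qed.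

Lemma ler_cmod_sum (I : Type) (r : seq I) (P : pred I) (F : I -> R[i]) :
  cmod (\sum_(i <- r | P i) F i) <= \sum_(i <- r | P i) cmod (F i).
Proof.
elim/big_rec2 : _ => [|i y x _ h]; first by rewrite cmod0.
by rewrite (le_trans (ler_cmodD _ _))// lerD2l.
Qed.

Lemma cmod_prod (I : Type) (r : seq I) (P : pred I) (F : I -> R[i]) :
  cmod (\prod_(i <- r | P i) F i) = \prod_(i <- r | P i) cmod (F i).
Proof.
by elim/big_rec2 : _ => [|i y x _ <-]; rewrite ?cmod1 ?cmodM.
Qed.

Lemma ler_Re_cmod z : `|complex.Re z| <= cmod z.
Proof. by rewrite -sqrtr_sqr ler_wsqrtr// lerDl sqr_ge0. Qed.

Lemma ler_Im_cmod z : `|complex.Im z| <= cmod z.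
Proof. by rewrite -sqrtr_sqr ler_wsqrtr// lerDr sqr_ge0. Qed.

Lemma ler_cmod_ReIm z : cmod z <= `|complex.Re z| + `|complex.Im z|.
Proof.
case: z => a b /=.
have -> : a +i* b = a%:C + 'i * b%:C by rewrite [LHS]complexE.
rewrite (le_trans (ler_cmodD _ _))// cmodM !cmod_real lerD2l.
by rewrite /cmod/= expr0n add0r expr1n sqrtr1 mul1r.
Qed.

Lemma cReD z w : complex.Re (z + w) = complex.Re z + complex.Re w.
Proof. by case: z w => [? ?] []. Qed.
Lemma cImD z w : complex.Im (z + w) = complex.Im z + complex.Im w.
Proof. by case: z w => [? ?] []. Qed.
Lemma cReN z : complex.Re (- z) = - complex.Re z.
Proof. by case: z. Qed.
Lemma cImN z : complex.Im (- z) = - complex.Im z.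
Proof. by case: z. Qed.
Lemma cReM z w : complex.Re (z * w) =
  complex.Re z * complex.Re w - complex.Im z * complex.Im w.
Proof. by case: z w => [? ?] []. Qed.
Lemma cImM z w : complex.Im (z * w) =
  complex.Re z * complex.Im w + complex.Im z * complex.Re w.
Proof. by case: z w => [? ?] []. Qed.

Lemma cRe_sum (I : Type) (r : seq I) (P : pred I) (F : I -> R[i]) :
  complex.Re (\sum_(i <- r | P i) F i) = \sum_(i <- r | P i) complex.Re (F i).
Proof. exact: (big_morph _ cReD). Qed.

Lemma complexP z w :
  complex.Re z = complex.Re w -> complex.Im z = complex.Im w -> z = w.
Proof. by case: z w => [? ?] [? ?] /= -> ->. Qed.

End modulus.

(** Convergence is taken in the two real coordinates, the form in which the real theorems on limits
    and integrals apply; [ccvg_cmod] recovers the modulus. *)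
Definition ccvg {R : realType} (u : nat -> R[i]) (l : R[i]) :=
  (complex.Re (u n) @[n --> \oo] --> complex.Re l) /\
  (complex.Im (u n) @[n --> \oo] --> complex.Im l).

Lemma squeeze_cvg0 {R : realType} (u v : nat -> R) :
  (forall n, 0 <= u n <= v n) -> v @ \oo --> 0 -> u @ \oo --> 0.
Proof.
move=> uv v0; apply: (@squeeze_cvgr _ _ _ _ (cst 0) v) => //.
- by apply: nearW => n; exact: uv.
- exact: cvg_cst.
Qed.

Section ccvg.
Context {R : realType}.
Implicit Types (u v : nat -> R[i]) (l m : R[i]).

Lemma ccvg_unique u l m : ccvg u l -> ccvg u m -> l = m.
Proof.
move=> [ul1 ul2] [um1 um2].
by apply: complexP; [exact: (cvg_unique _ ul1 um1)|exact: (cvg_unique _ ul2 um2)].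
Qed.

Lemma ccvg_cst l : ccvg (fun=> l) l.
Proof. by split; exact: cvg_cst. Qed.

Lemma ccvgM u v l m : ccvg u l -> ccvg v m -> ccvg (fun n => u n * v n) (l * m).
Proof.
move=> [ul1 ul2] [vm1 vm2]; split.
  by rewrite cReM; under eq_fun do rewrite cReM; apply: cvgB; exact: cvgM.
by rewrite cImM; under eq_fun do rewrite cImM; apply: cvgD; exact: cvgM.
Qed.

Lemma ccvg_prod (I : Type) (r : seq I) (f : I -> nat -> R[i]) (l : I -> R[i]) :
  (forall i, ccvg (f i) (l i)) ->
  ccvg (fun n => \prod_(i <- r) f i n) (\prod_(i <- r) l i).
Proof.
move=> fl; elim: r => [|i r IH].
  by rewrite big_nil; under [fun n => _]eq_fun do rewrite big_nil; exact: ccvg_cst.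
by rewrite big_cons; under [fun n => _]eq_fun do rewrite big_cons; exact: ccvgM.
Qed.

Lemma eq_ccvg u v l : u =1 v -> ccvg u l -> ccvg v l.
Proof. by move=> /funext ->. Qed.

Lemma ccvg_cmod u l : (cmod (u n - l) @[n --> \oo] --> 0) <-> ccvg u l.
Proof.
split=> [h|[h1 h2]].
  split; apply/subr_cvg0; apply: norm_cvg0.
    apply: (squeeze_cvg0 _ h) => n.
    by rewrite normr_ge0/= -cReN -cReD ler_Re_cmod.
  apply: (squeeze_cvg0 _ h) => n.
  by rewrite normr_ge0/= -cImN -cImD ler_Im_cmod.
have : `|complex.Re (u n) - complex.Re l| + `|complex.Im (u n) - complex.Im l|
    @[n --> \oo] --> (0 + 0 : R).
  apply: cvgD; rewrite -[X in _ --> X](normr0 R).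
    by apply: cvg_norm; apply/subr_cvg0.
  by apply: cvg_norm; apply/subr_cvg0.
rewrite addr0 => h; apply: (squeeze_cvg0 _ h) => n; rewrite cmod_ge0/=.
by rewrite (le_trans (ler_cmod_ReIm _))// cReD cImD cReN cImN.
Qed.

End ccvg.

(** * Complex-valued integrals *)

Definition cmeasurable {d} {T : measurableType d} {R : realType}
    (f : T -> R[i]) :=
  measurable_fun setT (fun x => complex.Re (f x)) /\
  measurable_fun setT (fun x => complex.Im (f x)).

Definition cintegrable {d} {T : measurableType d} {R : realType}
    (mu : {measure set T -> \bar R}) (f : T -> R[i]) :=
  mu.-integrable setT (fun x => (complex.Re (f x))%:E) /\
  mu.-integrable setT (fun x => (complex.Im (f x))%:E).

Section cmeasurable.
Context {d} {T : measurableType d} {R : realType}.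
Implicit Types f g : T -> R[i].

Lemma cmeasurable_cst (c : R[i]) : cmeasurable (fun _ : T => c).
Proof. by split; exact: measurable_cst. Qed.

Lemma cmeasurableD f g : cmeasurable f -> cmeasurable g ->
  cmeasurable (fun x => f x + g x).
Proof.
move=> [f1 f2] [g1 g2]; split.
  by under eq_fun do rewrite cReD; exact: measurable_funD.
by under eq_fun do rewrite cImD; exact: measurable_funD.
Qed.

Lemma cmeasurableM f g : cmeasurable f -> cmeasurable g ->
  cmeasurable (fun x => f x * g x).
Proof.
move=> [f1 f2] [g1 g2]; split.
  by under eq_fun do rewrite cReM; apply: measurable_funB; exact: measurable_funM.
by under eq_fun do rewrite cImM; apply: measurable_funD; exact: measurable_funM.
Qed.

Lemma cmeasurable_sum (I : Type) (r : seq I) (P : pred I) (f : I -> T -> R[i]) :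
  (forall i, cmeasurable (f i)) ->
  cmeasurable (fun x => \sum_(i <- r | P i) f i x).
Proof.
move=> mf; elim: r => [|i r IH].
  by under eq_fun do rewrite big_nil; exact: cmeasurable_cst.
under eq_fun do rewrite big_cons.
by case: (P i) => //; exact: cmeasurableD.
Qed.

Lemma cmeasurable_prod (I : Type) (r : seq I) (f : I -> T -> R[i]) :
  (forall i, cmeasurable (f i)) ->
  cmeasurable (fun x => \prod_(i <- r) f i x).
Proof.
move=> mf; elim: r => [|i r IH].
  by under eq_fun do rewrite big_nil; exact: cmeasurable_cst.
by under eq_fun do rewrite big_cons; exact: cmeasurableM.
Qed.

Lemma cmeasurable_real (f : T -> R) : measurable_fun setT f ->
  cmeasurable (fun x => (f x)%:C).
Proof. by move=> mf; split => //=; exact: measurable_cst. Qed.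

Lemma cmeasurable_if (b : T -> bool) f g : measurable_fun setT b ->
  cmeasurable f -> cmeasurable g ->
  cmeasurable (fun x => if b x then f x else g x).
Proof.
move=> mb [f1 f2] [g1 g2]; split.
  by under eq_fun do rewrite (fun_if (@complex.Re R)); exact: measurable_fun_ifT.
by under eq_fun do rewrite (fun_if (@complex.Im R)); exact: measurable_fun_ifT.
Qed.

Lemma measurable_cmod f : cmeasurable f -> measurable_fun setT (fun x => cmod (f x)).
Proof.
move=> [f1 f2]; rewrite /cmod.
pose F (x : T) := complex.Re (f x) ^+ 2 + complex.Im (f x) ^+ 2.
have mF : measurable_fun setT F.
  by apply: measurable_funD; exact: measurable_funX.
have -> : (fun x => Num.sqrt (F x)) = (@powR R ^~ 2^-1) \o F.
  by apply/funext => x; rewrite /= powR12_sqrt// addr_ge0 ?sqr_ge0.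
by apply: measurableT_comp => //; exact: measurable_powR.
Qed.

End cmeasurable.

Lemma cmeasurableT_comp {d1 d2} {T1 : measurableType d1} {T2 : measurableType d2}
    {R : realType} (f : T2 -> R[i]) (phi : T1 -> T2) :
  cmeasurable f -> measurable_fun setT phi -> cmeasurable (fun x => f (phi x)).
Proof. by move=> [f1 f2] mphi; split; [exact: (measurableT_comp f1 mphi)|exact: (measurableT_comp f2 mphi)]. Qed.

Section cintegral.
Context {d} {T : measurableType d} {R : realType}.
Variable mu : {measure set T -> \bar R}.
Implicit Types f g : T -> R[i].
Local Notation "\cint f" := (cintegral mu setT f) (at level 10).

Lemma cintegrable_cmeasurable f : cintegrable mu f -> cmeasurable f.
Proof.
move=> [/measurable_int f1 /measurable_int f2].
by split; exact/measurable_EFinP.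
Qed.

Lemma le_cintegrable f (g : T -> R) : cmeasurable f ->
  mu.-integrable setT (EFin \o g) -> (forall x, cmod (f x) <= g x) ->
  cintegrable mu f.
Proof.
move=> [f1 f2] ig fg; split.
  apply: (le_integrable _ _ _ ig) => //; first exact/measurable_EFinP.
  move=> x _; rewrite lee_fin (le_trans (ler_Re_cmod _))//.
  by rewrite (le_trans (fg x))// ler_norm.
apply: (le_integrable _ _ _ ig) => //; first exact/measurable_EFinP.
move=> x _; rewrite lee_fin (le_trans (ler_Im_cmod _))//.
by rewrite (le_trans (fg x))// ler_norm.
Qed.

Lemma cintegrable_cmod f : cintegrable mu f ->
  mu.-integrable setT (fun x => (cmod (f x))%:E).
Proof.
move=> cf; have mf := cintegrable_cmeasurable cf.
have [f1 f2] := cf.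
apply: (le_integrable _ _ _ (integrableD _ (integrable_abse f1) (integrable_abse f2))) => //.
  exact/measurable_EFinP/measurable_cmod.
move=> x _ /=; rewrite lee_fin ger0_norm ?cmod_ge0//.
by rewrite ger0_norm ?ler_cmod_ReIm// addr_ge0.
Qed.

Lemma eq_cintegral f g : f =1 g -> \cint f = \cint g.
Proof. by move=> /funext ->. Qed.

Lemma cintegrableD f g : cintegrable mu f -> cintegrable mu g ->
  cintegrable mu (fun x => f x + g x).
Proof.
move=> [f1 f2] [g1 g2]; split.
  by under eq_fun do rewrite cReD EFinD; exact: integrableD.
by under eq_fun do rewrite cImD EFinD; exact: integrableD.
Qed.

Lemma cintegralD f g : cintegrable mu f -> cintegrable mu g ->
  \cint (fun x => f x + g x) = \cint f + \cint g.
Proof.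
move=> [f1 f2] [g1 g2]; apply: complexP; rewrite ?(cReD, cImD)/=.
  by under eq_Rintegral do rewrite cReD; exact: RintegralD.
by under eq_Rintegral do rewrite cImD; exact: RintegralD.
Qed.

Lemma cintegrableZ (c : R[i]) f : cintegrable mu f ->
  cintegrable mu (fun x => c * f x).
Proof.
move=> cf; apply: (@le_cintegrable _ (fun x => cmod c * cmod (f x))).
- apply: cmeasurableM; first exact: cmeasurable_cst.
  exact: cintegrable_cmeasurable.
- under [_ \o _]eq_fun do rewrite /= EFinM.
  exact/integrableZl/cintegrable_cmod.
- by move=> x; rewrite cmodM.
Qed.

Lemma cintegralZ (c : R[i]) f : cintegrable mu f ->
  \cint (fun x => c * f x) = c * \cint f.
Proof.
move=> [f1 f2].
have Z (r : R) (h : T -> R) : mu.-integrable setT (EFin \o h) ->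
    mu.-integrable setT (EFin \o (fun x => r * h x)).
  by move=> ih; rewrite /comp; under eq_fun do rewrite EFinM; exact: integrableZl.
apply: complexP; rewrite ?(cReM, cImM)/=.
  under eq_Rintegral do rewrite cReM.
  by rewrite RintegralB ?RintegralZl//; exact: Z.
under eq_Rintegral do rewrite cImM.
by rewrite RintegralD ?RintegralZl//; exact: Z.
Qed.

Lemma cintegral0 : \cint (fun=> 0) = 0.
Proof. by apply: complexP => /=; rewrite /Rintegral integral0. Qed.

Lemma cintegrable0 : cintegrable mu (fun=> 0).
Proof. by split; exact: integrable0. Qed.

Lemma cintegrable_sum (I : Type) (r : seq I) (P : pred I) (f : I -> T -> R[i]) :
  (forall i, cintegrable mu (f i)) ->
  cintegrable mu (fun x => \sum_(i <- r | P i) f i x).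
Proof.
move=> mf; elim: r => [|i r IH].
  by under eq_fun do rewrite big_nil; exact: cintegrable0.
under eq_fun do rewrite big_cons.
by case: (P i) => //; exact: cintegrableD.
Qed.

Lemma cintegral_sum (I : Type) (r : seq I) (P : pred I) (f : I -> T -> R[i]) :
  (forall i, cintegrable mu (f i)) ->
  \cint (fun x => \sum_(i <- r | P i) f i x) = \sum_(i <- r | P i) \cint (f i).
Proof.
move=> mf; elim: r => [|i r IH].
  by under eq_cintegral do rewrite big_nil; rewrite big_nil cintegral0.
under eq_cintegral do rewrite big_cons.
rewrite big_cons; case: (P i) => //.
by rewrite cintegralD// ?IH//; exact: cintegrable_sum.
Qed.

Lemma ae_eq_cintegral f g : cmeasurable f -> cmeasurable g ->
  {ae mu, forall x, f x = g x} -> \cint f = \cint g.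
Proof.
move=> [f1 f2] [g1 g2] fg; apply: complexP => /=; congr fine;
  apply: ae_eq_integral => //; do ?exact/measurable_EFinP;
  by apply: filterS fg => x /= ->.
Qed.

Lemma cintegral_mkcond (D : set T) f :
  cintegral mu D f = \cint (fun x => if x \in D then f x else 0).
Proof.
apply: complexP; rewrite /= Rintegral_mkcond; apply: eq_Rintegral => x _;
  by rewrite patchE; case: ifPn.
Qed.

(** Convergence and domination are asked at every point, so that the limit is measurable by itself
    and its integrability can be part of the conclusion. *)
Lemma dominated_ccvg (f_ : nat -> T -> R[i]) f (g : T -> R) :
  (forall n, cmeasurable (f_ n)) -> (forall x, ccvg (f_ ^~ x) (f x)) ->
  mu.-integrable setT (EFin \o g) -> (forall n x, cmod (f_ n x) <= g x) ->
  cintegrable mu f /\ ccvg (fun n => \cint (f_ n)) (\cint f).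
Proof.
move=> mf_ f_f ig f_g.
have mf : cmeasurable f.
  split.
    apply: (@measurable_fun_cvg _ _ _ _ (fun n x => complex.Re (f_ n x))).
      by move=> n; have [] := mf_ n.
    by move=> x _; have [] := f_f x.
  apply: (@measurable_fun_cvg _ _ _ _ (fun n x => complex.Im (f_ n x))).
    by move=> n; have [] := mf_ n.
  by move=> x _; have [] := f_f x.
(* One argument for both coordinates: [p] stands for the real or the imaginary part. *)
have aux (p : R[i] -> R) : (forall z, `|p z| <= cmod z) ->
    (forall n, measurable_fun setT (p \o f_ n)) -> measurable_fun setT (p \o f) ->
    (forall x, p (f_ n x) @[n --> \oo] --> p (f x)) ->
    mu.-integrable setT (EFin \o (p \o f)) /\
    \int[mu]_x (p (f_ n x)) @[n --> \oo] --> \int[mu]_x (p (f x)).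
  move=> pc pmf_ pmf pf.
  have pfE x : (p (f_ n x))%:E @[n --> \oo] --> (p (f x))%:E.
    by apply: cvg_EFin; [exact: nearW|exact: pf].
  have [i1 _ i2] := @dominated_convergence _ _ _ mu _ measurableT
    (fun n x => (p (f_ n x))%:E) (fun x => (p (f x))%:E) (EFin \o g)
    (fun n => (measurable_EFinP _ _).2 (pmf_ n)) ((measurable_EFinP _ _).2 pmf)
    (aeW _ (fun x _ => pfE x)) ig
    (aeW _ (fun x n _ => le_trans (pc (f_ n x)) (f_g n x))).
  split=> //; apply: fine_cvg; rewrite fineK//.
  exact: integrable_fin_num.
have [r1 r2] := aux (@complex.Re R) (@ler_Re_cmod R) (fun n => (mf_ n).1) mf.1
  (fun x => (f_f x).1).
have [j1 j2] := aux (@complex.Im R) (@ler_Im_cmod R) (fun n => (mf_ n).2) mf.2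
  (fun x => (f_f x).2).
by split.
Qed.

End cintegral.

Section cintegral_pushforward.
Context {d1 d2} {T1 : measurableType d1} {T2 : measurableType d2} {R : realType}.
Variables (mu : {measure set T1 -> \bar R}) (nu : {measure set T2 -> \bar R}).
Variable phi : T1 -> T2.
Hypothesis mphi : measurable_fun setT phi.
Hypothesis nuE : forall A, measurable A -> nu A = mu (phi @^-1` A).

Let pf : {measure set T2 -> \bar R} :=
  measure_function_pushforward__canonical__measure_function_Measure mu mphi.

Let integral_nu f : (\int[nu]_x f x = \int[pushforward mu phi]_x f x)%E.
Proof. by apply: (@eq_measure_integral _ _ _ _ pf) => A mA _; exact: nuE. Qed.

Let ireal (f : T2 -> R) : measurable_fun setT f ->
  mu.-integrable setT (fun x => (f (phi x))%:E) ->
  nu.-integrable setT (EFin \o f) /\ \int[nu]_x f x = \int[mu]_x f (phi x).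
Proof.
move=> mf imf.
have mf' : measurable_fun setT (EFin \o f) by exact/measurable_EFinP.
split; last by rewrite /Rintegral integral_nu integral_pushforward.
have /integrableP[_ h] := integrable_pushforward mphi mf' imf measurableT.
by apply/integrableP; split => //; rewrite integral_nu.
Qed.

(** [nu] only has to agree with the image measure on measurable sets, so that it may be
    [lebesgue_tuple] at a successor as well as Lebesgue measure seen as the image of a multiple of
    itself. *)
Lemma cintegrable_pushforward (f : T2 -> R[i]) : cmeasurable f ->
  cintegrable mu (fun x => f (phi x)) -> cintegrable nu f.
Proof. by move=> [f1 f2] [/(ireal f1)[i1 _] /(ireal f2)[i2 _]]. Qed.

Lemma cintegral_pushforward (f : T2 -> R[i]) : cmeasurable f ->
  cintegrable mu (fun x => f (phi x)) ->
  cintegral nu setT f = cintegral mu setT (fun x => f (phi x)).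
Proof.
by move=> [f1 f2] [/(ireal f1)[_ i1] /(ireal f2)[_ i2]]; apply: complexP.
Qed.

End cintegral_pushforward.

(** * Fubini's theorem for complex-valued functions *)

Section cfubini.
Context {d1 d2} {T1 : measurableType d1} {T2 : measurableType d2} {R : realType}.
Variables (m1 : {sigma_finite_measure set T1 -> \bar R}).
Variables (m2 : {sigma_finite_measure set T2 -> \bar R}).

Let fubini_real (f : T1 * T2 -> R) :
  (m1 \x m2)%E.-integrable setT (EFin \o f) ->
  (m1.-integrable setT (fun x => (\int[m2]_y f (x, y))%:E) /\
   \int[(m1 \x m2)%E]_z f z = \int[m1]_x \int[m2]_y f (x, y)) /\
  (m2.-integrable setT (fun y => (\int[m1]_x f (x, y))%:E) /\
   \int[(m1 \x m2)%E]_z f z = \int[m2]_y \int[m1]_x f (x, y)).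
Proof.
move=> If.
(* An inner integral may be infinite on a null set; [aux] shows that replacing it by its [fine] part
   changes neither integrability nor the integral. *)
have aux d (T : measurableType d) (m : {measure set T -> \bar R})
    (F : T -> \bar R) : m.-integrable setT F ->
    m.-integrable setT (EFin \o (fine \o F)) /\
    (\int[m]_x (fine (F x))%:E = \int[m]_x F x)%E.
  move=> iF.
  have aeF : {ae m, forall x, setT x -> F x = (EFin \o (fine \o F)) x}.
    apply: filterS (integrable_ae measurableT iF) => x /(_ I) Fx _ /=.
    by rewrite fineK.
  have mF : measurable_fun setT (EFin \o (fine \o F)).
    apply/measurable_EFinP; apply: (measurableT_comp (fine_measurable measurableT)).
    exact: measurable_int iF.
  have E : (\int[m]_x (fine (F x))%:E = \int[m]_x F x)%E.
    apply: ae_eq_integral => //; first exact: measurable_int iF.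
    by apply: filterS aeF => x /(_ I) ->.
  split => //; apply: (le_integrable _ mF _ iF) => //= x _.
  by case: (F x) => //=; rewrite ?normr0 leey.
have [iF EF] := aux _ _ m1 _ (integrable_fubini_F If).
have mf : measurable_fun setT (EFin \o f) by exact: measurable_int If.
(* The inner integral over the first variable is dominated by that of the modulus, which Tonelli's
   theorem makes integrable. *)
have iG0 : m2.-integrable setT (fubini_G m1 (EFin \o f)).
  apply/integrableP; split; first exact: measurable_fubini_G If.
  apply: le_lt_trans ((integrable21ltyP _ _ mf).1 If); apply: ge0_le_integral => //.
  - by apply: measurableT_comp => //; exact: measurable_fubini_G If.
  - apply: (@measurable_fun_fubini_tonelli_G _ _ _ _ _ m1 (abse \o (EFin \o f))).
      exact: measurableT_comp.
    by move=> z; exact: abse_ge0.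
  - by move=> y _; apply: le_abse_integral => //; exact: measurableT_comp.
have [iG EG] := aux _ _ m2 _ iG0.
split; split => //; rewrite /Rintegral; congr fine; apply/esym.
  by rewrite -(integral12_prod_meas1 If).
by rewrite -(integral21_prod_meas1 If).
Qed.

Variable f : T1 * T2 -> R[i].
Hypothesis If : cintegrable (m1 \x m2)%E f.

Lemma cintegral_prod12 : cintegral (m1 \x m2)%E setT f =
  cintegral m1 setT (fun x => cintegral m2 setT (fun y => f (x, y))).
Proof.
have [/fubini_real[[_ r] _] /fubini_real[[_ j] _]] := If.
exact: complexP.
Qed.

Lemma cintegral_prod21 : cintegral (m1 \x m2)%E setT f =
  cintegral m2 setT (fun y => cintegral m1 setT (fun x => f (x, y))).
Proof.
have [/fubini_real[_ [_ r]] /fubini_real[_ [_ j]]] := If.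
exact: complexP.
Qed.

Lemma cintegrable_prod12 :
  cintegrable m1 (fun x => cintegral m2 setT (fun y => f (x, y))).
Proof. by have [/fubini_real[[r _] _] /fubini_real[[j _] _]] := If. Qed.

Lemma cintegrable_prod21 :
  cintegrable m2 (fun y => cintegral m1 setT (fun x => f (x, y))).
Proof. by have [/fubini_real[_ [r _]] /fubini_real[_ [j _]]] := If. Qed.

End cfubini.

Section cintegrable_prod.
Context {d1 d2} {T1 : measurableType d1} {T2 : measurableType d2} {R : realType}.
Variables (m1 : {sigma_finite_measure set T1 -> \bar R}).
Variables (m2 : {sigma_finite_measure set T2 -> \bar R}).

Lemma cintegrable_of_cmod {d} {T : measurableType d} (mu : {measure set T -> \bar R})
    (f : T -> R[i]) :
  cmeasurable f -> (\int[mu]_x (cmod (f x))%:E < +oo)%E -> cintegrable mu f.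
Proof.
move=> mf fi; apply: (@le_cintegrable _ _ _ _ _ (fun x => cmod (f x))) => //.
apply/integrableP; split; first exact/measurable_EFinP/measurable_cmod.
by under eq_integral do rewrite /= ger0_norm ?cmod_ge0//.
Qed.

Lemma cintegrable_prod (f : T1 * T2 -> R[i]) (G : T1 -> R) :
  cmeasurable f -> m1.-integrable setT (EFin \o G) ->
  {ae m1, forall x, (\int[m2]_y (cmod (f (x, y)))%:E <= (G x)%:E)%E} ->
  cintegrable (m1 \x m2)%E f.
Proof.
move=> mf iG fG.
apply: cintegrable_of_cmod => //.
have mcf : measurable_fun setT (fun z => (cmod (f z))%:E).
  exact/measurable_EFinP/measurable_cmod.
rewrite fubini_tonelli1//; last by move=> x; rewrite lee_fin cmod_ge0.
have /integrableP[mG Goo] := iG.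
apply: le_lt_trans Goo; apply: ae_ge0_le_integral => //.
- by move=> x _; apply: integral_ge0 => y _; rewrite lee_fin cmod_ge0.
- apply: measurable_fun_fubini_tonelli_F => //.
  by move=> x; rewrite lee_fin cmod_ge0.
- exact: measurableT_comp.
- apply: filterS fG => x h _; apply: (le_trans h).
  by rewrite lee_fin ler_norm.
Qed.

Lemma cintegrable_mul (f : T1 -> R[i]) (g : T2 -> R[i]) :
  cintegrable m1 f -> cintegrable m2 g ->
  cintegrable (m1 \x m2)%E (fun z => f z.1 * g z.2).
Proof.
move=> If Ig.
pose G x := cmod (f x) * fine (\int[m2]_y (cmod (g y))%:E).
apply: (@cintegrable_prod _ G).
- apply: cmeasurableM.
    exact: (cmeasurableT_comp (cintegrable_cmeasurable If) measurable_fst).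
  exact: (cmeasurableT_comp (cintegrable_cmeasurable Ig) measurable_snd).
- rewrite /G /comp; under eq_fun do rewrite mulrC EFinM.
  exact/integrableZl/cintegrable_cmod.
- apply: aeW => x /=; under eq_integral do rewrite cmodM EFinM.
  have ig := cintegrable_cmod Ig.
  by rewrite integralZl// /G EFinM fineK//; exact: integrable_fin_num.
Qed.

Lemma cintegral_mul (f : T1 -> R[i]) (g : T2 -> R[i]) :
  cintegrable m1 f -> cintegrable m2 g ->
  cintegral (m1 \x m2)%E setT (fun z => f z.1 * g z.2) =
  cintegral m1 setT f * cintegral m2 setT g.
Proof.
move=> If Ig; rewrite cintegral_prod12; last exact: cintegrable_mul.
under eq_cintegral do rewrite /= cintegralZ// mulrC.
by rewrite cintegralZ// mulrC.
Qed.

End cintegrable_prod.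

(** * Affine changes of variable on the real line *)

Section affine.
Context {R : realType}.
Local Notation leb := (@lebesgue_measure R).

Let measurable_affine (a b : R) :
  measurable_fun setT (fun x : measurableTypeR R => a * x + b : measurableTypeR R).
Proof. by apply: measurable_funD => //; exact: mulrl_measurable. Qed.

Let preimage_affine_itv (a b : R) (X : set (measurableTypeR R)) :
  a != 0 -> ocitv X ->
  leb ((fun x : measurableTypeR R => a * x + b : measurableTypeR R) @^-1` X) =
  ((`|a|^-1)%:E * leb X)%E.
Proof.
move=> a0 [[x y] _ <-].
(* All kinds of endpoints are needed: under a decreasing map the preimage of an interval open on the
   left is open on the right. *)
have h (u v : R) (b0 b1 : bool) :
    leb [set` Interval (BSide b0 u) (BSide b1 v)] = (Num.max 0 (v - u))%:E.
  rewrite lebesgue_measure_itv/= lte_fin; case: ifPn => uv.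
    by rewrite max_r ?subr_ge0 ?(ltW uv)// EFinB.
  by rewrite max_l// subr_le0 leNgt.
have [a_lt0|a_gt0|/eqP] := ltgtP a 0; last by rewrite (negbTE a0).
  have -> : (fun z => a * z + b) @^-1` [set` `]x, y]] =
      [set` `[(y - b) / a, (x - b) / a[].
    apply/seteqP; split => z /=; rewrite !in_itv/= => /andP[h1 h2]; apply/andP;
      split; move: h1 h2; rewrite ?ler_ndivrMr// ?ltr_ndivlMr//; lra.
  rewrite !h ltr0_norm// -EFinM; congr EFin.
  rewrite maxr_pMr ?invr_ge0 ?oppr_ge0 ?(ltW a_lt0)// mulr0.
  by congr Num.max => /=; field; rewrite ?oppr_eq0.
have -> : (fun z => a * z + b) @^-1` [set` `]x, y]] =
    [set` `](x - b) / a, (y - b) / a]].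
  apply/seteqP; split => z /=; rewrite !in_itv/= => /andP[h1 h2]; apply/andP;
    split; move: h1 h2; rewrite ?ler_pdivlMr// ?ltr_pdivrMr//; lra.
rewrite !h gtr0_norm// -EFinM; congr EFin.
rewrite maxr_pMr ?invr_ge0 ?(ltW a_gt0)// mulr0.
by congr Num.max => /=; field; rewrite ?oppr_eq0.
Qed.

Lemma lebesgue_measure_affine (a b : R) (A : set (measurableTypeR R)) :
  a != 0 -> measurable A ->
  (`|a|%:E * leb ((fun x : measurableTypeR R => (a * x + b)%R) @^-1` A))%E = leb A.
Proof.
move=> a0 mA.
have c0 : 0 <= `|a| by [].
pose pf : {measure set (measurableTypeR R) -> \bar R} :=
  measure_function_pushforward__canonical__measure_function_Measure leb
    (measurable_affine a b).
pose nu : {measure set (measurableTypeR R) -> \bar R} := mscale (NngNum c0) pf.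
apply/esym; apply: (@lebesgue_measure_unique _ nu _ A mA) => X ocX.
rewrite /nu/= /mscale/= /pushforward preimage_affine_itv//.
by rewrite muleA -EFinM mulfV ?normr_eq0// mul1e.
Qed.

(** Lebesgue measure is the image of [|a|^-1] times itself under the inverse map [psi], and
    composing the integrand [f (a * x + b)] with [psi] gives back [f]. *)
Lemma cintegral_affine (a b : R) (f : R -> R[i]) : a != 0 -> cmeasurable f ->
  cintegrable leb f ->
  cintegrable leb (fun x => f (a * x + b)) /\
  cintegral leb setT (fun x => f (a * x + b)) =
  (`|a|^-1)%:C * cintegral leb setT f.
Proof.
move=> a0 mf If.
have c0 : 0 <= `|a|^-1 by rewrite invr_ge0.
have scale (h : R -> R) : leb.-integrable setT (EFin \o h) ->
    (mscale (NngNum c0) leb).-integrable setT (EFin \o h) /\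
    \int[mscale (NngNum c0) leb]_x h x = `|a|^-1 * \int[leb]_x h x.
  move=> ih; have mh : measurable_fun setT (EFin \o h) by exact: measurable_int ih.
  split.
    apply/integrableP; split => //.
    rewrite ge0_integral_mscale//; last exact: measurableT_comp.
    have /integrableP[_ h1] := ih.
    by rewrite lte_mul_pinfty// lee_fin.
  rewrite /Rintegral integralE [in RHS]integralE !ge0_integral_mscale//=;
    do ?[exact: measurable_funepos|exact: measurable_funeneg].
  have p1 := integrable_fin_num measurableT (integrable_funepos measurableT ih).
  have p2 := integrable_fin_num measurableT (integrable_funeneg measurableT ih).
  by rewrite -(fineK p1) -(fineK p2) -!EFinM -!EFinB/= mulrBr.
have [i1 i2] := If.
have [/= j1 e1] := scale _ i1.
have [/= j2 e2] := scale _ i2.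
pose nu : {measure set (measurableTypeR R) -> \bar R} := mscale (NngNum c0) leb.
pose psi (x : measurableTypeR R) : measurableTypeR R := a^-1 * x + (- b / a).
have psiK x : a * psi x + b = x by rewrite /psi; field.
have nuE A : measurable A -> leb A = nu (psi @^-1` A).
  move=> mA; rewrite -(@lebesgue_measure_affine a^-1 (- b / a) A) ?invr_eq0//.
  by rewrite /nu/= /mscale/= normfV.
have mg : cmeasurable (fun x : measurableTypeR R => f (a * x + b)).
  exact: (cmeasurableT_comp mf (measurable_affine a b)).
have fE : (fun x => f (a * psi x + b)) = f by apply/funext => x; rewrite psiK.
have mpsi : measurable_fun setT psi by exact: measurable_affine.
have ig : cintegrable nu (fun x => f (a * psi x + b)) by rewrite fE.
split; first exact: (cintegrable_pushforward mpsi nuE mg ig).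
rewrite (cintegral_pushforward mpsi nuE mg ig) fE.
by apply: complexP; rewrite ?(cReM, cImM)/= mul0r ?(subr0, addr0).
Qed.

End affine.

(** * Exponential and powers *)

Section cexp.
Context {R : realType}.
Implicit Types (z w : R[i]) (x y t : R).

Lemma cexpD z w : cexp (z + w) = cexp z * cexp w.
Proof.
case: z w => [a b] [c d]; rewrite /cexp/= expRD cosD sinD.
by apply: complexP; rewrite ?(cReM, cImM)/=; ring.
Qed.

Lemma cexp_real x : cexp x%:C = (expR x)%:C.
Proof. by rewrite /cexp/= cos0 sin0; apply: complexP; rewrite ?(cReM, cImM)/=; ring. Qed.

Lemma cexp0 : cexp (0 : R[i]) = 1.
Proof. by rewrite (cexp_real 0) expR0. Qed.

Lemma cmod_cexp z : cmod (cexp z) = expR (complex.Re z).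
Proof.
rewrite /cexp cmodM cmod_real ger0_norm ?expR_ge0//.
by rewrite [X in _ * X]/cmod/= cos2Dsin2 sqrtr1 mulr1.
Qed.

Lemma cexp_neq0 z : cexp z != 0.
Proof. by rewrite -cmod_eq0 cmod_cexp expR_eq0. Qed.

Lemma cexp_sum (I : Type) (r : seq I) (F : I -> R[i]) :
  cexp (\sum_(i <- r) F i) = \prod_(i <- r) cexp (F i).
Proof. exact: (big_morph _ cexpD cexp0). Qed.

Lemma cmeasurable_cexp {d} {T : measurableType d} (f : T -> R[i]) :
  cmeasurable f -> cmeasurable (fun u => cexp (f u)).
Proof.
move=> [f1 f2].
have me := measurableT_comp (@measurable_expR R) f1.
have mc := measurableT_comp (continuous_measurable_fun (@continuous_cos R)) f2.
have ms := measurableT_comp (continuous_measurable_fun (@continuous_sin R)) f2.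
split.
  apply: eq_measurable_fun (measurable_funM me mc) => x _ /=.
  by rewrite mul0r subr0.
apply: eq_measurable_fun (measurable_funM me ms) => x _ /=.
by rewrite mul0r addr0.
Qed.

Lemma cln_real t : 0 < t -> cln t%:C = (ln t)%:C.
Proof.
move=> t0; rewrite /cln /carg/= lexx cmod_real gtr0_norm//.
by rewrite divff ?gt_eqF// acos1.
Qed.

Lemma cpowE z w : z != 0 -> cpow z w = cexp (w * cln z).
Proof. by rewrite /cpow => /negbTE ->. Qed.

Lemma Re_gt0_neq0 z : 0 < complex.Re z -> z != 0.
Proof. by apply: contraTneq => ->; rewrite /= ltxx. Qed.

Lemma cpow_real t w : 0 < t -> cpow t%:C w = cexp (w * (ln t)%:C).
Proof. by move=> t0; rewrite cpowE ?cln_real// Re_gt0_neq0. Qed.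

Lemma cpow_neq0 z w : z != 0 -> cpow z w != 0.
Proof. by move=> /cpowE ->; exact: cexp_neq0. Qed.

Lemma cpowD z w v : z != 0 -> cpow z (w + v) = cpow z w * cpow z v.
Proof. by move=> z0; rewrite !cpowE// mulrDl cexpD. Qed.

Lemma cpow0 z : cpow z 0 = 1.
Proof. by rewrite /cpow; case: ifPn => _; rewrite ?eqxx// mul0r cexp0. Qed.

Lemma cpowN z w : z != 0 -> cpow z (- w) = (cpow z w)^-1.
Proof.
move=> z0; apply: (mulIf (cpow_neq0 w z0)).
by rewrite -cpowD// addNr cpow0 mulVf// cpow_neq0.
Qed.

Lemma cpow_realM t s w : 0 < t -> 0 < s ->
  cpow (t * s)%:C w = cpow t%:C w * cpow s%:C w.
Proof.
move=> t0 s0; rewrite !cpow_real ?mulr_gt0// lnM ?posrE// -cexpD -mulrDr.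
by rewrite rmorphD.
Qed.

Lemma cmod_cpow_real t w : 0 < t -> cmod (cpow t%:C w) = t `^ complex.Re w.
Proof.
move=> t0; rewrite cpow_real// cmod_cexp cReM/= mulr0 subr0.
by rewrite /powR gt_eqF.
Qed.

(** On the right half-plane, where all [t_i] and [1 - <t>] lie, the case distinction on the sign of
    [Im z] disappears. This gives measurability, the derivative of [cln] along vertical lines and
    the bound [pi / 2] on the argument. *)
Lemma carg_Re_gt0 z : 0 < complex.Re z ->
  carg z = atan (complex.Im z / complex.Re z).
Proof.
case: z => a b /= a0; rewrite /carg/= /cmod/=.
have -> : a / Num.sqrt (a ^+ 2 + b ^+ 2) = cos (atan (b / a)).
  rewrite cos_atan.
  have -> : a ^+ 2 + b ^+ 2 = a ^+ 2 * (1 + (b / a) ^+ 2).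
    by field; rewrite gt_eqF.
  rewrite sqrtrM ?sqr_ge0// sqrtr_sqr gtr0_norm// invfM mulrA divff ?gt_eqF//.
  by rewrite mul1r.
have pi2 : pi / 2 <= pi :> R.
  by rewrite ler_pdivrMr// ler_peMr ?pi_ge0// ler1n.
case: ifPn => b0.
  rewrite cosK// in_itv/=; apply/andP; split.
    by rewrite -(@atan0 R) le_atan// divr_ge0// ltW.
  by rewrite ltW// (lt_le_trans (atan_ltpi2 _)).
rewrite cosKN ?opprK//; apply/andP; split.
  by rewrite ltW// (le_lt_trans _ (atan_gtNpi2 _))// lerN2.
rewrite -[X in _ <= X](@atan0 R) le_atan// mulr_le0_ge0 ?invr_ge0 ?(ltW a0)//.
by rewrite ltW// ltNge.
Qed.

Lemma cexp_cln z : 0 < complex.Re z -> cexp (cln z) = z.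
Proof.
case: z => a b /= a0.
have s0 : 0 < cmod (a +i* b) by rewrite cmod_gt0 Re_gt0_neq0.
have aE : cmod (a +i* b) = a * Num.sqrt (1 + (b / a) ^+ 2).
  rewrite /cmod/=.
  have -> : a ^+ 2 + b ^+ 2 = a ^+ 2 * (1 + (b / a) ^+ 2).
    by field; rewrite gt_eqF.
  by rewrite sqrtrM ?sqr_ge0// sqrtr_sqr gtr0_norm.
have q0 : Num.sqrt (1 + (b / a) ^+ 2) != 0.
  by rewrite gt_eqF// sqrtr_gt0 ltr_pwDl// sqr_ge0.
have ca : cos (atan (b / a)) != 0 by rewrite cos_atan invr_eq0.
have sa : sin (atan (b / a)) = b / a * cos (atan (b / a)).
  by rewrite -{2}(atanK (b / a)) /tan divfK.
rewrite /cexp/= lnK ?posrE// carg_Re_gt0//=.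
apply: complexP; rewrite ?(cReM, cImM)/= ?mul0r ?subr0 ?addr0 ?sa cos_atan aE.
  by field.
by field; rewrite q0 gt_eqF.
Qed.

Lemma cpow1 z : 0 < complex.Re z -> cpow z 1 = z.
Proof. by move=> z0; rewrite cpowE ?Re_gt0_neq0// mul1r cexp_cln. Qed.

Lemma cpow_nat z n : 0 < complex.Re z -> cpow z n%:R = z ^+ n.
Proof.
move=> z0; elim: n => [|n IH]; first by rewrite cpow0.
by rewrite -addn1 natrD cpowD ?Re_gt0_neq0// IH cpow1// exprD expr1.
Qed.

(** The modulus of [z ^ w] is [|z| ^ Re w * exp (- Im w * arg z)], and the argument is at most
    [pi / 2] in absolute value. *)
Lemma cmod_cpow_le z w : 0 < complex.Re z ->
  cmod (cpow z w) <= cmod z `^ complex.Re w * expR (`|complex.Im w| * (pi / 2)).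
Proof.
move=> z0; have z_neq0 := Re_gt0_neq0 z0.
rewrite cpowE// cmod_cexp cReM/= expRB -expRN carg_Re_gt0//.
rewrite /powR cmod_eq0 (negbTE z_neq0) ler_wpM2l ?expR_ge0// ler_expR.
rewrite (le_trans (ler_norm _))// normrN normrM ler_wpM2l//.
by rewrite ler_norml !ltW// ?atan_gtNpi2 ?atan_ltpi2.
Qed.

Lemma cmeasurable_cpow {d} {T : measurableType d} (f : T -> R[i]) w :
  cmeasurable f -> (forall u, 0 < complex.Re (f u)) ->
  cmeasurable (fun u => cpow (f u) w).
Proof.
move=> mf f0; under eq_fun do rewrite cpowE ?Re_gt0_neq0//.
apply: cmeasurable_cexp; apply: cmeasurableM; first exact: cmeasurable_cst.
have [f1 f2] := mf; split => /=.
  apply: measurableT_comp; first exact: measurable_ln.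
  exact: measurable_cmod.
under eq_fun do rewrite carg_Re_gt0//.
apply: measurableT_comp.
  by apply: continuous_measurable_fun => y; exact: continuous_atan.
apply: measurable_funM => //.
apply: eq_measurable_fun (measurableT_comp (@measurable_powR R (- 1)) f1).
by move=> x _ /=; rewrite powR_inv1// ltW.
Qed.

Lemma cmeasurable_cpow_if (g h : R -> R[i]) w : cmeasurable h -> cmeasurable g ->
  cmeasurable (fun t => if 0 < t then cpow t%:C w * h t else g t).
Proof.
move=> mh mg.
have -> : (fun t : R => if 0 < t then cpow t%:C w * h t else g t) =
    fun t => if 0 < t then cexp (w * (ln t)%:C) * h t else g t.
  by apply/funext => t; case: ifPn => // t0; rewrite cpow_real.
apply: cmeasurable_if => //.
  by apply: measurable_fun_ltr => //; exact: measurable_cst.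
apply: cmeasurableM => //; apply: cmeasurable_cexp; apply: cmeasurableM.
  exact: cmeasurable_cst.
by apply: cmeasurable_real; exact: measurable_ln.
Qed.

End cexp.

Definition is_cderive {R : realType} (x : R) (f : R -> R[i]) (df : R[i]) :=
  is_derive x 1 (fun y => complex.Re (f y)) (complex.Re df) /\
  is_derive x 1 (fun y => complex.Im (f y)) (complex.Im df).

(** * Derivatives of complex-valued functions *)

Section is_cderive.
Context {R : realType}.
Implicit Types (x : R) (f g : R -> R[i]) (df dg : R[i]).

Lemma is_cderive_eq x f df dg : is_cderive x f df -> df = dg -> is_cderive x f dg.
Proof. by move=> + <-. Qed.

Lemma is_cderive_cst x (c : R[i]) : is_cderive x (fun=> c) 0.
Proof. by split; exact: is_derive_cst. Qed.

Lemma is_cderiveM x f g df dg : is_cderive x f df -> is_cderive x g dg ->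
  is_cderive x (fun y => f y * g y) (df * g x + f x * dg).
Proof.
move=> [f1 f2] [g1 g2]; split.
  under eq_fun do rewrite cReM.
  apply: (is_derive_eq (is_deriveB (is_deriveM f1 g1) (is_deriveM f2 g2))).
  by rewrite cReD !cReM /GRing.scale/=; ring.
under eq_fun do rewrite cImM.
apply: (is_derive_eq (is_deriveD (is_deriveM f1 g2) (is_deriveM f2 g1))).
by rewrite cImD !cImM /GRing.scale/=; ring.
Qed.

Lemma is_cderiveZ x (c : R[i]) f df : is_cderive x f df ->
  is_cderive x (fun y => c * f y) (c * df).
Proof.
move=> h; apply: (is_cderive_eq (is_cderiveM (is_cderive_cst x c) h)).
by rewrite mul0r add0r.
Qed.

Lemma is_cderive_real x (f : R -> R) (df : R) : is_derive x 1 f df ->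
  is_cderive x (fun y => (f y)%:C) df%:C.
Proof. by move=> h; split => //=; exact: is_derive_cst. Qed.

Lemma is_cderive_cexp x f df : is_cderive x f df ->
  is_cderive x (fun y => cexp (f y)) (df * cexp (f x)).
Proof.
move=> [f1 f2].
have de := is_derive1_comp (is_derive_expR (complex.Re (f x))) f1.
have dc := is_derive1_comp (is_derive_cos (complex.Im (f x))) f2.
have ds := is_derive1_comp (is_derive_sin (complex.Im (f x))) f2.
have dcs : is_cderive x
    (fun y => cos (complex.Im (f y)) +i* sin (complex.Im (f y)))
    ((- sin (complex.Im (f x)) * complex.Im df) +i*
     (cos (complex.Im (f x)) * complex.Im df)) by split; [exact: dc|exact: ds].
apply: (is_cderive_eq (is_cderiveM (is_cderive_real de) dcs)).
by apply: complexP; rewrite ?(cReD, cImD, cReM, cImM)/= ?cReM ?cImM/=; ring.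
Qed.

(** The function is written [cexp (w * (ln t)%:C)], which is [cpow t%:C w] for positive [t] only: a
    single expression on the whole line can be differentiated without a local change of function. *)
Lemma is_cderive_cpow_real x w : 0 < x ->
  is_cderive x (fun t => cexp (w * (ln t)%:C)) (w * cpow x%:C (w - 1)).
Proof.
move=> x0.
apply: (is_cderive_eq (is_cderive_cexp
  (is_cderiveZ w (is_cderive_real (is_derive1_ln x0))))).
have x_neq0 : x%:C != 0 :> R[i] by rewrite Re_gt0_neq0.
rewrite cpowD// cpowN// cpow1// cpow_real// -mulrA; congr (_ * _).
by rewrite mulrC fmorphV.
Qed.

Lemma is_cderive_cpow_line (a y : R) w : 0 < a ->
  is_cderive y (fun t => cpow (a +i* t) w)
    ('i * (w * cpow (a +i* y) (w - 1))).
Proof.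
move=> a0.
have -> : (fun t => cpow (a +i* t) w) = (fun t => cexp (w * cln (a +i* t))).
  by apply/funext => t; rewrite cpowE// Re_gt0_neq0.
have r0 : 0 < a ^+ 2 + y ^+ 2 by rewrite ltr_pwDl ?exprn_gt0// sqr_ge0.
have dl : is_cderive y (fun t => cln (a +i* t)) ('i / (a +i* y)).
  have dq : is_derive y 1 (fun t : R => a ^+ 2 + t ^+ 2) (2 * y).
    apply: (is_derive_eq (is_deriveD (is_derive_cst (a ^+ 2) y 1)
      (is_deriveX 2 (is_derive_id y 1)))).
    by rewrite add0r /GRing.scale/= expr1 mulr1.
  have s0 : 0 < Num.sqrt (a ^+ 2 + y ^+ 2) by rewrite sqrtr_gt0.
  have s2 : Num.sqrt (a ^+ 2 + y ^+ 2) ^+ 2 = a ^+ 2 + y ^+ 2.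
    by rewrite sqr_sqrtr// ltW.
  split => /=.
    rewrite /cmod/=.
    have ds := @is_derive1_comp _ Num.sqrt (fun t : R => a ^+ 2 + t ^+ 2) y _ _
      (is_derive1_sqrt r0) dq.
    have dl := @is_derive1_comp _ (@ln R) (Num.sqrt \o (fun t : R => a ^+ 2 + t ^+ 2))
      y _ _ (is_derive1_ln s0) ds.
    apply: (is_derive_eq dl).
    by rewrite -[in RHS]s2; field; rewrite gt_eqF.
  under eq_fun do rewrite carg_Re_gt0//=.
  have dd : is_derive y 1 (fun t : R => t / a) a^-1.
    apply: (is_derive_eq (is_deriveM (is_derive_id y 1)
      (is_derive_cst a^-1 y 1))).
    by rewrite /GRing.scale/= mulr0 add0r mulr1.
  apply: (is_derive_eq (@is_derive1_comp _ (@atan R) (fun t : R => t / a) y _ _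
    (is_derive1_atan (y / a)) dd)).
  by field; rewrite !gt_eqF//= ltr_pwDr// ?sqr_ge0// exprn_gt0.
apply: (is_cderive_eq (is_cderive_cexp (is_cderiveZ w dl))).
have z0 : a +i* y != 0 by rewrite Re_gt0_neq0.
rewrite cpowD// cpowN// cpow1// cpowE//; field.
exact: z0.
Qed.

Lemma is_cderive_0_cst f x y : (forall z, is_cderive z f 0) -> f x = f y.
Proof.
move=> f0; apply: complexP.
  by apply: (@is_derive_0_is_cst _ (fun t => complex.Re (f t))) => z;
    have [] := f0 z.
by apply: (@is_derive_0_is_cst _ (fun t => complex.Im (f t))) => z;
  have [] := f0 z.
Qed.

End is_cderive.

(** * The fundamental theorem of calculus on the open half-line *)

Section improper_FTC.
Context {R : realType}.
Local Notation leb := (@lebesgue_measure R).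
Implicit Types f F : R -> R.

(** The truncation starts at 2 so that the interval is nondegenerate already for [n = 0]. *)
Let cut f n x := if n.+2%:R^-1 <= x <= n.+2%:R then f x else 0.

Let cutE f n : EFin \o cut f n = (EFin \o f) \_ `[n.+2%:R^-1, n.+2%:R].
Proof.
by apply/funext => x; rewrite patchE /cut mem_setE in_itv/= /cut; case: ifP.
Qed.

Let n2V_lt n : n.+2%:R^-1 < n.+2%:R :> R.
Proof.
by rewrite (@lt_trans _ _ 1)// ?invf_lt1// ltr1n.
Qed.

Let cut_within f n : (forall x : R, 0 < x -> {for x, continuous f}) ->
  {within `[n.+2%:R^-1, n.+2%:R], continuous f}.
Proof.
move=> cf; apply: continuous_in_subspaceT => x; rewrite inE/= in_itv/=.
by move=> /andP[h _]; apply: cf; apply: lt_le_trans h; rewrite invr_gt0.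
Qed.

Let FTC_cut f F n : (forall x : R, 0 < x -> {for x, continuous f}) ->
  (forall x : R, 0 < x -> is_derive x 1 F (f x)) ->
  leb.-integrable setT (EFin \o cut f n) /\
  (\int[leb]_x (cut f n x)%:E = (F n.+2%:R - F n.+2%:R^-1)%:E)%E.
Proof.
move=> cf dF.
have cF x : 0 < x -> {for x, continuous F}.
  move=> x0; apply: differentiable_continuous; apply/derivable1_diffP.
  by have [] := dF _ x0.
split.
  rewrite cutE; apply/(integrable_mkcond _ _).1 => //.
  apply: continuous_compact_integrable; first exact: segment_compact.
  exact: cut_within.
rewrite -[X in integral _ _ X]/(EFin \o cut f n) cutE.
rewrite -integral_mkcond (@continuous_FTC2 _ _ F)//.
- exact: cut_within.
- split.
  + move=> x; rewrite in_itv/= => /andP[h _].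
    by have [] := dF x (lt_trans _ h); rewrite ?invr_gt0//.
  + by apply: cvg_at_right_filter; apply: cF; rewrite invr_gt0.
  + by apply: cvg_at_left_filter; exact: cF.
- move=> x; rewrite in_itv/= => /andP[h _].
  have [|_ e] := dF x; last by rewrite derive1E.
  by apply: lt_trans h; rewrite invr_gt0.
Qed.

Let cut_cvg f x : cut f n x @[n --> \oo] --> (if 0 < x then f x else 0).
Proof.
apply: cvg_near_cst; case: ifPn => x0; last first.
  apply: nearW => n; rewrite /cut; case: ifPn => // /andP[h _].
  by move: x0; rewrite (lt_le_trans _ h)// invr_gt0.
near=> n.
have xn : x <= n.+2%:R.
  rewrite (@le_trans _ _ n%:R)//; last by rewrite ler_nat ltnW// ltnW.
  by near: n; exact: nbhs_infty_ger.
have xn' : x^-1 <= n.+2%:R.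
  rewrite (@le_trans _ _ n%:R)//; last by rewrite ler_nat ltnW// ltnW.
  by near: n; exact: nbhs_infty_ger.
by rewrite /cut xn -[x in _ <= x]invrK lef_pV2 ?posrE ?invr_gt0// xn'.
Unshelve. all: by end_near. Qed.

(** By monotone convergence: the truncated integrals are differences of two values of [F], hence at
    most [M + M]. *)
Lemma integrable_ge0_improper f F (M : R) :
  (forall x : R, 0 < x -> {for x, continuous f}) ->
  (forall x : R, 0 < x -> is_derive x 1 F (f x)) ->
  (forall x : R, 0 < x -> 0 <= f x) -> (forall x : R, 0 < x -> `|F x| <= M) ->
  leb.-integrable setT (fun x => (if 0 < x then f x else 0)%:E).
Proof.
move=> cf dF f0 FM.
have cut0 n x : 0 <= cut f n x.
  rewrite /cut; case: ifPn => // /andP[h _]; apply: f0.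
  by apply: lt_le_trans h; rewrite invr_gt0.
have mcut n : measurable_fun setT (fun x => (cut f n x)%:E).
  by have [/measurable_int] := FTC_cut n cf dF.
have cvgE x : (cut f n x)%:E @[n --> \oo] --> (if 0 < x then f x else 0)%:E.
  by apply: cvg_EFin; [exact: nearW|exact: cut_cvg].
apply/integrableP; split.
  apply: (@emeasurable_fun_cvg _ _ _ _ (fun n x => (cut f n x)%:E)) => [m|x _].
    exact: mcut.
  exact: cvgE.
have nd x (n m : nat) : (n <= m)%N -> ((cut f n x)%:E <= (cut f m x)%:E)%E.
  move=> nm; rewrite lee_fin {1}/cut; case: ifPn => [/andP[h1 h2]|_]; last exact: cut0.
  rewrite /cut (le_trans h2) ?ler_nat// andbT (le_trans _ h1)//.
  by rewrite lef_pV2 ?posrE// ler_nat.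
have h : (\int[leb]_x (cut f n x)%:E)%E @[n --> \oo] -->
    (\int[leb]_x limn (fun n => (cut f n x)%:E))%E.
  apply: cvg_monotone_convergence => // [n x _|x _ n m].
    by rewrite lee_fin.
  exact: nd.
have e : (\int[leb]_x `|(if 0 < x then f x else 0)%:E| =
    \int[leb]_x limn (fun n => (cut f n x)%:E))%E.
  apply: eq_integral; move=> x _; rewrite (cvg_lim _ (cvgE x))//= ger0_norm//.
  by case: ifPn => // /f0.
rewrite e.
apply: (@le_lt_trans _ _ (M + M)%:E); last exact: ltry.
rewrite -(cvg_lim _ h)//; apply: lime_le; first by apply/cvg_ex; eexists; exact: h.
apply: nearW => n; have [_ ->] := FTC_cut n cf dF.
rewrite lee_fin (le_trans (ler_norm _))// (le_trans (ler_normB _ _))//.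
by rewrite lerD ?FM ?invr_gt0.
Qed.

(** Once integrability is known no sign is required: the function dominates its own truncations. *)
Lemma integral_improper f F (a b : R) :
  (forall x : R, 0 < x -> {for x, continuous f}) ->
  (forall x : R, 0 < x -> is_derive x 1 F (f x)) ->
  leb.-integrable setT (fun x => (if 0 < x then f x else 0)%:E) ->
  (F n.+2%:R @[n --> \oo] --> b) -> (F n.+2%:R^-1 @[n --> \oo] --> a) ->
  \int[leb]_x (if 0 < x then f x else 0) = b - a.
Proof.
move=> cf dF If Fb Fa.
have cvgE x : (cut f n x)%:E @[n --> \oo] --> (if 0 < x then f x else 0)%:E.
  by apply: cvg_EFin; [exact: nearW|exact: cut_cvg].
have h : (\int[leb]_x (cut f n x)%:E)%E @[n --> \oo] -->
    (\int[leb]_x (if (0 < x)%R then f x else 0)%:E)%E.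
  have [||||| //] := @dominated_convergence _ _ _ leb _ measurableT
    (fun n x => (cut f n x)%:E) (fun x => (if 0 < x then f x else 0)%:E)
    (fun x => `|(if 0 < x then f x else 0)%:E|)%E.
  - by move=> n; have [/measurable_int] := FTC_cut n cf dF.
  - exact: measurable_int If.
  - by apply: aeW => x _; exact: cvgE.
  - exact: integrable_abse If.
  - apply: aeW => x n _; rewrite /= lee_fin /cut.
    case: ifPn => [/andP[e _]|_]; last by rewrite normr0.
    by rewrite (lt_le_trans _ e)// invr_gt0.
have {}h : (F n.+2%:R - F n.+2%:R^-1) @[n --> \oo] -->
    \int[leb]_x (if 0 < x then f x else 0).
  have e n : (\int[leb]_x (cut f n x)%:E = (F n.+2%:R - F n.+2%:R^-1)%:E)%E.
    by have [_ ->] := FTC_cut n cf dF.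
  have -> : (fun n => F n.+2%:R - F n.+2%:R^-1) =
      fine \o (fun n => \int[leb]_x (cut f n x)%:E)%E.
    by apply/funext => n; rewrite /= e.
  by apply: fine_cvg; rewrite fineK//; exact: integrable_fin_num.
by apply: (cvg_unique _ h); [exact: Rhausdorff|exact: cvgB].
Qed.

End improper_FTC.

(** * The real majorants *)

Section integrability.
Context {R : realType}.
Local Notation leb := (@lebesgue_measure R).

Lemma is_derive_continuous (f : R -> R) (x df : R) :
  is_derive x 1 f df -> {for x, continuous f}.
Proof.
by move=> [h _]; apply: differentiable_continuous; exact/derivable1_diffP.
Qed.

(** Taking [s]-th roots with [d = c / s], it suffices that [1 + x <= K exp (d x)]; this holds for
    [K = 1 + 1 / d] because [exp (d x) >= 1 + d x]. *)
Lemma expR_dominates_powR (s c : R) : 0 < s -> 0 < c ->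
  exists2 C : R, 0 < C & forall x, 0 < x -> (1 + x) `^ s <= C * expR (c * x).
Proof.
move=> s0 c0; pose d := c / s; have d0 : 0 < d by rewrite divr_gt0.
pose K := 1 + d^-1; have K0 : 0 < K by rewrite addr_gt0// invr_gt0.
exists (K `^ s) => [|x x0]; first by rewrite powR_gt0.
have -> : expR (c * x) = expR (d * x) `^ s.
  by rewrite -expRM mulrAC divfK// gt_eqF.
rewrite -powRM ?expR_ge0 ?(ltW K0)//.
rewrite ge0_ler_powR ?(ltW s0) ?nnegrE ?mulr_ge0 ?expR_ge0 ?(ltW K0)//.
  by rewrite addr_ge0// ltW.
apply: (@le_trans _ _ (K * (1 + d * x))).
  rewrite /K mulrDl mul1r mulrDr mulKf ?gt_eqF// mulr1.
  have : 0 < d * x by rewrite mulr_gt0.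
  have : 0 < d^-1 by rewrite invr_gt0.
  lra.
by rewrite ler_wpM2l ?(ltW K0)// expR_ge1Dx.
Qed.

Let is_derive_frac (x : R) : 0 < x ->
  is_derive x 1 (fun y : R => y / (1 + y)) ((1 + x) ^- 2).
Proof.
move=> x0; have x1 : 1 + x != 0 by rewrite gt_eqF// addr_gt0.
have d1 : is_derive x 1 (fun y : R => 1 + y) 1.
  apply: (is_derive_eq (is_deriveD (is_derive_cst (1 : R) x 1) (is_derive_id x 1))).
  by rewrite add0r.
apply: (is_derive_eq (is_deriveM (is_derive_id x 1) (is_deriveV x1 d1))).
by rewrite /GRing.scale/=; field.
Qed.

(** Comparison with [(x / (1 + x)) ^ (p - 1) (1 + x) ^ (- 2)], which has the same behaviour at 0 and
    the bounded primitive [(x / (1 + x)) ^ p / p]. The quotient is [(1 + x) ^ (p + 1) exp (- c x)],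
    bounded by [expR_dominates_powR]. *)
Lemma integrable_powR_expR (p c : R) : 0 < p -> 0 < c ->
  leb.-integrable setT
    (fun x => (if 0 < x then x `^ (p - 1) * expR (- (c * x)) else 0)%:E).
Proof.
move=> p0 c0.
pose u (x : R) := x / (1 + x).
have u0 x : 0 < x -> 0 < u x by move=> x0; rewrite divr_gt0// addr_gt0.
pose f x := u x `^ (p - 1) * (1 + x) ^- 2.
pose F x := p^-1 * u x `^ p.
have If : leb.-integrable setT (fun x => (if 0 < x then f x else 0)%:E).
  apply: (@integrable_ge0_improper _ f F p^-1).
  - move=> x x0; have x1 : (1 + x) ^+ 2 != 0.
      by rewrite gt_eqF// exprn_gt0// addr_gt0.
    have d2 : is_derive x 1 (fun y : R => (1 + y) ^+ 2) (2 * (1 + x)).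
      apply: (is_derive_eq (is_deriveX 2 (is_deriveD (is_derive_cst (1 : R) x 1)
        (is_derive_id x 1)))).
      by rewrite add0r /GRing.scale/= mulr1 expr1.
    apply: is_derive_continuous.
    have dV := @is_deriveV _ (fun y : R => (1 + y) ^+ 2) x _ 1 x1 d2.
    have dP := @is_derive1_comp _ (@powR R ^~ (p - 1)) u x _ _
      (is_derive1_powR (p - 1) (u0 _ x0)) (is_derive_frac x0).
    exact: (is_deriveM dP dV).
  - move=> x x0.
    have dp := @is_derive1_comp _ (@powR R ^~ p) u x _ _
      (is_derive1_powR p (u0 _ x0)) (is_derive_frac x0).
    apply: (is_derive_eq (is_deriveZ p^-1 dp)).
    by rewrite /GRing.scale/= mulrA mulKf// gt_eqF.
  - by move=> x x0; rewrite mulr_ge0 ?powR_ge0// invr_ge0 sqr_ge0.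
  - move=> x x0; rewrite ger0_norm ?mulr_ge0 ?powR_ge0 ?invr_ge0 ?(ltW p0)//.
    rewrite ler_piMr ?invr_ge0 ?(ltW p0)//.
    have -> : 1 = 1 `^ p :> R by rewrite powR1.
    rewrite ge0_ler_powR ?(ltW p0) ?nnegrE ?(ltW (u0 _ x0))//.
    by rewrite /u ler_pdivrMr ?addr_gt0// mul1r lerDr.
have p10 : 0 < p + 1 by rewrite addr_gt0.
have [C C0 hC] := expR_dominates_powR p10 c0.
apply: (le_integrable _ _ _ (integrableZl _ C If)) => //.
  apply/measurable_EFinP.
  apply: measurable_fun_ifT => //.
  - by apply: measurable_fun_ltr => //; exact: measurable_cst.
  - apply: measurable_funM; first exact: measurable_powR.
    apply: measurableT_comp; first exact: measurable_expR.
    by apply: measurableT_comp => //; exact: mulrl_measurable.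
move=> x _; rewrite -EFinM lee_fin; case: ifPn => x0; last first.
  by rewrite mulr0.
have x1 : 0 < 1 + x by rewrite addr_gt0.
rewrite !ger0_norm ?mulr_ge0 ?powR_ge0 ?expR_ge0 ?invr_ge0 ?sqr_ge0 ?(ltW C0)//.
rewrite /f /u powRM ?invr_ge0 ?(ltW x0) ?(ltW x1)//.
rewrite -[(x `^ _ * _) * _]mulrA mulrCA ler_wpM2l ?powR_ge0//.
have -> : (1 + x)^-1 `^ (p - 1) = (1 + x) `^ (1 - p).
  by rewrite -powR_inv1 ?(ltW x1)// -powRrM; congr powR; ring.
have -> : (1 + x) ^- 2 = (1 + x) `^ (- 2%:R) by rewrite powR_invn// ltW.
rewrite -powRD; last by rewrite (gt_eqF x1) implybT.
rewrite expRN.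
have -> : 1 - p + - 2%:R = - (p + 1) by ring.
by rewrite powRN ler_pdivlMr ?powR_gt0// mulrC ler_pdivrMr ?expR_gt0// hC.
Qed.

Lemma integrable_1Dnorm_powR (q : R) : 1 < q ->
  leb.-integrable setT (fun x : R => ((1 + `|x|) `^ (- q))%:E).
Proof.
move=> q1; have q0 : 0 < q - 1 by rewrite subr_gt0.
pose f (x : R) := (1 + x) `^ (- q).
pose F (x : R) := - (q - 1)^-1 * (1 + x) `^ (1 - q).
pose h x := if 0 < x then f x else 0.
have d1 (x : R) : is_derive x 1 (fun y : R => 1 + y) 1.
  apply: (is_derive_eq (is_deriveD (is_derive_cst (1 : R) x 1) (is_derive_id x 1))).
  by rewrite add0r.
have Ih : leb.-integrable setT (fun x => (h x)%:E).
  apply: (@integrable_ge0_improper _ f F (q - 1)^-1) => x x0;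
    have x1 : 0 < 1 + x by rewrite addr_gt0.
  - apply: is_derive_continuous.
    exact: (@is_derive1_comp _ (@powR R ^~ (- q)) (fun y => 1 + y) x _ _
      (is_derive1_powR (- q) x1) (d1 x)).
  - have dp := @is_derive1_comp _ (@powR R ^~ (1 - q)) (fun y => 1 + y) x _ _
      (is_derive1_powR (1 - q) x1) (d1 x).
    apply: (is_derive_eq (is_deriveZ (- (q - 1)^-1) dp)).
    rewrite /GRing.scale/= mulr1 /f.
    have -> : 1 - q - 1 = - q by ring.
    by rewrite mulrA; have -> : - (q - 1)^-1 * (1 - q) = 1;
      [field; rewrite gt_eqF|rewrite mul1r].
  - exact: powR_ge0.
  - rewrite /F mulNr normrN ger0_norm ?mulr_ge0 ?powR_ge0 ?invr_ge0 ?(ltW q0)//.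
    rewrite ler_piMr ?invr_ge0 ?(ltW q0)//.
    rewrite -[leRHS](powRr0 (1 + x)) ler_powR ?lerDl ?(ltW x0)//.
    by rewrite subr_le0 ltW.
have mh : cmeasurable (fun x => (h x)%:C).
  by apply: cmeasurable_real; apply/measurable_EFinP; exact: measurable_int Ih.
have Ih' : cintegrable leb (fun x => (h x)%:C) by split => //; exact: integrable0.
have N10 : - 1 != 0 :> R by rewrite oppr_eq0.
have [[Ihn _] _] := cintegral_affine 0 N10 mh Ih'.
(* [h] and its reflection both vanish at the origin; the indicator of that point supplies the
   missing value 1. *)
have I0 := @integrable_indic_itv R 0 0 true false.
apply: (le_integrable _ _ _ (integrableD _ (integrableD _ Ih Ihn) I0)) => //.
  apply/measurable_EFinP.
  have m1 : measurable_fun setT (fun x : R => 1 + `|x|).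
    by apply: measurable_funD => //; exact: normr_measurable.
  exact: (measurableT_comp (measurable_powR (- q)) m1).
move=> x _ /=; rewrite lee_fin ger0_norm ?powR_ge0//.
rewrite (le_trans _ (ler_norm _))// /h /f mulN1r addr0 indicE.
have [x0|x0|->] := ltgtP x 0.
- rewrite oppr_gt0 x0 add0r ler0_norm ?(ltW x0)// lerDl//.
- by rewrite oppr_gt0 (lt_gtF x0) addr0 gtr0_norm// lerDl.
- rewrite oppr0 ltxx !add0r normr0 addr0 powR1 mem_set//=.
  by rewrite in_itv/= lexx.
Qed.

Lemma integral_oneDsqr :
  leb.-integrable setT (fun x : R => ((1 + x ^+ 2)^-1)%:E) /\
  \int[leb]_x (1 + x ^+ 2)^-1 = pi.
Proof.
have E : (\int[leb]_x ((1 + x ^+ 2)^-1)%:E = pi%:E)%E.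
  have -> : (\int[leb]_x ((1 + x ^+ 2)^-1)%:E =
      2%:E * \int[leb]_(x in [set x : R | (0 <= x)%R]) ((1 + x ^+ 2)^-1)%:E)%E.
    apply: (@ge0_symfun_integralT R (fun x => (1 + x ^+ 2)^-1)).
    - by move=> x; rewrite invr_ge0 addr_ge0// sqr_ge0.
    - exact: continuous_oneDsqrV.
    - by move=> x; rewrite /= sqrrN.
  rewrite -set_itvcy.
  have -> := @integral0y_oneDsqr R.
  by rewrite -EFinM mulrC divfK.
split; last by rewrite /Rintegral E.
apply/integrableP; split.
  apply/measurable_EFinP; apply: continuous_measurable_fun.
  exact: continuous_oneDsqrV.
under eq_integral do rewrite /= ger0_norm ?invr_ge0 ?addr_ge0 ?sqr_ge0//.
by rewrite E ltry.
Qed.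

End integrability.

(** * Differentiation under the integral sign *)

Section cderive_under_integral.
Context {R : realType} {d} {Y : measurableType d}.
Variable mu : {measure set Y -> \bar R}.

Lemma is_cderive_under_integral (f f' : R -> Y -> R[i]) (G : Y -> R) (a u v : R) :
  u < a < v ->
  (forall x, u < x < v -> cintegrable mu (f x)) ->
  (forall x y, u < x < v -> is_cderive x (f ^~ y) (f' x y)) ->
  mu.-integrable setT (EFin \o G) ->
  (forall x y, u < x < v -> cmod (f' x y) <= G y) ->
  is_cderive a (fun x => cintegral mu setT (f x)) (cintegral mu setT (f' a)).
Proof.
move=> auv If df IG fG.
have aI : [set` `]u, v[] a by rewrite /= in_itv.
have G0 y : 0 <= G y by rewrite (le_trans (cmod_ge0 _) (fG a y auv)).
have aux (p : R[i] -> R) : (forall z, `|p z| <= cmod z) ->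
    (forall x, u < x < v -> mu.-integrable setT (EFin \o (p \o f x))) ->
    (forall x y, u < x < v -> is_derive x 1 (fun t => p (f t y)) (p (f' x y))) ->
    is_derive a 1 (fun x => \int[mu]_y p (f x y)) (\int[mu]_y p (f' a y)).
  move=> pc pf pd.
  have h1 x : [set` `]u, v[] x -> mu.-integrable setT (EFin \o (fun y => p (f x y))).
    by rewrite /= in_itv; exact: pf.
  have h2 x y : [set` `]u, v[] x -> [set: Y] y -> derivable (fun t => p (f t y)) x 1.
    by rewrite /= in_itv => /(pd x y)[].
  have h3 x y : [set` `]u, v[] x -> [set: Y] y ->
      `|partial1of2 (fun t y => p (f t y)) x y| <= G y.
    rewrite /= in_itv => xuv _; rewrite partial1of2E.
    have [_ ->] := pd x y xuv.
    by rewrite (le_trans (pc _))// fG.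
  split; first exact: (derivable_under_integral measurableT aI h1 h2 G0 IG h3).
  rewrite -derive1E (differentiation_under_integral measurableT aI h1 h2 G0 IG h3).
  apply: eq_Rintegral => y _; rewrite partial1of2E.
  by have [_ ->] := pd a y auv.
split.
  apply: (aux (@complex.Re R)); first exact: ler_Re_cmod.
    by move=> x /If[].
  by move=> x y /(df x y)[].
apply: (aux (@complex.Im R)); first exact: ler_Im_cmod.
  by move=> x /If[].
by move=> x y /(df x y)[].
Qed.

End cderive_under_integral.

(** The derivative [f'] provides the continuity of [f] that the real version asks for. *)
Lemma cintegral_improper {R : realType} (f F : R -> R[i]) (f' : R -> R[i]) (a b : R[i]) :
  (forall x : R, 0 < x -> is_cderive x F (f x)) ->
  (forall x : R, 0 < x -> is_cderive x f (f' x)) ->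
  cintegrable (@lebesgue_measure R) (fun x => if 0 < x then f x else 0) ->
  ccvg (fun n => F n.+2%:R) b -> ccvg (fun n => F n.+2%:R^-1) a ->
  cintegral (@lebesgue_measure R) setT (fun x => if 0 < x then f x else 0) = b - a.
Proof.
move=> dF df [i1 i2] [b1 b2] [a1 a2].
have fifE (p : R[i] -> R) : p 0 = 0 ->
    (fun x => p (if 0 < x then f x else 0)) = fun x => if 0 < x then p (f x) else 0.
  by move=> p0; apply/funext => x; case: ifP.
apply: complexP; rewrite ?(cReD, cReN, cImD, cImN)/=.
  rewrite -[RHS](@integral_improper _ (fun x => complex.Re (f x))
    (fun x => complex.Re (F x))) ?(fifE (@complex.Re R))//.
  - by move=> x /df[/is_derive_continuous].
  - by move=> x /dF[].
  - by have := i1; under eq_fun do rewrite (fun_if (@complex.Re R)).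
rewrite -[RHS](@integral_improper _ (fun x => complex.Im (f x))
  (fun x => complex.Im (F x))) ?(fifE (@complex.Im R))//.
- by move=> x /df[_ /is_derive_continuous].
- by move=> x /dF[].
- by have := i2; under eq_fun do rewrite (fun_if (@complex.Im R)).
Qed.

(** * The Gamma function *)

Section gamma.
Context {R : realType}.
Local Notation leb := (@lebesgue_measure R).
Implicit Types (z q : R[i]) (s c r : R).

(** The integrand of the Laplace transform at [z] of [s ^ (q - 1)], extended by 0 to the whole line
    so that convolutions and reflections need no domain. The value [z = 0], where it is not
    integrable, gives the factors of the beta integral. *)
Definition gker z q (s : R) : R[i] :=
  if 0 < s then cpow s%:C (q - 1) * cexp (- z * s%:C) else 0.

Lemma cmod_gker z q s : cmod (gker z q s) =
  if 0 < s then s `^ (complex.Re q - 1) * expR (- (complex.Re z * s)) else 0.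
Proof.
rewrite /gker; case: ifPn => s0; last by rewrite cmod0.
rewrite cmodM cmod_cpow_real// cReD cReN/= cmod_cexp cReM/= mulr0 subr0.
by rewrite cReN mulNr.
Qed.

Lemma cmeasurable_gker z q : cmeasurable (gker z q).
Proof.
apply: cmeasurable_cpow_if; last exact: cmeasurable_cst.
apply: cmeasurable_cexp; apply: cmeasurableM; first exact: cmeasurable_cst.
exact: cmeasurable_real.
Qed.

Lemma cintegrable_gker z q : 0 < complex.Re z -> 0 < complex.Re q ->
  cintegrable leb (gker z q).
Proof.
move=> z0 q0; apply: (@le_cintegrable _ _ _ leb _ (fun s => if 0 < s then
  s `^ (complex.Re q - 1) * expR (- (complex.Re z * s)) else 0)).
- exact: cmeasurable_gker.
- exact: integrable_powR_expR.
- by move=> s; rewrite cmod_gker.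
Qed.

Lemma cgammaE q : cgamma q = cintegral leb setT (gker 1 q).
Proof.
rewrite /cgamma cintegral_mkcond; apply: eq_cintegral => s.
rewrite /gker mem_setE in_itv/= andbT; case: ifP => // _.
by rewrite -cexp_real rmorphN mulN1r.
Qed.

Let is_cderive_cexpN z s :
  is_cderive s (fun t => cexp (- z * t%:C)) (- z * cexp (- z * s%:C)).
Proof.
apply: (is_cderive_eq (is_cderive_cexp
  (is_cderiveZ (- z) (is_cderive_real (is_derive_id s 1))))).
by rewrite mulr1.
Qed.

(** [gker z (q + 1)] without its case distinction, in a form that can be differentiated. *)
Let gpos z q s := cexp (q * (ln s)%:C) * cexp (- z * s%:C).

Let gposE z q s : 0 < s -> gpos z q s = gker z (q + 1) s.
Proof. by move=> s0; rewrite /gker s0 addrK cpow_real. Qed.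

Let is_cderive_gpos z q s : 0 < s ->
  is_cderive s (gpos z q) (q * gpos z (q - 1) s - z * gpos z q s).
Proof.
move=> s0.
apply: (is_cderive_eq (is_cderiveM (is_cderive_cpow_real q s0)
  (is_cderive_cexpN z s))).
by rewrite cpow_real// /gpos; ring.
Qed.

(** Integration by parts: the derivative of [s ^ q exp (- z s)] is the difference of the two
    integrands, and this function tends to 0 at both ends. *)
Lemma gker_rec z q : 0 < complex.Re z -> 0 < complex.Re q ->
  q * cintegral leb setT (gker z q) = z * cintegral leb setT (gker z (q + 1)).
Proof.
move=> z0 q0.
have q10 : 0 < complex.Re (q + 1) by rewrite cReD/= addr_gt0.
have I1 := cintegrable_gker z0 q0.
have I2 := cintegrable_gker z0 q10.
pose f s := q * gpos z (q - 1) s - z * gpos z q s.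
have fE : (fun s => q * gker z q s + (- z) * gker z (q + 1) s) =
    (fun s => if 0 < s then f s else 0).
  apply/funext => s; case: ifPn => s0; last first.
    by rewrite /gker (negbTE s0) !mulr0 addr0.
  by rewrite /f !gposE// subrK mulNr.
have cmodF s : 0 < s -> cmod (gpos z q s) =
    s `^ complex.Re q * expR (- (complex.Re z * s)).
  by move=> s0; rewrite gposE// cmod_gker s0 cReD/= addrK.
apply/eqP; rewrite -subr_eq0 -mulNr; apply/eqP.
rewrite -!cintegralZ// -cintegralD; [|exact: cintegrableZ..].
rewrite fE -[RHS](subr0 0).
apply: (@cintegral_improper _ f (gpos z q)
  (fun s => q * ((q - 1) * gpos z (q - 1 - 1) s - z * gpos z (q - 1) s)
    - z * (q * gpos z (q - 1) s - z * gpos z q s))).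
- by move=> s s0; exact: is_cderive_gpos.
- move=> s s0.
  have d1 := is_cderiveZ q (is_cderive_gpos z (q - 1) s0).
  have d2 := is_cderiveZ (- z) (is_cderive_gpos z q s0).
  have -> : f = fun s => q * gpos z (q - 1) s + (- z) * gpos z q s.
    by apply/funext => t; rewrite /f mulNr.
  split.
    under eq_fun do rewrite cReD.
    apply: (is_derive_eq (is_deriveD d1.1 d2.1)).
    by rewrite -cReD mulNr.
  under eq_fun do rewrite cImD.
  apply: (is_derive_eq (is_deriveD d1.2 d2.2)).
  by rewrite -cImD mulNr.
- rewrite -fE; apply: cintegrableD; exact: cintegrableZ.
(* The exponential is made to dominate one power more than the one present, which leaves a decay in
   [1 / s] at infinity. *)
- have q20 : 0 < complex.Re q + 1 by rewrite addr_gt0.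
  have [C C0 hC] := expR_dominates_powR q20 z0.
  apply/ccvg_cmod; apply: (@squeeze_cvg0 _ _ (fun n => C * n.+1%:R^-1)).
    move=> n; rewrite cmod_ge0/= subr0 cmodF//.
    have n0 : 0 < n.+2%:R :> R by [].
    have h : n.+2%:R `^ (complex.Re q + 1) <= C * expR (complex.Re z * n.+2%:R).
      rewrite (le_trans _ (hC _ n0))// ge0_ler_powR ?(ltW q20) ?nnegrE//.
      by rewrite lerDr.
    rewrite expRN ler_pdivrMr ?expR_gt0//.
    rewrite -[leLHS](@mulfK _ n.+2%:R)// -{2}(@powRr1 _ n.+2%:R)//.
    rewrite -powRD; last by rewrite pnatr_eq0 implybT.
    rewrite ler_pdivrMr// (le_trans h)// -mulrA -mulrA ler_wpM2l ?(ltW C0)//.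
    rewrite mulrCA ler_peMr ?expR_ge0//.
    by rewrite mulrC ler_pdivlMr// mul1r ler_nat.
  rewrite -[X in _ --> X](mulr0 C); apply: cvgM.
    exact: cvg_cst.
  exact: cvg_harmonic.
- apply/ccvg_cmod; apply: (@squeeze_cvg0 _ _ (fun n => n.+2%:R^-1 `^ complex.Re q)).
    move=> n; rewrite cmod_ge0/= subr0 cmodF ?invr_gt0//.
    rewrite ler_piMr ?powR_ge0// expR_le1 oppr_le0 mulr_ge0 ?invr_ge0//.
    exact: ltW.
  have /cvg_at_rightP h := powR_cvg0 q0.
  apply: h; split=> [n|]; first by rewrite invr_gt0.
  by have := @cvg_harmonic R; rewrite -cvg_shiftS.
Qed.

Lemma cgammaS q : 0 < complex.Re q -> cgamma (q + 1) = q * cgamma q.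
Proof. by move=> q0; rewrite !cgammaE gker_rec ?mul1r//= ltr01. Qed.

Let cgamma_scale r q : 0 < r -> 0 < complex.Re q ->
  cintegral leb setT (gker r%:C q) = cgamma q * cpow r%:C (- q).
Proof.
move=> r0 q0.
have r_neq0 : r%:C != 0 :> R[i] by rewrite Re_gt0_neq0.
have rg s : gker 1 q (r * s + 0) = cpow r%:C (q - 1) * gker r%:C q s.
  rewrite /gker addr0 pmulr_rgt0//; case: ifPn => s0; last by rewrite mulr0.
  by rewrite cpow_realM// rmorphM/= mulN1r mulNr mulrA.
have I1 : cintegrable leb (gker 1 q) by apply: cintegrable_gker => //=.
have r_neq0' : r != 0 by rewrite gt_eqF.
have [_] := cintegral_affine 0 r_neq0' (cmeasurable_gker 1 q) I1.
under eq_cintegral do rewrite rg.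
rewrite cintegralZ; last exact: cintegrable_gker.
rewrite -cgammaE gtr0_norm// cpowD// cpowN// cpowN// cpow1//.
have p0 := cpow_neq0 q r_neq0.
move=> h; apply: (mulfI p0); apply: (mulIf (invr_neq0 r_neq0)).
rewrite [LHS]mulrAC h fmorphV/=; field.
exact/andP.
Qed.

(* By [gker_rec], the product of the integral by [z^q] has a zero derivative
   along the vertical line through [z]; on the real axis, rescale. *)
Lemma gker_gamma z q : 0 < complex.Re z -> 0 < complex.Re q ->
  cintegral leb setT (gker z q) = cgamma q * cpow z (- q).
Proof.
case: z => r y /= r0 q0.
have q10 : 0 < complex.Re (q + 1) by rewrite cReD/= addr_gt0.
pose A (t : R) := cintegral leb setT (gker (r +i* t) q) * cpow (r +i* t) q.
have dA t : is_cderive t A 0.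
  have z_neq0 : r +i* t != 0 by rewrite Re_gt0_neq0.
  have dG : is_cderive t (fun t => cintegral leb setT (gker (r +i* t) q))
      (- 'i * cintegral leb setT (gker (r +i* t) (q + 1))).
    rewrite -cintegralZ; last exact: cintegrable_gker.
    (* The derivative in [t] has a modulus independent of [t]; its value on the real axis serves as
       majorant, and the interval around [t] is arbitrary. *)
    apply: (@is_cderive_under_integral _ _ _ leb (fun t => gker (r +i* t) q)
       (fun t s => - 'i * gker (r +i* t) (q + 1) s)
       (fun s => cmod (gker r%:C (q + 1) s)) t (t - 1) (t + 1)).
    - by rewrite ltrBlDr !ltrDl ltr01.
    - by move=> x _; exact: cintegrable_gker.
    - move=> x s _; rewrite /gker; case: ifPn => s0; last first.
        by rewrite mulr0; exact: is_cderive_cst.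
      have s_neq0 : s%:C != 0 :> R[i] by rewrite Re_gt0_neq0.
      pose K := cpow s%:C (q - 1) * cexp (- r%:C * s%:C).
      have E w : cpow s%:C (q - 1) * cexp (- (r +i* w) * s%:C) =
          K * cexp ((- 'i * s%:C) * w%:C).
        rewrite /K -mulrA -cexpD; congr (_ * cexp _).
        have -> : r +i* w = r%:C + 'i * w%:C by rewrite [LHS]complexE.
        by ring.
      have -> : - 'i * (cpow s%:C (q + 1 - 1) * cexp (- (r +i* x) * s%:C)) =
          K * (- 'i * s%:C * 1 * cexp ((- 'i * s%:C) * x%:C)).
        rewrite addrK -[q in LHS](subrK 1) cpowD// cpow1//.
        transitivity (- 'i * s%:C * (cpow s%:C (q - 1) * cexp (- (r +i* x) * s%:C))).
          by ring.
        by rewrite E; ring.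
      under eq_fun do rewrite E.
      apply: is_cderiveZ; apply: is_cderive_cexp; apply: is_cderiveZ.
      exact: (is_cderive_real (is_derive_id x 1)).
    - by apply: cintegrable_cmod; exact: cintegrable_gker.
    - move=> x s _; rewrite cmodM !cmod_gker/= cmodN.
      by have -> : cmod ('i : R[i]) = 1;
        [rewrite /cmod/= expr0n expr1n add0r sqrtr1|rewrite mul1r].
  apply: (is_cderive_eq (is_cderiveM dG (is_cderive_cpow_line t q r0))).
  have rec := gker_rec (z := r +i* t) r0 q0.
  have -> : cpow (r +i* t) q = (r +i* t) * cpow (r +i* t) (q - 1).
    by rewrite -{2}(@cpow1 _ (r +i* t))// -cpowD// addrC subrK.
  transitivity ('i * cpow (r +i* t) (q - 1) *
    (q * cintegral leb setT (gker (r +i* t) q) -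
     (r +i* t) * cintegral leb setT (gker (r +i* t) (q + 1)))).
    by ring.
  by rewrite rec subrr mulr0.
have := is_cderive_0_cst y 0 dA; rewrite /A => h.
have z_neq0 : r +i* y != 0 by rewrite Re_gt0_neq0.
rewrite cpowN//; apply: (canRL (mulfK (cpow_neq0 q z_neq0))).
have r_neq0 : r +i* 0 != 0 by rewrite Re_gt0_neq0.
by rewrite h cgamma_scale// cpowN// mulfVK// cpow_neq0.
Qed.

End gamma.

(** * Integrals along vertical lines *)

Section inversion.
Context {R : realType}.
Local Notation leb := (@lebesgue_measure R).

Lemma ae_neq (a : R) : {ae leb, forall x, x != a}.
Proof.
exists [set a]; split; [exact: measurable_set1|exact: lebesgue_measure_set1|].
by move=> x /= /negP; rewrite negbK => /eqP.
Qed.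

Lemma eq_cintegral_neq (f g : R -> R[i]) (a : R) :
  cmeasurable f -> cmeasurable g -> (forall x, x != a -> f x = g x) ->
  cintegral leb setT f = cintegral leb setT g.
Proof.
move=> mf mg fg; apply: ae_eq_cintegral => //.
by have [N [mN N0 Na]] := ae_neq a; exists N; split => // x /= h; apply: Na => /= /fg.
Qed.

Lemma cgamma1 : cgamma 1 = 1 :> R[i].
Proof.
have c0 (x : R) : is_cderive x (fun t => cexp (- t%:C)) (- cexp (- x%:C)).
  have -> : (fun t : R => cexp (- t%:C)) = fun t => cexp ((- 1) * t%:C).
    by apply/funext => t; rewrite mulN1r.
  apply: (is_cderive_eq (is_cderive_cexp (is_cderiveZ (- 1)
    (is_cderive_real (is_derive_id x 1))))).
  by rewrite mulr1 !mulN1r.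
have E : (fun s => gker 1 1 s) = fun s : R => if 0 < s then cexp (- s%:C) else 0.
  apply/funext => s; rewrite /gker; case: ifP => // s0.
  by rewrite subrr cpow0 mul1r mulN1r.
have r0 : 0 < complex.Re (1 : R[i]) by [].
have I := cintegrable_gker r0 r0.
have cE (t : R) : cexp (- t%:C) = (expR (- t))%:C by rewrite -cexp_real rmorphN.
rewrite cgammaE -[gker 1 1]/(fun s => gker 1 1 s) E -[RHS](subr0 1).
have -> : 1 - 0 = 0 - (- 1) :> R[i] by rewrite subr0 sub0r opprK.
apply: (@cintegral_improper _ _ (fun t => (- 1) * cexp (- t%:C))
  (fun x => - cexp (- x%:C))).
- by move=> x _; apply: (is_cderive_eq (is_cderiveZ (- 1) (c0 x))); rewrite mulN1r opprK.
- by move=> x _; exact: c0.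
- by rewrite -E.
- apply/ccvg_cmod; apply: (@squeeze_cvg0 _ _ (fun n => n.+1%:R^-1)).
    move=> n; rewrite cmod_ge0/= subr0 cmodM cmodN cmod1 mul1r cE cmod_real.
    rewrite ger0_norm ?expR_ge0// expRN lef_pV2 ?posrE ?expR_gt0//.
    apply: (le_trans _ (expR_ge1Dx _)).
    have : n.+1%:R <= n.+2%:R :> R by rewrite ler_nat.
    lra.
  exact: cvg_harmonic.
- rewrite -[X in ccvg _ X]mulr1; apply: ccvgM; first exact: ccvg_cst.
  under eq_fun do rewrite cE.
  split => /=; last exact: cvg_cst.
  rewrite -[X in _ --> X](@expR0 R).
  have h : - (n.+2%:R^-1 : R) @[n --> \oo] --> (0 : R).
    rewrite -oppr0; apply: cvgN.
    by have := @cvg_harmonic R; rewrite -cvg_shiftS.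
  by apply: continuous_cvg; [exact: continuous_expR|exact: h].
Qed.

(* [exp (- eps |tau|)], except at the origin where it vanishes. *)
Let w (eps tau : R) : R[i] := gker eps%:C 1 tau + gker eps%:C 1 (- tau).

Let wE eps tau : w eps tau = (if tau == 0 then 0 else expR (- (eps * `|tau|)))%:C.
Proof.
have g1 t : 0 < t -> gker eps%:C 1 t = (expR (- (eps * t)))%:C.
  move=> t0; rewrite /gker t0 subrr cpow0 mul1r -cexp_real.
  by rewrite mulNr -rmorphM rmorphN.
have g2 t : t <= 0 -> gker eps%:C 1 t = 0.
  by rewrite /gker leNgt => /negbTE ->.
rewrite /w; have [t0|t0|->] := ltgtP tau 0.
- by rewrite (g2 tau) ?(ltW t0)// g1 ?oppr_gt0// add0r ltr0_norm.
- by rewrite g1// (g2 (- tau)) ?oppr_le0 ?(ltW t0)// addr0 gtr0_norm.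
- by rewrite oppr0 !g2// addr0.
Qed.

Let cmeasurable_reflect (f : R -> R[i]) :
  cmeasurable f -> cmeasurable (fun x : R => f (- x)).
Proof. by move=> mf; apply: (cmeasurableT_comp mf); exact: oppr_measurable. Qed.

Let cintegral_reflect (f : R -> R[i]) : cintegrable leb f ->
  cintegrable leb (fun x : R => f (- x)) /\
  cintegral leb setT (fun x : R => f (- x)) = cintegral leb setT f.
Proof.
move=> If.
have N10 : - 1 != 0 :> R by rewrite oppr_eq0.
have := cintegral_affine 0 N10 (cintegrable_cmeasurable If) If.
under eq_fun do rewrite mulN1r addr0.
by rewrite normrN normr1 invr1 mul1r.
Qed.

(** The Fourier transform of [exp (- eps |tau|)]: by [gker_gamma] at [q = 1] the two half-lines
    contribute [1 / (eps - i x)] and [1 / (eps + i x)], whose sum is the Poisson kernel. *)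
Let cintegral_w (eps x : R) : 0 < eps ->
  cintegrable leb (fun tau => w eps tau * cexp ('i * (tau * x)%:C)) /\
  cintegral leb setT (fun tau => w eps tau * cexp ('i * (tau * x)%:C)) =
  (2 * eps / (eps ^+ 2 + x ^+ 2))%:C.
Proof.
move=> e0; pose zp := eps +i* (- x); pose zm := eps +i* x.
have I1 : cintegrable leb (gker zp 1) by exact: cintegrable_gker.
have I2 : cintegrable leb (gker zm 1) by exact: cintegrable_gker.
have [I2' E2] := cintegral_reflect I2.
have E : (fun tau => w eps tau * cexp ('i * (tau * x)%:C)) =
    (fun tau => gker zp 1 tau + gker zm 1 (- tau)).
  apply/funext => t; rewrite /w mulrDl; congr (_ + _); rewrite /gker;
    case: ifP => _; rewrite ?mul0r// -mulrA -cexpD; congr (_ * cexp _).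
    rewrite /zp; have -> : eps +i* (- x) = eps%:C + 'i * (- x)%:C by rewrite [LHS]complexE.
    by rewrite rmorphM rmorphN; ring.
  rewrite /zm; have -> : eps +i* x = eps%:C + 'i * x%:C by rewrite [LHS]complexE.
  by rewrite rmorphM rmorphN; ring.
rewrite E; split; first exact: cintegrableD.
rewrite cintegralD// E2 !gker_gamma// cgamma1 !mul1r.
rewrite !cpowN ?Re_gt0_neq0// !cpow1//.
have n0 : eps ^+ 2 + x ^+ 2 != 0.
  by rewrite gt_eqF// ltr_pwDl ?exprn_gt0// sqr_ge0.
by apply: complexP; rewrite ?(cReD, cImD)/= ?sqrrN; field.
Qed.

Lemma cintegrable_cpow_line (sg : R) (p : R[i]) : 0 < sg -> 1 < complex.Re p ->
  cintegrable leb (fun t => cpow (sg +i* t) (- p)).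
Proof.
move=> sg0 p1.
(* With this constant [c (1 + |t|) <= |sg + i t|], because [sg] and [|t|] are both at most
   [|sg + i t|]. *)
pose c := sg / (1 + sg); have c0 : 0 < c by rewrite divr_gt0// addr_gt0.
have m1 : cmeasurable (fun t : R => cpow (sg +i* t) (- p)).
  apply: cmeasurable_cpow => //; split => //=.
pose K := c `^ (- complex.Re p) * expR (`|complex.Im p| * (pi / 2)).
apply: (@le_cintegrable _ _ _ leb _
  (fun t : R => K * (1 + `|t|) `^ (- complex.Re p))); first exact: m1.
  rewrite /comp; under eq_fun do rewrite EFinM.
  exact/integrableZl/integrable_1Dnorm_powR.
move=> t; apply: (le_trans (cmod_cpow_le _ _)) => //.
rewrite cReN cImN normrN /K mulrAC ler_wpM2r ?expR_ge0//.
rewrite -powRM ?addr_ge0 ?(ltW c0)//.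
have h : c * (1 + `|t|) <= cmod (sg +i* t).
  have h1 := ler_Re_cmod (sg +i* t); have h2 := ler_Im_cmod (sg +i* t).
  rewrite /= (gtr0_norm sg0) in h1; rewrite /= in h2.
  rewrite /c mulrAC ler_pdivrMr ?addr_gt0// mulrDr mulr1 mulrDr mulr1.
  by rewrite lerD// mulrC ler_wpM2r// ltW.
have p0 : 0 <= complex.Re p by rewrite (le_trans _ (ltW p1)).
have c1 : 0 < c * (1 + `|t|) by apply: mulr_gt0 => //; rewrite ltr_pwDl.
have z0 : 0 < cmod (sg +i* t) by exact: lt_le_trans h.
by rewrite !powRN lef_pV2 ?posrE ?powR_gt0// ge0_ler_powR ?nnegrE ?(ltW c1) ?(ltW z0).
Qed.

(* Fourier inversion for [gker sg p], whose Fourier transform is given by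
   [gker_gamma]: with the weight [w eps], Fubini's theorem turns the left-hand
   side into a Poisson integral of [gker sg p]; then let [eps] tend to [0]. *)
Lemma cintegral_cpow_line (sg s : R) (p : R[i]) : 0 < sg -> 0 < s ->
  1 < complex.Re p ->
  cgamma p * cintegral leb setT
    (fun t => cpow (sg +i* t) (- p) * cexp ((sg +i* t) * s%:C)) =
  (2 * pi)%:C * cpow s%:C (p - 1).
Proof.
move=> sg0 s0 p1; have p0 : 0 < complex.Re p by rewrite (lt_trans _ p1).
pose f := gker sg%:C p.
have If : cintegrable leb f by exact: cintegrable_gker.
pose L (t : R) := cgamma p * cpow (sg +i* t) (- p) * cexp ('i * (t * s)%:C).
have cmod_i (x : R) : cmod (cexp ('i * x%:C)) = 1.
  by rewrite cmod_cexp cReM/= mul0r mulr0 subr0 expR0.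
have cm_i (d : measure_display) (T : measurableType d) (h : T -> R) :
    measurable_fun setT h -> cmeasurable (fun x => cexp ('i * (h x)%:C)).
  move=> mh; apply: cmeasurable_cexp; apply: cmeasurableM.
    exact: cmeasurable_cst.
  exact: cmeasurable_real.
have mmul (r : R) : measurable_fun setT (fun t : R => t * r) by exact: mulrr_measurable.
have gE t : gker (sg +i* t) p = fun y => f y * cexp (- ('i * (t * y)%:C)).
  apply/funext => y; rewrite /f /gker; case: ifP => _; last by rewrite mul0r.
  rewrite -mulrA -cexpD; congr (_ * cexp _).
  have -> : sg +i* t = sg%:C + 'i * t%:C by rewrite [LHS]complexE.
  by rewrite rmorphM; ring.
(* After Fubini the kernel is the Poisson kernel at [s - y]; substituting [y = eps x + s] moves
   [eps] out of the kernel and into the argument of [f], so that a fixed integrable weight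
   remains. *)
have reg eps : 0 < eps ->
    cintegral leb setT (fun t => w eps t * L t) =
    cintegral leb setT (fun x => f (eps * x + s) * (2 * (1 + x ^+ 2)^-1)%:C).
  move=> e0.
  pose A t := w eps t * cexp ('i * (t * s)%:C).
  have [IA _] := cintegral_w s e0.
  pose H (z : R * R) := A z.1 * f z.2 * cexp (- ('i * (z.1 * z.2)%:C)).
  have IH : cintegrable (leb \x leb)%E H.
    have I2 := cintegrable_cmod (cintegrable_mul IA If).
    apply: (@le_cintegrable _ _ _ (leb \x leb)%E _ (fun z => cmod (A z.1 * f z.2))) => //.
      apply: cmeasurableM.
        exact: cintegrable_cmeasurable (cintegrable_mul IA If).
      have -> : (fun z : R * R => cexp (- ('i * (z.1 * z.2)%:C))) =
          (fun z => cexp ('i * (- (z.1 * z.2))%:C)).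
        by apply/funext => z; rewrite rmorphN mulrN.
      apply: cm_i; apply: measurableT_comp => //.
      by apply: measurable_funM.
    by move=> z; rewrite /H cmodM -mulrN -rmorphN cmod_i mulr1.
  have -> : (fun t => w eps t * L t) =
      (fun t => cintegral leb setT (fun y => H (t, y))).
    apply/funext => t.
    have It : cintegrable leb (gker (sg +i* t) p) by exact: cintegrable_gker.
    rewrite gE in It; rewrite /L -gker_gamma// gE [X in _ * X]mulrC mulrA -/(A t).
    by rewrite -cintegralZ//; apply: eq_cintegral => y; rewrite /H/= mulrA.
  rewrite -cintegral_prod12// cintegral_prod21//.
  have HE : (fun y => cintegral leb setT (fun t => H (t, y))) =
      (fun y => f y * (2 * eps / (eps ^+ 2 + (s - y) ^+ 2))%:C).
    apply/funext => y; have [Iw <-] := cintegral_w (s - y) e0.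
    rewrite -cintegralZ//; apply: eq_cintegral => t.
    have -> : cexp ('i * (t * (s - y))%:C) =
        cexp ('i * (t * s)%:C) * cexp (- ('i * (t * y)%:C)).
      by rewrite -cexpD; congr cexp; rewrite mulrBr rmorphB; ring.
    by rewrite /H/= /A; ring.
  have IG := cintegrable_prod21 IH; rewrite HE in IG *.
  have eps_neq0 : eps != 0 by rewrite gt_eqF.
  have [IG' EG] := cintegral_affine s eps_neq0 (cintegrable_cmeasurable IG) IG.
  rewrite -[LHS](mulKf (x := (`|eps|^-1)%:C)) ?Re_gt0_neq0//= ?invr_gt0 ?normr_gt0//.
  rewrite -EG -cintegralZ//; apply: eq_cintegral => x.
  rewrite mulrCA; congr (_ * _); rewrite fmorphV/= invrK -rmorphM; congr (_%:C).
  rewrite gtr0_norm//; have x2 : 1 + x ^+ 2 != 0.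
    by rewrite gt_eqF// ltr_pwDl// sqr_ge0.
  have -> : eps ^+ 2 + (s - (eps * x + s)) ^+ 2 = eps ^+ 2 * (1 + x ^+ 2) by ring.
  by field; rewrite x2.
pose e n : R := n.+1%:R^-1.
have e0 n : 0 < e n by rewrite invr_gt0.
have e_0 : e @ \oo --> (0 : R) by exact: cvg_harmonic.
have IL : cintegrable leb L.
  apply: (@le_cintegrable _ _ _ leb _
    (fun t => cmod (cgamma p * cpow (sg +i* t) (- p)))).
  - apply: cmeasurableM; last by apply: cm_i; exact: mmul.
    exact: cintegrable_cmeasurable (cintegrableZ _ (cintegrable_cpow_line sg0 p1)).
  - exact: cintegrable_cmod (cintegrableZ _ (cintegrable_cpow_line sg0 p1)).
  - by move=> t; rewrite /L cmodM cmod_i mulr1.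
have mw eps : cmeasurable (w eps).
  apply: cmeasurableD; first exact: cmeasurable_gker.
  exact: (cmeasurable_reflect (cmeasurable_gker eps%:C 1)).
have mL := cintegrable_cmeasurable IL.
have lhs : ccvg (fun n => cintegral leb setT (fun t => w (e n) t * L t))
    (cintegral leb setT L).
  (* [w eps] vanishes at the origin, so the pointwise limit of [w eps t * L t] is [L0], equal to [L]
     up to one point. *)
  pose L0 (t : R) := if t == 0 then 0 else L t.
  have mL0 : cmeasurable L0.
    apply: cmeasurable_if; [|exact: cmeasurable_cst|exact: mL].
    by apply: measurable_fun_eqr => //; exact: measurable_cst.
  rewrite -(@eq_cintegral_neq L0 L 0)//; last first.
    by move=> t t0; rewrite /L0 (negbTE t0).
  apply: (@dominated_ccvg _ _ _ leb _ _ (fun t => cmod (L t)) _ _ _ _).2.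
  - by move=> n; exact: (cmeasurableM (mw (e n)) mL).
  - move=> t; rewrite /L0; case: ifPn => t0.
      under eq_fun do rewrite wE t0 mul0r.
      exact: ccvg_cst.
    rewrite -[X in ccvg _ X]mul1r; apply: ccvgM; last exact: ccvg_cst.
    under eq_fun do rewrite wE (negbTE t0).
    split => /=; last exact: cvg_cst.
    rewrite -[X in _ --> X](@expR0 R).
    apply: continuous_cvg; first exact: continuous_expR.
    rewrite -oppr0 -[X in _ --> - X](mul0r `|t|).
    by apply: cvgN; apply: cvgM => //; exact: cvg_cst.
  - exact: cintegrable_cmod.
  - move=> n t; rewrite cmodM ler_piMl ?cmod_ge0// wE cmod_real.
    case: ifP => _; first by rewrite normr0.
    by rewrite ger0_norm ?expR_ge0// expR_le1 oppr_le0 mulr_ge0 ?(ltW (e0 n)).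
(* [f] is bounded since its exponent [Re p - 1] is positive; times the Poisson weight, this bound is
   the majorant for [rhs]. *)
have [C C0 fC] : exists2 C : R, 0 < C & forall y, cmod (f y) <= C.
  have p10 : 0 < complex.Re p - 1 by rewrite subr_gt0.
  have [C C0 hC] := expR_dominates_powR p10 sg0.
  exists C => // y; rewrite cmod_gker; case: ifP => y0; last exact: ltW.
  rewrite expRN ler_pdivrMr ?expR_gt0// (le_trans _ (hC _ y0))//.
  by rewrite ge0_ler_powR ?(ltW p10) ?nnegrE ?addr_ge0 ?(ltW y0)// lerDr.
have [Ip Ep] := @integral_oneDsqr R.
have rhs : ccvg (fun n => cintegral leb setT
     (fun x => f (e n * x + s) * (2 * (1 + x ^+ 2)^-1)%:C))
    (cintegral leb setT (fun x => f s * (2 * (1 + x ^+ 2)^-1)%:C)).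
  have mp : measurable_fun setT (fun x : R => 2 * (1 + x ^+ 2)^-1).
    apply: measurable_funM => //; apply/measurable_EFinP.
    exact: measurable_int Ip.
  apply: (@dominated_ccvg _ _ _ leb _ _ (fun x => C * (2 * (1 + x ^+ 2)^-1)) _ _ _ _).2.
  - move=> n; apply: cmeasurableM; last exact: cmeasurable_real.
    apply: (cmeasurableT_comp (cmeasurable_gker sg%:C p)).
    by apply: measurable_funD => //; exact: mulrl_measurable.
  - move=> x; apply: ccvgM; last exact: ccvg_cst.
    (* A differentiable function equal to [f] on the positive reals. It gives the continuity of [f]
       at [s], as [eps x + s] is eventually positive. *)
    pose fp y := cexp ((p - 1) * (ln y)%:C) * cexp (- sg%:C * y%:C).
    have dfp : is_cderive s fp ((p - 1) * cpow s%:C (p - 1 - 1) * cexp (- sg%:C * s%:C)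
        + cexp ((p - 1) * (ln s)%:C) * (- sg%:C * 1%:C * cexp (- sg%:C * s%:C))).
      apply: is_cderiveM; first exact: is_cderive_cpow_real.
      apply: is_cderive_cexp; apply: is_cderiveZ.
      exact: (is_cderive_real (is_derive_id s 1)).
    have es : (fun n => e n * x + s) @ \oo --> s.
      rewrite -[X in _ --> X]add0r -[X in _ --> X + _](mul0r x).
      by apply: cvgD; [apply: cvgM => //; exact: cvg_cst|exact: cvg_cst].
    have fE y : 0 < y -> f y = fp y by move=> y0; rewrite /f /gker y0 cpow_real.
    have [c1 c2] := (is_derive_continuous dfp.1, is_derive_continuous dfp.2).
    have nearE : \forall n \near \oo, fp (e n * x + s) = f (e n * x + s).
      by near=> n; rewrite fE//; near: n; exact: (cvgr_gt s es).
    split.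
      rewrite fE//; apply: cvg_trans (continuous_cvg _ c1 es).
      by apply: near_eq_cvg; apply: filterS nearE => n /(congr1 (@complex.Re R)).
    rewrite fE//; apply: cvg_trans (continuous_cvg _ c2 es).
    by apply: near_eq_cvg; apply: filterS nearE => n /(congr1 (@complex.Im R)).
  - rewrite /comp; under eq_fun do rewrite mulrA EFinM.
    exact: integrableZl.
  - move=> n x; rewrite cmodM cmod_real ger0_norm; last first.
      by rewrite mulr_ge0 ?invr_ge0 ?addr_ge0 ?sqr_ge0.
    by rewrite ler_wpM2r ?mulr_ge0 ?invr_ge0 ?addr_ge0 ?sqr_ge0.
have {lhs}E : cintegral leb setT L =
    cintegral leb setT (fun x => f s * (2 * (1 + x ^+ 2)^-1)%:C).
  apply: (ccvg_unique _ rhs); apply: eq_ccvg lhs => n; exact: reg.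
have Ec : cintegral leb setT (fun x : R => (2 * (1 + x ^+ 2)^-1)%:C) = (2 * pi)%:C.
  apply: complexP => /=; last by rewrite /Rintegral integral0.
  by rewrite RintegralZl// Ep.
have Ip' : cintegrable leb (fun x : R => (2 * (1 + x ^+ 2)^-1)%:C).
  split => /=; last exact: integrable0.
  by under eq_fun do rewrite EFinM; exact: integrableZl.
rewrite cintegralZ// Ec in E.
rewrite -cintegralZ; last first.
  apply: (@le_cintegrable _ _ _ leb _
    (fun t => expR (sg * s) * cmod (cpow (sg +i* t) (- p)))).
  - apply: cmeasurableM.
      exact: cintegrable_cmeasurable (cintegrable_cpow_line sg0 p1).
    apply: cmeasurable_cexp; apply: cmeasurableM; last exact: cmeasurable_cst.
    by split => //=; exact: measurable_cst.
  - rewrite /comp; under eq_fun do rewrite EFinM.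
    exact/integrableZl/cintegrable_cmod/cintegrable_cpow_line.
  - move=> t; rewrite cmodM mulrC ler_wpM2r ?cmod_ge0// cmod_cexp cReM/= mulr0 subr0.
    exact: lexx.
have -> : (fun t => cgamma p * (cpow (sg +i* t) (- p) * cexp ((sg +i* t) * s%:C))) =
    fun t => cexp (sg * s)%:C * L t.
  apply/funext => t.
  have -> : cexp ((sg +i* t) * s%:C) = cexp (sg * s)%:C * cexp ('i * (t * s)%:C).
    rewrite -cexpD; congr cexp.
    have -> : sg +i* t = sg%:C + 'i * t%:C by rewrite [LHS]complexE.
    by rewrite !rmorphM; ring.
  by rewrite /L; ring.
rewrite cintegralZ// E /f /gker s0.
have ee : cexp (sg * s)%:C * cexp (- sg%:C * s%:C) = 1.
  by rewrite -cexpD rmorphM mulNr subrr cexp0.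
by rewrite -[RHS]mulr1 -ee; ring.
Unshelve. all: by end_near. Qed.

End inversion.

(** * Integrals over tuples and over products of vertical lines *)

Section tuple_integral.
Context {R : realType}.
Local Notation leb := (@lebesgue_measure R).
Local Notation T n := (n.-tuple (measurableTypeR R)).

(* A zero at [q] would be a zero at [q + 1], against [cintegral_cpow_line]. *)
Lemma cgamma_neq0 (q : R[i]) : 0 < complex.Re q -> cgamma q != 0.
Proof.
move=> q0; apply/eqP => gq0.
have q1 : 1 < complex.Re (q + 1) by rewrite cReD/= ltrDr.
have := @cintegral_cpow_line R 1 1 (q + 1) ltr01 ltr01 q1.
rewrite cgammaS// gq0 mulr0 mul0r addrK => /esym/eqP; apply/negP.
rewrite mulf_neq0 ?cpow_neq0 ?Re_gt0_neq0//=.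
by rewrite mulr_gt0// pi_gt0.
Qed.

Lemma tnth_tuple_cons0 n (p : measurableTypeR R * T n) :
  tnth (tuple_cons p) ord0 = p.1.
Proof. by rewrite (tnth_nth p.1). Qed.

Lemma tnth_tuple_consS n (p : measurableTypeR R * T n) i :
  tnth (tuple_cons p) (lift ord0 i) = tnth p.2 i.
Proof. by rewrite !(tnth_nth p.1). Qed.

Lemma cintegrable_tuple_cons n (f : T n.+1 -> R[i]) : cmeasurable f ->
  cintegrable (leb \x lebesgue_tuple R n)%E (fun p => f (tuple_cons p)) ->
  cintegrable (lebesgue_tuple R n.+1) f.
Proof.
move=> mf If.
by apply: (@cintegrable_pushforward _ _ _ _ _ (leb \x lebesgue_tuple R n)%E
  (lebesgue_tuple R n.+1) (@tuple_cons _ _ _)) => //; exact: measurable_tuple_cons.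
Qed.

Lemma cintegral_tuple_cons n (f : T n.+1 -> R[i]) : cmeasurable f ->
  cintegrable (leb \x lebesgue_tuple R n)%E (fun p => f (tuple_cons p)) ->
  cintegral (lebesgue_tuple R n.+1) setT f =
  cintegral (leb \x lebesgue_tuple R n)%E setT (fun p => f (tuple_cons p)).
Proof.
move=> mf If.
by apply: (@cintegral_pushforward _ _ _ _ _ (leb \x lebesgue_tuple R n)%E
  (lebesgue_tuple R n.+1) (@tuple_cons _ _ _)) => //; exact: measurable_tuple_cons.
Qed.

Lemma cintegral_tuple0 (f : T 0 -> R[i]) : cmeasurable f ->
  cintegrable (lebesgue_tuple R 0) f /\
  cintegral (lebesgue_tuple R 0) setT f = f [tuple].
Proof.
move=> [f1 f2]; split.
  by split; apply/integrableP; split; do ?exact/measurable_EFinP;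
    rewrite integral_dirac ?diracT ?mul1e ?ltry//;
    apply: measurableT_comp => //; exact/measurable_EFinP.
apply: complexP => /=; rewrite /Rintegral integral_dirac ?diracT ?mul1e//;
  exact/measurable_EFinP.
Qed.

Lemma cmeasurable_tnth n (f : R -> R[i]) (i : 'I_n) :
  cmeasurable f -> cmeasurable (fun s : T n => f (tnth s i)).
Proof. by move=> mf; apply: (cmeasurableT_comp mf); exact: measurable_tnth. Qed.

Lemma cintegral_tuple_prod n (f : 'I_n -> R -> R[i]) :
  (forall i, cintegrable leb (f i)) ->
  cintegrable (lebesgue_tuple R n) (fun s => \prod_i f i (tnth s i)) /\
  cintegral (lebesgue_tuple R n) setT (fun s => \prod_i f i (tnth s i)) =
  \prod_i cintegral leb setT (f i).
Proof.
elim: n f => [|n IH] f If.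
  have [] := @cintegral_tuple0 (fun s => \prod_(i < 0) f i (tnth s i)).
    by apply: cmeasurable_prod => -[].
  by move=> I0 ->; split => //; rewrite !big_ord0.
have [I' E'] := IH (fun i => f (lift ord0 i)) (fun i => If _).
have m : cmeasurable (fun s : T n.+1 => \prod_i f i (tnth s i)).
  apply: cmeasurable_prod => i; apply: cmeasurable_tnth.
  exact: (cintegrable_cmeasurable (If i)).
have E : (fun p : measurableTypeR R * T n => \prod_i f i (tnth (tuple_cons p) i)) =
    (fun p => f ord0 p.1 * \prod_i f (lift ord0 i) (tnth p.2 i)).
  apply/funext => p; rewrite big_ord_recl tnth_tuple_cons0; congr (_ * _).
  by apply: eq_bigr => i _; rewrite tnth_tuple_consS.
have I2 := cintegrable_mul (If ord0) I'.
rewrite -E in I2; split; first exact: cintegrable_tuple_cons.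
by rewrite cintegral_tuple_cons// E (cintegral_mul (If ord0) I') E' big_ord_recl.
Qed.

(* Once [cgamma c * cpow (1 - \sum_i t_i) (- c)] is written as an integral by
   [gker_gamma], the variables [t_i] separate and [cintegral_cpow_line] applies
   to each of them. *)
Lemma cintegral_lines n (sg : R) (p : 'I_n -> R[i]) (c : R[i]) :
  0 < sg -> n%:R * sg < 1 ->
  (forall i, 1 < complex.Re (p i)) -> 0 < complex.Re c ->
  let t (tau : T n) i := sg +i* (tnth tau i : R) in
  let F tau := (\prod_i cpow (t tau i) (- p i)) *
    cpow (1 - \sum_i t tau i) (- c) in
  cintegrable (lebesgue_tuple R n) F /\
  (\prod_i cgamma (p i)) * cgamma c * cintegral (lebesgue_tuple R n) setT F =
  (2 * pi)%:C ^+ n * cgamma (c + \sum_i (p i - 1)).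
Proof.
move=> sg0 nsg p1 c0 t F.
have p0 i : 0 < complex.Re (p i) by rewrite (lt_trans _ (p1 i)).
have Ret tau : complex.Re (1 - \sum_i t tau i) = 1 - n%:R * sg.
  rewrite cReD cReN cRe_sum/=; congr (_ - _).
  by rewrite sumr_const card_ord mulr_natl.
have r0 : 0 < 1 - n%:R * sg by rewrite subr_gt0.
pose lam := \sum_i (p i - 1).
have lam0 : 0 <= complex.Re lam.
  rewrite /lam cRe_sum; apply: sumr_ge0 => i _.
  by rewrite cReD cReN/= subr_ge0 ltW.
pose P (tau : T n) := \prod_i cpow (t tau i) (- p i).
have [IP _] := cintegral_tuple_prod (fun i => cintegrable_cpow_line sg0 (p1 i)).
have mtau i : cmeasurable (fun tau : T n => t tau i).
  split => /=; first exact: measurable_cst.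
  exact: measurable_tnth.
have mP := cintegrable_cmeasurable IP.
have mS : cmeasurable (fun tau : T n => 1 - \sum_i t tau i).
  apply: cmeasurableD; first exact: cmeasurable_cst.
  have -> : (fun tau : T n => - \sum_i t tau i) = (fun tau => (- 1) * \sum_i t tau i).
    by apply/funext => tau; rewrite mulN1r.
  apply: cmeasurableM; first exact: cmeasurable_cst.
  by apply: cmeasurable_sum.
have mF : cmeasurable F.
  apply: cmeasurableM => //; apply: cmeasurable_cpow => // tau.
  by rewrite Ret.
have IF : cintegrable (lebesgue_tuple R n) F.
  (* The last factor is bounded, since [|1 - <t>|] is at least its real part, which has the constant
     value [1 - n sg] on the lines. *)
  pose K := (1 - n%:R * sg) `^ (- complex.Re c) * expR (`|complex.Im c| * (pi / 2)).
  apply: (@le_cintegrable _ _ _ (lebesgue_tuple R n) _ (fun tau => K * cmod (P tau))) => //.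
    rewrite /comp; under eq_fun do rewrite EFinM.
    exact/integrableZl/cintegrable_cmod.
  move=> tau; rewrite /F cmodM mulrC ler_wpM2r ?cmod_ge0//.
  apply: (le_trans (cmod_cpow_le _ _)); first by rewrite Ret.
  rewrite cReN cImN normrN ler_wpM2r ?expR_ge0//.
  have h : 1 - n%:R * sg <= cmod (1 - \sum_i t tau i).
    by rewrite -(Ret tau) (le_trans (ler_norm _))// ler_Re_cmod.
  have h0 : 0 < cmod (1 - \sum_i t tau i) by exact: lt_le_trans h.
  rewrite !powRN lef_pV2 ?posrE ?powR_gt0//.
  by rewrite ge0_ler_powR ?nnegrE ?(ltW c0) ?(ltW r0) ?(ltW h0).
split => //.
pose H (z : T n * R) := P z.1 * gker (1 - \sum_i t z.1 i) c z.2.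
have gE tau s : gker (1 - \sum_i t tau i) c s =
    gker 1 c s * \prod_i cexp (t tau i * s%:C).
  rewrite /gker; case: ifP => _; last by rewrite mul0r.
  rewrite -cexp_sum -mulrA -cexpD; congr (_ * cexp _).
  by rewrite -mulr_suml; ring.
(* The modulus of the Laplace kernel sees only the constant real part of [1 - <t>], so that of [H]
   is the modulus of a product of integrable functions of separate variables. *)
have IH : cintegrable (lebesgue_tuple R n \x leb)%E H.
  have Ig : cintegrable leb (gker (1 - n%:R * sg)%:C c) by exact: cintegrable_gker.
  have I2 := cintegrable_mul IP Ig.
  apply: (@le_cintegrable _ _ _ (lebesgue_tuple R n \x leb)%E _
    (fun z => cmod (P z.1 * gker (1 - n%:R * sg)%:C c z.2))).
  - apply: cmeasurableM; first exact: (cmeasurableT_comp mP measurable_fst).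
    have -> : (fun z : T n * R => gker (1 - \sum_i t z.1 i) c z.2) =
       (fun z => gker 1 c z.2 * \prod_i cexp (t z.1 i * z.2%:C)).
      by apply/funext => z; rewrite gE.
    apply: cmeasurableM; first exact: (cmeasurableT_comp (cmeasurable_gker 1 c) measurable_snd).
    apply: cmeasurable_prod => i; apply: cmeasurable_cexp; apply: cmeasurableM.
      exact: (cmeasurableT_comp (mtau i) measurable_fst).
    by apply: cmeasurable_real; exact: measurable_snd.
  - exact: cintegrable_cmod.
  - by move=> z; rewrite /H !cmodM !cmod_gker Ret.
have -> : (\prod_i cgamma (p i)) * cgamma c * cintegral (lebesgue_tuple R n) setT F =
    (\prod_i cgamma (p i)) * cintegral (lebesgue_tuple R n \x leb)%E setT H.
  rewrite -mulrA -cintegralZ// cintegral_prod12//; congr (_ * _).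
  apply: eq_cintegral => tau; rewrite /H /= cintegralZ; last first.
    by apply: cintegrable_gker; rewrite ?Ret.
  rewrite gker_gamma ?Ret//.
  by rewrite /F -/(P tau); ring.
rewrite cintegral_prod21// -cintegralZ; last exact: cintegrable_prod21.
rewrite cgammaE -cintegralZ; last first.
  by apply: cintegrable_gker => //=; rewrite cReD ltr_wpDr.
apply: eq_cintegral => s.
have -> : (fun tau => H (tau, s)) = (fun tau => gker 1 c s *
    \prod_i (cpow (t tau i) (- p i) * cexp (t tau i * s%:C))).
  by apply/funext => tau; rewrite /H gE [in RHS]big_split/= mulrCA.
have [s0|s0] := ltP 0 s; last first.
  rewrite [RHS]mulrC /gker ltNge s0/= mul0r.
  by under eq_cintegral do rewrite mul0r; rewrite cintegral0 mulr0.
have Ii i : cintegrable leb (fun y => cpow (sg +i* y) (- p i) * cexp ((sg +i* y) * s%:C)).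
  apply: (@le_cintegrable _ _ _ leb _
    (fun t => expR (sg * s) * cmod (cpow (sg +i* t) (- p i)))).
  - apply: cmeasurableM.
      exact: cintegrable_cmeasurable (cintegrable_cpow_line sg0 (p1 i)).
    apply: cmeasurable_cexp; apply: cmeasurableM; last exact: cmeasurable_cst.
    by split => //=; exact: measurable_cst.
  - rewrite /comp; under eq_fun do rewrite EFinM.
    exact/integrableZl/cintegrable_cmod/cintegrable_cpow_line.
  - move=> y; rewrite cmodM mulrC ler_wpM2r ?cmod_ge0// cmod_cexp cReM/= mulr0 subr0.
    exact: lexx.
have [IQ EQ] := cintegral_tuple_prod Ii.
rewrite cintegralZ// EQ mulrCA -big_split/=.
under eq_bigr do rewrite cintegral_cpow_line//.
rewrite big_split/= prodr_const card_ord mulrCA; congr (_ * _).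
(* The line integrals have contributed [s ^ lam]; it raises the exponent [c] of the Gamma integrand
   to [c + lam]. *)
rewrite /gker s0 -/lam.
have -> : \prod_i cpow s%:C (p i - 1) = cpow s%:C lam.
  rewrite cpow_real// /lam mulr_suml cexp_sum.
  by apply: eq_bigr => i _; rewrite cpow_real.
rewrite mulrAC -cpowD ?Re_gt0_neq0//; congr (cpow _ _ * _).
by ring.
Qed.

End tuple_integral.

(** * Dirichlet integrals *)

Section dirichlet.
Context {R : realType}.
Local Notation leb := (@lebesgue_measure R).
Local Notation T n := (n.-tuple (measurableTypeR R)).
Implicit Types (l m a : R[i]) (r s : R).

Let gker0 l s : gker 0 l s = if 0 < s then cpow s%:C (l - 1) else 0.
Proof. by rewrite /gker oppr0 mul0r cexp0 mulr1. Qed.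

Let cmod_gker0 l s :
  cmod (gker 0 l s) = if 0 < s then s `^ (complex.Re l - 1) else 0.
Proof. by rewrite cmod_gker/= mul0r oppr0 expR0 mulr1. Qed.

Let cmeasurable_sub (f : R -> R[i]) r :
  cmeasurable f -> cmeasurable (fun s : R => f (r - s)).
Proof. by move=> mf; apply: (cmeasurableT_comp mf); exact: measurable_funB. Qed.

Let conv_measurable l m r : cmeasurable (fun s => gker 0 l s * gker 0 m (r - s)).
Proof.
apply: cmeasurableM; first exact: cmeasurable_gker.
exact: (cmeasurable_sub r (cmeasurable_gker 0 m)).
Qed.

Let cintegral_sub (f : R -> R[i]) r : cintegrable leb f ->
  cintegrable leb (fun s : R => f (r - s)) /\
  cintegral leb setT (fun s : R => f (r - s)) = cintegral leb setT f.
Proof.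
move=> If.
have N10 : - 1 != 0 :> R by rewrite oppr_eq0.
have := cintegral_affine r N10 (cintegrable_cmeasurable If) If.
have -> : (fun x : R => f (- 1 * x + r)) = (fun s => f (r - s)).
  by apply/funext => x; rewrite mulN1r addrC.
by rewrite normrN normr1 invr1 mul1r.
Qed.

(** Away from 1 the factor in [1 - s] is at most 1 or [2 ^ (1 - m)], according to the sign of
    [m - 1]; adding both covers the two cases. The factor [exp 1 * exp (- s)], at least 1 here,
    turns the rest into the Gamma integrand, already known to be integrable. *)
Let beta_half_bound (l m : R) s : 0 < s -> s <= 2^-1 ->
  s `^ (l - 1) * (1 - s) `^ (m - 1) <=
  (1 + 2^-1 `^ (m - 1)) * expR 1 * (s `^ (l - 1) * expR (- (1 * s))).
Proof.
move=> s0 s2; have s1 : 0 < 1 - s by lra.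
have h : (1 - s) `^ (m - 1) <= 1 + 2^-1 `^ (m - 1).
  have [m1|m1] := leP 0 (m - 1).
    rewrite (@le_trans _ _ 1)//; last by rewrite lerDl powR_ge0.
    have h1 : (1 - s) `^ (m - 1) <= 1 `^ (m - 1).
      by rewrite ge0_ler_powR ?nnegrE ?(ltW s1)//; lra.
    by rewrite powR1 in h1.
  rewrite (@le_trans _ _ (2^-1 `^ (m - 1)))//; last by rewrite lerDr.
  have q0 : 0 <= - (m - 1) by lra.
  rewrite -[m - 1]opprK; move: (- (m - 1)) q0 => q q0.
  rewrite !powRN lef_pV2 ?posrE ?powR_gt0// ge0_ler_powR ?nnegrE ?(ltW s1)//.
  lra.
have e1 : 1 <= expR 1 * expR (- (1 * s)) 
  by rewrite -expRD; apply: le_trans (expR_ge1Dx _); lra.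
rewrite mulrCA -!mulrA ler_wpM2l ?powR_ge0//.
have h0 : 0 <= 1 + 2^-1 `^ (m - 1) by rewrite addr_ge0 ?powR_ge0.
by rewrite (le_trans h)// ler_peMr.
Qed.

(** Only one factor can blow up on each half of the unit interval; [beta_half_bound] treats the
    first half, and the second after exchanging [s] and [1 - s]. *)
Let conv_integrable1 l m : 0 < complex.Re l -> 0 < complex.Re m ->
  cintegrable leb (fun s => gker 0 l s * gker 0 m (1 - s)).
Proof.
move=> l0 m0.
have r1 : 0 < complex.Re (1 : R[i]) by [].
have Il := cintegrable_gker r1 l0.
have [Im _] := cintegral_sub 1 (cintegrable_gker r1 m0).
pose C1 := (1 + 2^-1 `^ (complex.Re m - 1)) * expR 1.
pose C2 := (1 + 2^-1 `^ (complex.Re l - 1)) * expR 1.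
have C10 : 0 <= C1 by rewrite mulr_ge0 ?expR_ge0 ?addr_ge0 ?powR_ge0.
have C20 : 0 <= C2 by rewrite mulr_ge0 ?expR_ge0 ?addr_ge0 ?powR_ge0.
apply: (@le_cintegrable _ _ _ leb _
   (fun s => C1 * cmod (gker 1 l s) + C2 * cmod (gker 1 m (1 - s)))).
- exact: conv_measurable.
- rewrite /comp; under eq_fun do rewrite EFinD !EFinM.
  by apply: integrableD => //; apply: integrableZl => //; exact: cintegrable_cmod.
move=> s; rewrite cmodM !cmod_gker0 !cmod_gker/=.
have [s0|s0] := ltP 0 s; last first.
  rewrite mul0r mulr0 add0r mulr_ge0//.
  by case: ifP => // _; rewrite mulr_ge0 ?powR_ge0 ?expR_ge0.
have [s1|s1] := ltP 0 (1 - s); last first.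
  by rewrite !mulr0 addr0 mulr_ge0// mulr_ge0 ?powR_ge0 ?expR_ge0.
have [s2|s2] := leP s 2^-1.
  rewrite (le_trans (beta_half_bound _ _ _ _))// lerDl mulr_ge0//.
  by rewrite mulr_ge0 ?powR_ge0 ?expR_ge0.
rewrite mulrC -[s in X in _ * X](subKr 1 s).
rewrite (le_trans (beta_half_bound _ _ _ _))//; first by lra.
by rewrite lerDr mulr_ge0// mulr_ge0 ?powR_ge0 ?expR_ge0.
Qed.

Let gker0M l r s : 0 < r -> gker 0 l (r * s) = cpow r%:C (l - 1) * gker 0 l s.
Proof.
move=> r0; rewrite !gker0 pmulr_rgt0//; case: ifP => s0; rewrite ?mulr0//.
by rewrite cpow_realM.
Qed.

(** By homogeneity: substituting [r s] for [s] takes out the exponents [l - 1] and [m - 1], and one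
    more power of [r] for the measure. *)
Let conv_scale l m r : 0 < complex.Re l -> 0 < complex.Re m -> 0 < r ->
  cintegrable leb (fun s => gker 0 l s * gker 0 m (r - s)) /\
  cintegral leb setT (fun s => gker 0 l s * gker 0 m (r - s)) =
  cpow r%:C (l + m - 1) *
  cintegral leb setT (fun s => gker 0 l s * gker 0 m (1 - s)).
Proof.
move=> l0 m0 r0; have I1 := conv_integrable1 l0 m0.
have r_neq0 : r != 0 by rewrite gt_eqF.
have rV_neq0 : r^-1 != 0 by rewrite invr_eq0.
have cr_neq0 : r%:C != 0 :> R[i] by rewrite Re_gt0_neq0.
have [I2 E2] := cintegral_affine 0 rV_neq0 (cintegrable_cmeasurable I1) I1.
have E : (fun s => gker 0 l s * gker 0 m (r - s)) = fun x => cpow r%:C (l + m - 1 - 1)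
    * (gker 0 l (r^-1 * x + 0) * gker 0 m (1 - (r^-1 * x + 0))).
  apply/funext => x; rewrite addr0 -{1}[x](mulVKf r_neq0).
  have -> : r - x = r * (1 - r^-1 * x) by rewrite mulrBr mulr1 mulVKf.
  rewrite (gker0M l (r^-1 * x) r0) (gker0M m (1 - r^-1 * x) r0).
  have -> : l + m - 1 - 1 = (l - 1) + (m - 1) by ring.
  by rewrite (cpowD (l - 1))//; ring.
rewrite E; split; first exact: cintegrableZ.
rewrite cintegralZ// E2 mulrA; congr (_ * _).
rewrite normfV invrK gtr0_norm// -[X in _ * X]cpow1// -cpowD//; congr cpow; ring.
Qed.

(** Both sides are the double integral of [gker 1 l s * gker 1 m (r - s)]. Integrating over [r]
    first gives the product of Gammas; over [s] first, the exponentials merge into [exp (- r)] and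
    [conv_scale] leaves a multiple of [r ^ (l + m - 1)]. *)
Let beta_gamma l m : 0 < complex.Re l -> 0 < complex.Re m ->
  cgamma (l + m) * cintegral leb setT (fun s => gker 0 l s * gker 0 m (1 - s)) =
  cgamma l * cgamma m.
Proof.
move=> l0 m0.
have r1 : 0 < complex.Re (1 : R[i]) by [].
have lm0 : 0 < complex.Re (l + m) by rewrite cReD addr_gt0.
have Il := cintegrable_gker r1 l0.
have Im := cintegrable_gker r1 m0.
have shift (f : R -> R[i]) s : cintegrable leb f ->
    cintegrable leb (fun r : R => f (r - s)) /\
    cintegral leb setT (fun r : R => f (r - s)) = cintegral leb setT f.
  move=> If; have := cintegral_affine (- s) (oner_neq0 R) (cintegrable_cmeasurable If) If.
  have -> : (fun x : R => f (1 * x - s)) = (fun x => f (x - s)).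
    by apply/funext => x; rewrite mul1r.
  by rewrite normr1 invr1 mul1r.
pose H (z : R * R) := gker 1 l z.1 * gker 1 m (z.2 - z.1).
have mH : cmeasurable H.
  apply: cmeasurableM; first exact: (cmeasurableT_comp (cmeasurable_gker 1 l) measurable_fst).
  apply: (cmeasurableT_comp (cmeasurable_gker 1 m)).
  by apply: measurable_funB.
have Ic := cintegrable_cmod Im.
have IH : cintegrable (leb \x leb)%E H.
  apply: (@cintegrable_prod _ _ _ _ _ leb leb _
    (fun s => cmod (gker 1 l s) * fine (\int[leb]_r (cmod (gker 1 m r))%:E))).
  - exact: mH.
  - rewrite /comp; under eq_fun do rewrite mulrC EFinM.
    exact/integrableZl/cintegrable_cmod.
  - apply: aeW => s.
    have Icr : cintegrable leb (fun r => (cmod (gker 1 m r))%:C).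
      by split => //=; exact: integrable0.
    have [[I1 _] /(congr1 (@complex.Re R)) /= E1] := shift _ s Icr.
    rewrite /H/=; under eq_integral do rewrite cmodM EFinM.
    rewrite integralZl// EFinM.
    have := E1; rewrite /Rintegral => E1'.
    rewrite -[X in (_ * X <= _)%E]fineK; last exact: integrable_fin_num.
    by rewrite E1'.
have E12 : cintegral (leb \x leb)%E setT H = cgamma l * cgamma m.
  rewrite cintegral_prod12//.
  rewrite [in RHS]cgammaE mulrC -cintegralZ//; apply: eq_cintegral => s.
  by have [I1 E1] := shift _ s Im; rewrite /H/= cintegralZ// E1 -cgammaE mulrC.
rewrite -E12 cintegral_prod21// mulrC cgammaE.
rewrite -cintegralZ; last exact: cintegrable_gker.
apply: eq_cintegral => r.
have HE s : H (s, r) = cexp (- r%:C) * (gker 0 l s * gker 0 m (r - s)).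
  rewrite /H/= !gker0 /gker; case: ifP => _; last by rewrite !(mul0r, mulr0).
  case: ifP => _; last by rewrite !mulr0.
  have -> : cexp (- r%:C) = cexp (- 1 * s%:C) * cexp (- 1 * (r - s)%:C).
    by rewrite -cexpD; congr cexp; rewrite rmorphB; ring.
  by ring.
under [RHS]eq_cintegral do rewrite HE.
have [r0|r0] := ltP 0 r; last first.
  have -> : gker 1 (l + m) r = 0 by rewrite /gker ltNge r0.
  rewrite mulr0 -[LHS](@cintegral0 _ _ _ leb); apply: eq_cintegral => s.
  rewrite (gker0 l) (gker0 m); case: ifP => s0; last by rewrite mul0r mulr0.
  by rewrite ifF ?mulr0//; apply/negbTE; rewrite -leNgt subr_le0 (le_trans r0)// ltW.
have [I2 E2] := conv_scale l0 m0 r0.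
have -> : gker 1 (l + m) r = cpow r%:C (l + m - 1) * cexp (- r%:C).
  by rewrite /gker r0 mulN1r.
by rewrite cintegralZ// E2; ring.
Qed.

(* [pker l] differs from [gker 0 l] at [0] only, where it keeps the junk value
   of [cpow] found in [dirichlet_density]. *)
Definition pker l s : R[i] := if 0 <= s then cpow s%:C (l - 1) else 0.

Let pkerE l s : s != 0 -> pker l s = gker 0 l s.
Proof. by move=> s0; rewrite /pker gker0 le_eqVlt eq_sym (negbTE s0). Qed.

Lemma cmeasurable_pker l : cmeasurable (pker l).
Proof.
have -> : pker l = fun s => if s == 0 then pker l 0 else gker 0 l s.
  by apply/funext => s; case: eqP => [->//|/eqP /pkerE ->].
apply: cmeasurable_if; [|exact: cmeasurable_cst|exact: cmeasurable_gker].
by apply: measurable_fun_eqr => //; exact: measurable_cst.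
Qed.

(** At [r = 0] the identity can fail: the integral vanishes, whereas [pker (l + m) 0] is 1 when
    [l + m = 1]. *)
Let conv_pker l m r : 0 < complex.Re l -> 0 < complex.Re m -> r != 0 ->
  cintegrable leb (fun s => pker l s * pker m (r - s)) /\
  cgamma (l + m) * cintegral leb setT (fun s => pker l s * pker m (r - s)) =
  cgamma l * cgamma m * pker (l + m) r.
Proof.
move=> l0 m0 r_neq0.
have [r0|r0|/eqP] := ltgtP r 0; last by rewrite (negbTE r_neq0).
  have -> : (fun s => pker l s * pker m (r - s)) = fun=> 0.
    apply/funext => s; rewrite /pker; case: ifP => s0; last by rewrite mul0r.
    by rewrite ifF ?mulr0//; apply/negbTE; rewrite -ltNge subr_lt0 (lt_le_trans r0).
  split; first exact: cintegrable0.
  by rewrite cintegral0 mulr0 /pker leNgt r0 mulr0.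
have [I1 E1] := conv_scale l0 m0 r0.
have mp : cmeasurable (fun s => pker l s * pker m (r - s)).
  apply: cmeasurableM; first exact: cmeasurable_pker.
  exact: (cmeasurable_sub r (cmeasurable_pker m)).
have mg := cintegrable_cmeasurable I1.
have ae0 : {ae leb, forall s, gker 0 l s * gker 0 m (r - s) = pker l s * pker m (r - s)}.
  have [N1 [mN1 N10 h1]] := ae_neq (0 : R).
  have [N2 [mN2 N20 h2]] := ae_neq r.
  exists (N1 `|` N2); split; [exact: measurableU| |].
    apply/eqP; rewrite -measure_le0; apply: (le_trans (measureU2 _ mN1 mN2)).
    by rewrite [X in (X + _)%E]N10 [X in (_ + X)%E]N20 add0e.
  move=> s /= h; have [s0|s0] := eqVneq s 0.
    by left; apply: h1 => /=; rewrite s0 eqxx.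
  have [sr|sr] := eqVneq s r.
    by right; apply: h2 => /=; rewrite sr eqxx.
  by exfalso; apply: h; rewrite !pkerE// subr_eq0 eq_sym.
have ae1 (p : R[i] -> R) : ae_eq leb setT
    (fun s => (p (gker 0 l s * gker 0 m (r - s)))%:E)
    (fun s => (p (pker l s * pker m (r - s)))%:E).
  have [N [mN N0 h]] := ae0; exists N; split => // s /= hs; apply: h => /= e.
  by apply: hs => _; rewrite e.
split.
  have aux (f g : R -> \bar R) : measurable_fun setT f -> measurable_fun setT g ->
      ae_eq leb setT f g -> leb.-integrable setT f -> leb.-integrable setT g.
    move=> mf mg' fg /integrableP[_ h]; apply/integrableP; split => //.
    rewrite (_ : (\int[leb]_x `|g x| = \int[leb]_x `|f x|)%E)//.
    apply: ae_eq_integral => //; do ?exact: measurableT_comp.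
    by have [N [mN N0 hN]] := fg; exists N; split => // s /= hs; apply: hN => /= e;
      apply: hs => _; rewrite e.
  by split; [apply: (aux _ _ _ _ (ae1 (@complex.Re R)) I1.1)
    |apply: (aux _ _ _ _ (ae1 (@complex.Im R)) I1.2)]; apply/measurable_EFinP;
    [exact: mg.1|exact: mp.1|exact: mg.2|exact: mp.2].
rewrite -(ae_eq_cintegral mg mp ae0) E1 mulrCA beta_gamma// mulrC.
by rewrite /pker ltW.
Qed.

Let qker (x s : R) : R := if 0 <= s then s `^ (x - 1) else 0.

Let pker_real (x s : R) : pker x%:C s = (qker x s)%:C.
Proof.
rewrite /pker /qker; case: ifP => // s0; have [->|s_neq0] := eqVneq s 0.
  rewrite /cpow /powR !eqxx -(rmorph1 (real_complex R)) -rmorphB.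
  by rewrite (inj_eq (@complexI R)) rmorph_nat.
have s1 : 0 < s by rewrite lt_def s_neq0.
rewrite cpow_real// /powR (negbTE s_neq0) -(rmorph1 (real_complex R)) -rmorphB.
by rewrite -rmorphM cexp_real.
Qed.

(** Not an equality: at [s = 0], [cpow] gives 1 for [l = 1] only, while [powR] gives 1 as soon as
    [Re l = 1]. *)
Let cmod_pker l s : cmod (pker l s) <= qker (complex.Re l) s.
Proof.
rewrite /pker /qker; case: ifP => s0; last by rewrite cmod0.
have [->|s_neq0] := eqVneq s 0.
  rewrite /cpow /powR !eqxx; rewrite subr_eq0; have [->|_] := eqVneq l 1.
    by rewrite cmod1/= subrr eqxx.
  by rewrite cmod0.
by rewrite cmod_cpow_real ?cReD ?cReN// lt_def s_neq0.
Qed.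

Let F n (lam : 'I_n -> R[i]) a r (s : T n) := (\prod_i pker (lam i) (tnth s i)) *
  pker a (r - \sum_i (tnth s i : R)).

Let cmeasurable_F n (lam : 'I_n -> R[i]) a r : cmeasurable (F lam a r).
Proof.
apply: cmeasurableM.
  apply: cmeasurable_prod => i; apply: cmeasurable_tnth; exact: cmeasurable_pker.
apply: (cmeasurableT_comp (cmeasurable_pker a)); apply: measurable_funB.
  exact: measurable_cst.
by apply: measurable_sum => i; exact: measurable_tnth.
Qed.

(** Induction on [n], with a total mass [r] because fixing the first coordinate [s] leaves a
    Dirichlet integral of mass [r - s]. The induction hypothesis turns it into
    [pker (\sum_i lam' i + a) (r - s)], and the integral over [s] is then a convolution computed by
    [conv_pker]. *)
Lemma cintegral_dirichlet n (lam : 'I_n -> R[i]) a r :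
  (forall i, 0 < complex.Re (lam i)) -> 0 < complex.Re a -> r != 0 ->
  cintegrable (lebesgue_tuple R n) (fun t => (\prod_i pker (lam i) (tnth t i)) *
    pker a (r - \sum_i (tnth t i : R))) /\
  cgamma (\sum_i lam i + a) * cintegral (lebesgue_tuple R n) setT
    (fun t => (\prod_i pker (lam i) (tnth t i)) *
      pker a (r - \sum_i (tnth t i : R))) =
  (\prod_i cgamma (lam i)) * cgamma a * pker (\sum_i lam i + a) r.
Proof.
elim: n lam a r => [|n IH] lam a r lam0 a0 r0; rewrite -[fun t : T _ => _]/(F lam a r).
  have [I0 ->] := cintegral_tuple0 (cmeasurable_F lam a r).
  by split => //; rewrite /F !big_ord0 subr0 !mul1r add0r.
pose lam' (i : 'I_n) := lam (lift ord0 i).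
(* Integrability on the product calls for the integral of a modulus. Replacing the exponents by
   their real parts gives a nonnegative majorant of the same shape, so the induction hypothesis also
   evaluates its integral. *)
pose rlam i := (complex.Re (lam' i))%:C; pose ra := (complex.Re a)%:C.
have FE s (s' : T n) : F lam a r (tuple_cons (s, s')) = pker (lam ord0) s * F lam' a (r - s) s'.
  rewrite /F big_ord_recl tnth_tuple_cons0 -mulrA; congr (_ * (_ * pker _ _)).
    by apply: eq_bigr => i _; rewrite tnth_tuple_consS.
  rewrite big_ord_recl tnth_tuple_cons0 opprD addrA; congr (_ - _).
  by apply: eq_bigr => i _; rewrite tnth_tuple_consS.
have cmod_F s (s' : T n) : cmod (F lam' a s s') <= complex.Re (F rlam ra s s').
  rewrite /F /rlam /ra; under [in leRHS]eq_bigr do rewrite pker_real.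
  rewrite pker_real -rmorph_prod -rmorphM/= cmodM cmod_prod.
  apply: ler_pM; rewrite ?cmod_ge0//.
    by apply: prodr_ge0 => i _; exact: cmod_ge0.
  by apply: ler_prod => i _; rewrite cmod_ge0 cmod_pker.
have S0 : 0 < complex.Re (\sum_i rlam i + ra).
  rewrite cReD cRe_sum ltr_wpDl//; apply: sumr_ge0 => i _.
  exact/ltW/lam0.
have S'0 : 0 < complex.Re (\sum_i lam' i + a).
  rewrite cReD cRe_sum ltr_wpDl//; apply: sumr_ge0 => i _.
  exact/ltW/lam0.
pose K := (\prod_i cgamma (rlam i)) * cgamma ra / cgamma (\sum_i rlam i + ra).
have [IG _] := conv_pker (lam0 ord0) S0 r0.
have IF : cintegrable (leb \x lebesgue_tuple R n)%E
    (fun p => F lam a r (tuple_cons p)).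
  apply: (@cintegrable_prod _ _ _ _ _ leb (lebesgue_tuple R n) _
    (fun s => cmod K * cmod (pker (lam ord0) s * pker (\sum_i rlam i + ra) (r - s)))).
  - apply: (cmeasurableT_comp (cmeasurable_F lam a r)).
    exact: measurable_tuple_cons.
  - rewrite /comp; under eq_fun do rewrite EFinM.
    exact/integrableZl/cintegrable_cmod.
  (* The induction hypothesis excludes mass 0, so the slice [s = r] is discarded. *)
  - have [N [mN N0 hN]] := ae_neq r; exists N; split => // s /= hs; apply: hN => /= sr.
    apply: hs; have rs0 : r - s != 0 by rewrite subr_eq0 eq_sym.
    have [I1 _] := IH lam' a (r - s) (fun i => lam0 _) a0 rs0.
    have [I2 E2] := IH rlam ra (r - s) (fun i => lam0 _) a0 rs0.
    have h : (\int[lebesgue_tuple R n]_y (cmod (F lam' a (r - s) y))%:E <=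
        (cmod K * cmod (pker (\sum_i rlam i + ra) (r - s)))%:E)%E.
      apply: (@le_trans _ _ (\int[lebesgue_tuple R n]_y
          (complex.Re (F rlam ra (r - s) y))%:E)%E).
        apply: le_integral => //; first exact: cintegrable_cmod I1.
          exact: I2.1.
        by move=> y _; rewrite lee_fin.
      have Ef := integrable_fin_num measurableT I2.1.
      rewrite -(fineK Ef) lee_fin -cmodM.
      have -> : K * pker (\sum_i rlam i + ra) (r - s) =
          cintegral (lebesgue_tuple R n) setT (F rlam ra (r - s)).
        apply: (mulfI (cgamma_neq0 S0)); rewrite E2 /K mulrAC mulrCA mulfV ?mulr1//.
        exact: cgamma_neq0.
      apply: (le_trans (ler_norm _)).
      exact: (ler_Re_cmod (cintegral (lebesgue_tuple R n) setT (F rlam ra (r - s)))).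
    under eq_integral do rewrite FE cmodM EFinM.
    rewrite integralZl//; last exact: cintegrable_cmod I1.
    rewrite cmodM mulrCA EFinM lee_pmul//; first by rewrite lee_fin cmod_ge0.
    by apply: integral_ge0 => y _; rewrite lee_fin cmod_ge0.
split; first exact: (cintegrable_tuple_cons (cmeasurable_F lam a r)).
rewrite (cintegral_tuple_cons (cmeasurable_F lam a r) IF) cintegral_prod12//.
have IF12 := cintegrable_prod12 IF.
have [IC EC] := conv_pker (lam0 ord0) S'0 r0.
apply: (mulfI (cgamma_neq0 S'0)); rewrite [LHS]mulrCA -cintegralZ//.
have -> : cintegral leb setT (fun x => cgamma (\sum_i lam' i + a) *
      cintegral (lebesgue_tuple R n) setT (fun y => F lam a r (tuple_cons (x, y)))) =
    (\prod_i cgamma (lam' i)) * cgamma a *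
    cintegral leb setT (fun s => pker (lam ord0) s * pker (\sum_i lam' i + a) (r - s)).
  rewrite -cintegralZ//; apply: (@eq_cintegral_neq _ _ _ r).
  - exact: cintegrable_cmeasurable (cintegrableZ _ IF12).
  - exact: cintegrable_cmeasurable (cintegrableZ _ IC).
  - move=> s sr; have rs0 : r - s != 0 by rewrite subr_eq0 eq_sym.
    have [I1 E1] := IH lam' a (r - s) (fun i => lam0 _) a0 rs0.
    under eq_cintegral do rewrite FE.
    by rewrite cintegralZ// mulrCA E1; ring.
rewrite !big_ord_recl/= -/lam' -addrA mulrCA EC; ring.
Qed.

End dirichlet.

(** * Multiple series *)

Section box_sums.
Context {R : realType} {k : nat}.
Implicit Types F : 'rV[nat]_k -> R[i].

Definition multi_index n (f : {ffun 'I_k -> 'I_n}) : 'rV[nat]_k :=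
  \row_i (f i : nat).

(** Cubes of multi-indices exhaust all finite sets, and on them a sum of products over the
    coordinates is a product of sums. *)
Definition box_sum {V : nmodType} n (F : 'rV[nat]_k -> V) : V :=
  \sum_(f : {ffun 'I_k -> 'I_n}) F (multi_index f).

Let box n : {fset 'rV[nat]_k} :=
  [fset m in [seq multi_index f | f <- enum {: {ffun 'I_k -> 'I_n}}]]%fset.

Let multi_index_inj n : injective (@multi_index n).
Proof.
move=> f g /rowP fg; apply/ffunP => i; apply: val_inj.
by have := fg i; rewrite !mxE.
Qed.

Let box_sumE (V : nmodType) n (F : 'rV[nat]_k -> V) :
  box_sum n F = \sum_(m <- box n) F m.
Proof.
rewrite (perm_big [seq multi_index f | f <- enum {: {ffun 'I_k -> 'I_n}}]).
  by rewrite big_map big_enum.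
apply: uniq_perm; first exact: fset_uniq.
  by rewrite (map_inj_uniq (@multi_index_inj n)) enum_uniq.
by move=> m; rewrite /box in_fset.
Qed.

Let mem_box n m : (m \in box n) = [forall i, (m ord0 i < n)%N].
Proof.
rewrite /box in_fset; apply/mapP/forallP => /= [[f _ -> i]|h].
  by rewrite mxE.
exists [ffun i => Ordinal (h i)]; first by rewrite mem_enum.
by apply/rowP => i; rewrite mxE ffunE.
Qed.

Let box_subset n m : (n <= m)%N -> (box n `<=` box m)%fset.
Proof.
move=> nm; apply/fsubsetP => x; rewrite !mem_box => /forallP h.
by apply/forallP => i; apply: leq_trans (h i) nm.
Qed.

Let subset_box (A : {fset 'rV[nat]_k}) : exists n, (A `<=` box n)%fset.
Proof.
exists (\max_(m <- A) \max_(i < k) (m ord0 i).+1).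
apply/fsubsetP => x xA; rewrite mem_box; apply/forallP => i.
rewrite (big_rem x)//= leq_max; apply/orP; left.
exact: (@leq_bigmax _ (fun i : 'I_k => (x ord0 i).+1) i).
Qed.

Let sum_diff F (A B : {fset 'rV[nat]_k}) : (A `<=` B)%fset ->
  cmod (\sum_(m <- B) F m - \sum_(m <- A) F m) <=
  \sum_(m <- B) cmod (F m) - \sum_(m <- A) cmod (F m).
Proof.
move=> AB.
have E (V : zmodType) (G : 'rV[nat]_k -> V) : \sum_(m <- B) G m - \sum_(m <- A) G m =
    \sum_(m <- [fset x in B | x \notin A]%fset) G m.
  rewrite (big_fsetID _ (mem A) B)/=.
  have -> : [fset x in B | mem A x]%fset = A.
    apply/fsetP => x; rewrite !inE/=; apply/andP/idP => [[]//|xA].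
    by split => //; exact: (fsubsetP AB).
  by rewrite addrAC subrr add0r.
by rewrite !E ler_cmod_sum.
Qed.

(** The increments of [u] are dominated by those of [v], so [v] and [u + v] are both nondecreasing
    and bounded. *)
Let cauchy_cvg (u v : nat -> R) (M : R) :
  (forall n m, (n <= m)%N -> `|u m - u n| <= v m - v n) ->
  (forall n, 0 <= v n <= M) -> cvgn u /\ cvgn v.
Proof.
move=> uv vM.
have vnd : nondecreasing_seq v.
  by move=> n m nm; rewrite -subr_ge0 (le_trans _ (uv _ _ nm)).
have cv : cvgn v.
  apply: nondecreasing_is_cvgn => //; exists M => _ [n _ <-].
  by have /andP[] := vM n.
split => //.
have -> : u = (u \+ v) \- v by apply/funext => n /=; rewrite addrK.
apply: is_cvgB => //; apply: nondecreasing_is_cvgn => [n m nm|].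
  have := uv _ _ nm; rewrite ler_norml => /andP[h _] /=; lra.
exists (`|u 0%N| + M + M) => _ [n _ <-] /=.
have := uv 0%N n (leq0n _); rewrite ler_norml => /andP[_ h].
have /andP[v0 _] := vM 0%N; have /andP[_ vn] := vM n.
have := ler_norm (u 0%N); lra.
Qed.

(** Absolute convergence makes the limit along the filter of finite sets equal to the limit along
    cubes: beyond a large cube the total modulus still missing is small, whatever finite set is
    added. *)
Lemma summability_sum_box F (M : R) :
  (forall n, box_sum n (fun m => cmod (F m)) <= M) ->
  ccvg (fun n => box_sum n F) (@summability.sum _ R[i] R[i]^o F).
Proof.
move=> FM.
pose T n := box_sum n (fun m => cmod (F m)).
have T0M n : 0 <= T n <= M.
  by rewrite FM andbT; apply: sumr_ge0 => f _; exact: cmod_ge0.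
have PT n m : (n <= m)%N -> cmod (box_sum m F - box_sum n F) <= T m - T n.
  by move=> nm; rewrite /T !box_sumE sum_diff// box_subset.
have [cr cT] := @cauchy_cvg (fun n => complex.Re (box_sum n F)) T M
  (fun n m nm => le_trans (eq_ind _ (fun z => `|z| <= _)
    (ler_Re_cmod (box_sum m F - box_sum n F)) _
    (etrans (cReD _ _) (congr1 _ (cReN _)))) (PT n m nm)) T0M.
have [ci _] := @cauchy_cvg (fun n => complex.Im (box_sum n F)) T M
  (fun n m nm => le_trans (eq_ind _ (fun z => `|z| <= _)
    (ler_Im_cmod (box_sum m F - box_sum n F)) _
    (etrans (cImD _ _) (congr1 _ (cImN _)))) (PT n m nm)) T0M.
pose l : R[i] := limn (fun n => complex.Re (box_sum n F)) +i*
  limn (fun n => complex.Im (box_sum n F)).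
have Pl : ccvg (fun n => box_sum n F) l by split.
suff -> : @summability.sum _ R[i] R[i]^o F = l by [].
have Tnd : nondecreasing_seq T.
  by move=> n m nm; rewrite -subr_ge0 (le_trans (cmod_ge0 _) (PT _ _ nm)).
have tF := @summability.totally_filter 'rV[nat]_k.
apply: cvg_lim; first exact: norm_hausdorff.
apply/(@cvgrPdist_lt R[i] R[i]^o) => eps eps0.
have epsE : eps = (complex.Re eps)%:C.
  by rewrite RRe_real// realE ltW.
have e0 : 0 < complex.Re eps by rewrite -(@ltcR R) -epsE.
pose e := complex.Re eps / 2; have {}e0' : 0 < e by rewrite divr_gt0.
have [N _ hN] : \forall n \near \oo, limn T - T n < e.
  have /cvgrPdist_lt/(_ _ e0') : T @ \oo --> limn T by [].
  by apply: filterS => n; apply: le_lt_trans; exact: ler_norm.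
exists (box N) => // A /= NA.
rewrite cmodE epsE ltcR.
have -> : summability.partial_sum F A = \sum_(m <- A) F m.
  by rewrite /summability.partial_sum big_seq_fsetE.
have [n1 An1] := subset_box A.
have /ccvg_cmod/cvgrPdist_lt/(_ _ e0')[n2 _ hn2] := Pl.
(* Chosen after [A]: the cube of size [n] contains [A] and its sum is [e]-close to [l]; what it adds
   to [A] has total modulus below [e], because [A] contains the cube of size [N]. *)
pose n := maxn n1 n2.
have An : (A `<=` box n)%fset by apply: (fsubset_trans An1); rewrite box_subset// leq_maxl.
have h1 : cmod (l - box_sum n F) < e.
  have := hn2 n (leq_maxr _ _); rewrite /= sub0r normrN ger0_norm ?cmod_ge0//.
  by rewrite -cmodN opprB.
have h2 : cmod (box_sum n F - \sum_(m <- A) F m) < e.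
  rewrite box_sumE; apply: (le_lt_trans (sum_diff F An)).
  apply: (le_lt_trans _ (hN N (leqnn _))); apply: lerB.
    by rewrite -box_sumE; exact: nondecreasing_cvgn_le.
  rewrite /T box_sumE -subr_ge0.
  by have := sum_diff F NA; apply: le_trans; exact: cmod_ge0.
have -> : l - \sum_(m <- A) F m = (l - box_sum n F) + (box_sum n F - \sum_(m <- A) F m).
  by rewrite addrA subrK.
by rewrite (le_lt_trans (ler_cmodD _ _))// [ltRHS]splitr ltrD.
Qed.

Lemma box_sum_prod (V : comNzRingType) n (f : 'I_k -> nat -> V) :
  box_sum n (fun m => \prod_i f i (m ord0 i)) = \prod_i \sum_(j < n) f i j.
Proof.
rewrite bigA_distr_bigA; apply: eq_bigr => g _.
by apply: eq_bigr => i _; rewrite mxE.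
Qed.

Lemma exp_sum_le (q : R) n : 0 <= q -> \sum_(j < n) q ^+ j / j`!%:R <= expR q.
Proof.
move=> q0; have -> : \sum_(j < n) q ^+ j / j`!%:R = series (exp_coeff q) n.
  by rewrite /series/= big_mkord.
apply: nondecreasing_cvgn_le; last exact: is_cvg_series_exp_coeff.
by apply: nondecreasing_series => j _ _; exact: exp_coeff_ge0.
Qed.

Lemma box_sum_exp_le n (q : 'I_k -> R) : (forall i, 0 <= q i) ->
  box_sum n (fun m => \prod_i (q i ^+ m ord0 i / (m ord0 i)`!%:R)) <= \prod_i expR (q i).
Proof.
move=> q0; rewrite (box_sum_prod n (fun i j => q i ^+ j / j`!%:R)).
apply: ler_prod => i _; rewrite exp_sum_le// andbT.
by apply: sumr_ge0 => j _; rewrite mulr_ge0 ?invr_ge0// exprn_ge0.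
Qed.

End box_sums.

(** * The power series of the complex exponential *)

Section exponential_series.
Context {R : realType}.

Let is_cderive_mono (x : R) n : is_cderive x (fun t => t%:C ^+ n / n`!%:R)
  (if n is m.+1 then x%:C ^+ m / m`!%:R else 0).
Proof.
have -> : (fun t : R => t%:C ^+ n / n`!%:R : R[i]) = fun t => (t ^+ n / n`!%:R)%:C.
  by apply/funext => t; rewrite rmorphM rmorphXn fmorphV rmorph_nat.
case: n => [|n].
  under eq_fun do rewrite expr0.
  exact: is_cderive_cst.
have d : is_derive x 1 (fun t : R => t ^+ n.+1 / n.+1`!%:R) (x ^+ n / n`!%:R).
  have dX := is_deriveX n.+1 (is_derive_id x (1 : R)).
  rewrite exprfctE in dX.
  apply: (is_derive_eq (is_deriveM dX (is_derive_cst (n.+1`!%:R^-1 : R) x 1))).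
  rewrite /GRing.scale/= mulr0 add0r mulr1 factS natrM; field.
  by rewrite nat1r !pnatr_eq0 -lt0n fact_gt0.
by apply: (is_cderive_eq (is_cderive_real d)); rewrite rmorphM rmorphXn fmorphV rmorph_nat.
Qed.

Lemma is_cderiveD (x : R) (f g : R -> R[i]) (df dg : R[i]) :
  is_cderive x f df -> is_cderive x g dg ->
  is_cderive x (fun y => f y + g y) (df + dg).
Proof.
move=> [f1 f2] [g1 g2]; split.
  under eq_fun do rewrite cReD.
  by apply: (is_derive_eq (is_deriveD f1 g1)); rewrite cReD.
under eq_fun do rewrite cImD.
by apply: (is_derive_eq (is_deriveD f2 g2)); rewrite cImD.
Qed.

(** The mean value theorem applies to each real coordinate, at points that may differ; hence twice
    the bound. *)
Lemma cmod_increment_le (f df : R -> R[i]) (M : R) :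
  (forall t, is_cderive t f (df t)) -> (forall t, 0 <= t <= 1 -> cmod (df t) <= M) ->
  cmod (f 1 - f 0) <= M + M.
Proof.
move=> dfE dfM; rewrite (le_trans (ler_cmod_ReIm _))// lerD//.
  have [|t t01 e] := @MVT_segment R (fun t => complex.Re (f t))
    (fun t => complex.Re (df t)) 0 1 ler01 (fun t _ => (dfE t).1).
    apply: continuous_subspaceT => t; exact: is_derive_continuous (dfE t).1.
  by rewrite cReD cReN e subr0 mulr1 (le_trans (ler_Re_cmod _))// dfM.
have [|t t01 e] := @MVT_segment R (fun t => complex.Im (f t))
  (fun t => complex.Im (df t)) 0 1 ler01 (fun t _ => (dfE t).2).
  apply: continuous_subspaceT => t; exact: is_derive_continuous (dfE t).2.
by rewrite cImD cImN e subr0 mulr1 (le_trans (ler_Im_cmod _))// dfM.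
Qed.

(* The derivative of [cexp (- t z) * \sum_(j <= n) (t z)^j / j!] telescopes to
   [- z cexp (- t z) (t z)^n / n!]. *)
Lemma ccvg_exp_series (z : R[i]) :
  ccvg (fun n => \sum_(j < n) z ^+ j / j`!%:R) (cexp z).
Proof.
pose S n (t : R) : R[i] := \sum_(j < n) z ^+ j * (t%:C ^+ j / j`!%:R).
have dS n t : is_cderive t (S n.+1) (z * S n t).
  elim: n => [|n IH].
    rewrite /S big_ord0 mulr0; under eq_fun do rewrite big_ord1 !expr0 !mul1r.
    exact: is_cderive_cst.
  rewrite /S; under eq_fun do rewrite big_ord_recr.
  apply: (is_cderive_eq (is_cderiveD IH (is_cderiveZ (z ^+ n.+1) (is_cderive_mono t n.+1)))).
  by rewrite [in RHS]big_ord_recr mulrDr exprS -mulrA.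
pose f n t := cexp (- z * t%:C) * S n.+1 t.
pose df n (t : R) := - z * cexp (- z * t%:C) * (z ^+ n * (t%:C ^+ n / n`!%:R)).
have dfE n t : is_cderive t (f n) (df n t).
  apply: (is_cderive_eq (is_cderiveM (is_cderive_cexp
    (is_cderiveZ (- z) (is_cderive_real (is_derive_id t 1)))) (dS n t))).
  have -> : S n.+1 t = S n t + z ^+ n * (t%:C ^+ n / n`!%:R) by exact: big_ord_recr.
  by rewrite /df mulr1; ring.
pose C := cmod z * expR (cmod z).
have dfM n t : 0 <= t <= 1 -> cmod (df n t) <= C * (cmod z ^+ n / n`!%:R).
  move=> /andP[t0 t1]; rewrite /df cmodM (cmodM (- z)) cmodN cmod_cexp (cmodM (z ^+ n)) cmodX.
  rewrite -[leRHS]mulrA -mulrA ler_wpM2l ?cmod_ge0//.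
  apply: ler_pM; rewrite ?expR_ge0 ?mulr_ge0 ?exprn_ge0 ?cmod_ge0//.
    rewrite ler_expR cReM/= mulr0 subr0 cReN.
    rewrite (le_trans (ler_norm _))// normrM normrN (ger0_norm t0).
    by rewrite (le_trans (ler_piMr _ t1))// ler_Re_cmod.
  rewrite ler_wpM2l ?exprn_ge0 ?cmod_ge0// cmodM cmodX cmod_real cmodV cmod_nat (ger0_norm t0).
  by rewrite ler_piMl ?invr_ge0// exprn_ile1.
have f0 n : f n 0 = 1.
  rewrite /f mulr0 cexp0 mul1r /S big_ord_recl big1 ?addr0.
    by rewrite !expr0 !mul1r invr1.
  by move=> i _; rewrite /= expr0n mul0r mulr0.
have S1 n : S n 1 = \sum_(j < n) z ^+ j / j`!%:R.
  by apply: eq_bigr => j _; rewrite expr1n mul1r.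
have f1 : ccvg (fun n => f n 1) 1.
  apply/ccvg_cmod; apply: (@squeeze_cvg0 _ _ (fun n =>
    C * (cmod z ^+ n / n`!%:R) + C * (cmod z ^+ n / n`!%:R))).
    move=> n; rewrite cmod_ge0/= -(f0 n).
    exact: (cmod_increment_le (dfE n) (dfM n)).
  have h : C * (cmod z ^+ n / n`!%:R) @[n --> \oo] --> (0 : R).
    rewrite -(mulr0 C); apply: cvgM; first exact: cvg_cst.
    exact: (cvg_exp_coeff (cmod z)).
  by rewrite -[X in _ --> X](addr0 0); apply: cvgD.
have e1 : cexp z * cexp (- z * 1%:C) = 1.
  by rewrite -cexpD mulr1 subrr cexp0.
have h : ccvg (fun n => \sum_(j < n.+1) z ^+ j / j`!%:R) (cexp z).
  rewrite -[X in ccvg _ X]mulr1.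
  apply: eq_ccvg (ccvgM (ccvg_cst (cexp z)) f1) => n.
  by rewrite /f mulrA e1 mul1r S1.
have [h1 h2] := h.
split.
  by move: h1; rewrite (cvg_shiftS (fun n => complex.Re (\sum_(j < n) z ^+ j / j`!%:R))).
by move: h2; rewrite (cvg_shiftS (fun n => complex.Im (\sum_(j < n) z ^+ j / j`!%:R))).
Qed.

End exponential_series.

(** * Convergence of the series of [Phi2], uniformly on polydiscs *)

Section Phi2_series.
Context {R : realType} {k : nat}.
Implicit Types (b x : 'rV[R[i]]_k) (m : 'rV[nat]_k).

Definition Phi2_coef b (c : R[i]) m : R[i] :=
  (\prod_(i < k) pochhammer (b 0 i) (m ord0 i)) / pochhammer c (vsum m).

(** Kept convertible to the summand of [Phi2]; [Phi2_termE] gives the form that factorizes over the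
    coordinates. *)
Definition Phi2_term b (c : R[i]) x m : R[i] := Phi2_coef b c m *
  ((\prod_(i < k) x 0 i ^+ m ord0 i) / (\prod_(i < k) (m ord0 i)`!)%N%:R).

Definition exp_term x m : R[i] := \prod_(i < k) (x 0 i ^+ m ord0 i / (m ord0 i)`!%:R).

Lemma Phi2_termE b c x m : Phi2_term b c x m = Phi2_coef b c m * exp_term x m.
Proof.
by rewrite /Phi2_term /exp_term big_split/= prodfV natr_prod.
Qed.

Lemma ccvg_box_sum_exp x : ccvg (fun n => box_sum n (exp_term x)) (cexp (vsum x)).
Proof.
rewrite /vsum cexp_sum.
have -> : (fun n => box_sum n (exp_term x)) =
    fun n => \prod_(i < k) \sum_(j < n) x 0 i ^+ j / j`!%:R.
  by apply/funext => n; rewrite -(box_sum_prod n (fun i j => x 0 i ^+ j / j`!%:R)).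
apply: (@ccvg_prod R _ _ (fun i n => \sum_(j < n) x 0 i ^+ j / j`!%:R)) => i.
exact: ccvg_exp_series.
Qed.

Lemma cmod_exp_term x m (q : 'I_k -> R) : (forall i, cmod (x 0 i) <= q i) ->
  cmod (exp_term x m) <= \prod_(i < k) (q i ^+ m ord0 i / (m ord0 i)`!%:R).
Proof.
move=> xq; rewrite /exp_term cmod_prod; apply: ler_prod => i _.
rewrite cmod_ge0/= cmodM cmodX cmodV cmod_nat ler_wpM2r ?invr_ge0//.
by rewrite lerXn2r ?nnegrE ?cmod_ge0// (le_trans (cmod_ge0 _) (xq i)).
Qed.

Let prod_fact_le m : (\prod_(i < k) (m ord0 i)`! <= (vsum m)`!)%N.
Proof.
rewrite /vsum; elim/big_rec2 : _ => // i y1 y2 _ h.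
rewrite -(bin_fact (leq_addr y1 (m ord0 i))) addKn.
rewrite (leq_trans (leq_mul (leqnn _) h))// leq_pmull// bin_gt0.
exact: leq_addr.
Qed.

(** Factor by factor, [|b_i + j| <= B (j + 1)] and [|c + j| >= e (j + 1)], with [e] the smaller of
    [Re c] and 1. This compares Pochhammer symbols with factorials, and the product of the [m_i!] is
    at most [<m>!]. Geometric growth is harmless against the factorials of [exp_term]. *)
Lemma Phi2_coef_bound b c : 0 < complex.Re c ->
  exists2 K : R, 0 <= K & forall m, cmod (Phi2_coef b c m) <= K ^+ vsum m.
Proof.
move=> c0.
pose B : R := 1 + \sum_(i < k) cmod (b 0 i).
have B0 : 0 <= B by rewrite addr_ge0// sumr_ge0// => i _; exact: cmod_ge0.
have bB i : cmod (b 0 i) <= \sum_(i < k) cmod (b 0 i).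
  by rewrite (bigD1 i)//= lerDl sumr_ge0// => j _; exact: cmod_ge0.
pose e := Num.min (complex.Re c) 1.
have e0 : 0 < e by rewrite lt_min c0 ltr01.
have fE n : \prod_(j < n) j.+1%:R = n`!%:R :> R.
  by rewrite fact_prod -natr_prod big_add1 big_mkord.
have pB i n : cmod (pochhammer (b 0 i) n) <= B ^+ n * n`!%:R.
  rewrite /pochhammer cmod_prod -fE.
  have -> : B ^+ n = \prod_(j < n) B by rewrite prodr_const card_ord.
  rewrite -big_split/=; apply: ler_prod => j _; rewrite cmod_ge0/=.
  rewrite (le_trans (ler_cmodD _ _))// cmod_nat /B mulrDl mul1r -natr1.
  have h := bB i; have s0 := le_trans (cmod_ge0 _) h.
  have : 0 <= (\sum_(i0 < k) cmod (b 0 i0)) * j%:R by rewrite mulr_ge0.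
  rewrite mulrDr mulr1; lra.
have pe n : e ^+ n * n`!%:R <= cmod (pochhammer c n).
  rewrite /pochhammer cmod_prod -fE.
  have -> : e ^+ n = \prod_(j < n) e by rewrite prodr_const card_ord.
  rewrite -big_split/=; apply: ler_prod => j _.
  rewrite mulr_ge0 ?(ltW e0)//= (le_trans _ (ler_Re_cmod _))// (le_trans _ (ler_norm _))//.
  have -> : complex.Re (c + j%:R) = complex.Re c + j%:R.
    by rewrite cReD -(rmorph_nat (real_complex R)).
  rewrite -natr1 mulrDr mulr1 addrC lerD ?ge_min ?lexx//.
  by rewrite ler_piMl// ge_min lexx orbT.
exists (B / e) => [|m]; first by rewrite mulr_ge0 ?invr_ge0 ?(ltW e0).
have f0 n : 0 < n`!%:R :> R by rewrite ltr0n fact_gt0.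
have D0 : 0 < e ^+ vsum m * (vsum m)`!%:R by rewrite mulr_gt0 ?exprn_gt0.
rewrite /Phi2_coef cmodM cmodV.
have hn : cmod (\prod_(i < k) pochhammer (b 0 i) (m ord0 i)) <=
    B ^+ vsum m * (vsum m)`!%:R.
  rewrite cmod_prod.
  apply: (@le_trans _ _ (\prod_(i < k) (B ^+ m ord0 i * (m ord0 i)`!%:R))).
    by apply: ler_prod => i _; rewrite cmod_ge0 pB.
  rewrite big_split/= prodrXr -natr_prod ler_wpM2l ?exprn_ge0//.
  by rewrite ler_nat prod_fact_le.
rewrite ler_pdivrMr; last exact: lt_le_trans (pe _).
rewrite (le_trans hn)// expr_div_n.
apply: (@le_trans _ _ (B ^+ vsum m / e ^+ vsum m * (e ^+ vsum m * (vsum m)`!%:R))).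
  by rewrite mulrA divfK// expf_neq0// gt_eqF.
by rewrite ler_wpM2l// mulr_ge0 ?invr_ge0 ?exprn_ge0 ?(ltW e0).
Qed.

(** [M] depends on the radii only: under the line integral the argument of [Phi2] moves with [t],
    but stays in one polydisc. *)
Lemma Phi2_box b c (q : 'I_k -> R) : 0 < complex.Re c -> (forall i, 0 <= q i) ->
  exists M : R, forall x, (forall i, cmod (x 0 i) <= q i) ->
    (forall n, cmod (box_sum n (Phi2_term b c x)) <= M) /\
    ccvg (fun n => box_sum n (Phi2_term b c x)) (Phi2 b c x).
Proof.
move=> c0 q0; have [K K0 hK] := Phi2_coef_bound b c0.
exists (\prod_(i < k) expR (K * q i)) => x xq.
have tb m : cmod (Phi2_term b c x m) <=
    \prod_(i < k) ((K * q i) ^+ m ord0 i / (m ord0 i)`!%:R).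
  rewrite Phi2_termE cmodM.
  apply: (@le_trans _ _ (K ^+ vsum m *
      \prod_(i < k) (q i ^+ m ord0 i / (m ord0 i)`!%:R))).
    by apply: ler_pM; rewrite ?cmod_ge0//; exact: cmod_exp_term.
  rewrite /vsum -prodrXr -big_split/= le_eqVlt; apply/orP; left; apply/eqP.
  by apply: eq_bigr => i _; rewrite exprMn mulrA.
have Kq i : 0 <= K * q i by rewrite mulr_ge0.
have hM n : box_sum n (fun m => cmod (Phi2_term b c x m)) <=
    \prod_(i < k) expR (K * q i).
  apply: le_trans (box_sum_exp_le n Kq).
  by apply: ler_sum => f _; exact: tb.
split; first by move=> n; apply: le_trans (hM n); exact: ler_cmod_sum.
exact: summability_sum_box hM.
Qed.

End Phi2_series.

(** * The two integral representations *)

Section moments.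
Context {R : realType} {k : nat}.
Local Notation leb := (@lebesgue_measure R).
Local Notation T := (k.-tuple (measurableTypeR R)).
Implicit Types (x y a b h z t : 'rV[R[i]]_k) (m : 'rV[nat]_k).

Lemma pochhammer_cgamma (q : R[i]) n : 0 < complex.Re q ->
  pochhammer q n * cgamma q = cgamma (q + n%:R).
Proof.
move=> q0; elim: n => [|n IH]; first by rewrite /pochhammer big_ord0 mul1r addr0.
rewrite /pochhammer big_ord_recr/= mulrAC IH -natr1 addrA cgammaS 1?mulrC//.
by rewrite cReD -(rmorph_nat (real_complex R)) ltr_wpDr.
Qed.

Let Re_natr n : complex.Re (n%:R : R[i]) = n%:R.
Proof. by rewrite -(rmorph_nat (real_complex R)). Qed.

Let natr_vsum m : (vsum m)%:R = \sum_i (m ord0 i)%:R :> R[i].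
Proof. by rewrite /vsum natr_sum. Qed.

Let Re_vsum_ge0 a : (forall i, 0 < complex.Re (a 0 i)) -> 0 <= complex.Re (vsum a).
Proof. by move=> a0; rewrite /vsum cRe_sum sumr_ge0// => i _; exact/ltW/a0. Qed.

Lemma pochhammer_neq0 (q : R[i]) n : 0 < complex.Re q -> pochhammer q n != 0.
Proof.
move=> q0; rewrite prodf_seq_neq0; apply/allP => i _ /=.
by apply: Re_gt0_neq0; rewrite cReD Re_natr ltr_wpDr.
Qed.

(** Dividing the density by [t ^ m] replaces [h] by [h + m] and leaves the exponent [c] unchanged,
    so every moment is an instance of [cintegral_lines]. By [EF], the moment is the inverse of the
    coefficient of [Phi2], and the series of the exponential remains. *)
Lemma line_integral_Phi2 h (g : R[i]) z :
  (forall i, 0 < complex.Re ((h - const_mx 1) 0 i)) ->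
  complex.Re (vsum h) < complex.Re (g + k%:R) ->
  line_integral (fun t => Phi2 h g (vdiv z t)
    * line_density (h - const_mx 1) (g + k%:R - vsum h) t) = cexp (vsum z).
Proof.
move=> hh hg.
have h1 i : 1 < complex.Re (h 0 i).
  by have := hh i; rewrite !mxE cReD cReN/= subr_gt0.
have h0 i : 0 < complex.Re (h 0 i) by rewrite (lt_trans _ (h1 i)).
pose c := g + k%:R - vsum h.
have c0 : 0 < complex.Re c by rewrite /c cReD cReN subr_gt0.
(* Each [Re h_i] exceeds 1, so [Re <h>] is at least [k]. *)
have g0 : 0 < complex.Re g.
  have := hg; rewrite cReD Re_natr -ltrBlDr; apply: le_lt_trans.
  rewrite subr_ge0 /vsum cRe_sum -[k in leLHS]card_ord -sumr_const ler_sum// => i _.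
  exact/ltW/h1.
pose sg : R := k.+1%:R^-1.
have sg0 : 0 < sg by rewrite invr_gt0.
have ksg : k%:R * sg < 1 by rewrite ltr_pdivrMr// mul1r ltr_nat.
pose t (tau : T) i := sg +i* (tnth tau i : R).
pose F (p : 'I_k -> R[i]) tau := (\prod_i cpow (t tau i) (- p i)) *
  cpow (1 - \sum_i t tau i) (- c).
(* The trailing ['i ^+ k] comes from [dt_i = i dtau_i]; it cancels the one in [(2 pi i) ^ k]. *)
pose C0 := (\prod_(i < k) cgamma (h 0 i)) * cgamma c
    / ((2 * pi%:C * 'i) ^+ k * cgamma g) * 'i ^+ k.
have i_neq0 : 'i != 0 :> R[i] by rewrite eq_complex/= negb_and oner_neq0 orbT.
have pi_neq0 : pi%:C != 0 :> R[i] by rewrite Re_gt0_neq0//= pi_gt0.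
have DE tau : line_density (h - const_mx 1) c (line_point tau) * 'i ^+ k =
    C0 * F (h 0) tau.
  rewrite /line_density.
  have -> : \prod_(i < k) cgamma ((h - const_mx 1) 0 i + 1) = \prod_(i < k) cgamma (h 0 i).
    by apply: eq_bigr => i _; rewrite !mxE subrK.
  have -> : vsum (h - const_mx 1) + c = g.
    rewrite /c /vsum; under eq_bigr do rewrite !mxE.
    by rewrite sumrB sumr_const card_ord; ring.
  have -> : \prod_(i < k) cpow (line_point tau 0 i) (- (h - const_mx 1) 0 i - 1) =
      \prod_i cpow (t tau i) (- h 0 i).
    by apply: eq_bigr => i _; rewrite !mxE; congr cpow; ring.
  have -> : vsum (line_point tau) = \sum_i t tau i.
    by apply: eq_bigr => i _; rewrite mxE.
  by rewrite /C0 /F; ring.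
have lines (m : 'I_k -> nat) := @cintegral_lines R k sg (fun i => h 0 i + (m i)%:R) c sg0 ksg.
have hm1 (m : 'I_k -> nat) i : 1 < complex.Re (h 0 i + (m i)%:R).
  by rewrite cReD Re_natr ltr_wpDr.
have IF m : cintegrable (lebesgue_tuple R k) (F (fun i => h 0 i + (m ord0 i)%:R)).
  by have [] := lines (fun i => m ord0 i) (hm1 _) c0.
have EF m : Phi2_coef h g m *
    (C0 * cintegral (lebesgue_tuple R k) setT (F (fun i => h 0 i + (m ord0 i)%:R))) = 1.
  have [_] := lines (fun i => m ord0 i) (hm1 _) c0; rewrite -/(F _).
  have -> : c + \sum_i (h 0 i + (m ord0 i)%:R - 1) = g + (vsum m)%:R.
    rewrite natr_vsum /c /vsum sumrB big_split/= sumr_const card_ord.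
    by ring.
  rewrite -pochhammer_cgamma//.
  have -> : \prod_i cgamma (h 0 i + (m ord0 i)%:R) =
      (\prod_(i < k) pochhammer (h 0 i) (m ord0 i)) * \prod_(i < k) cgamma (h 0 i).
    by rewrite -big_split/=; apply: eq_bigr => i _; rewrite pochhammer_cgamma.
  rewrite /Phi2_coef /C0.
  set I := cintegral _ _ _; set P := \prod_(i < k) pochhammer _ _.
  set Q := \prod_(i < k) cgamma _ => e.
  have G0 := cgamma_neq0 g0; have p0 := pochhammer_neq0 (vsum m) g0.
  transitivity ((P * Q * cgamma c * I) / pochhammer g (vsum m) *
      'i ^+ k / ((2 * pi%:C * 'i) ^+ k * cgamma g)).
    by ring.
  rewrite e rmorphM rmorph_nat !exprMn.
  field; rewrite G0 p0 !expf_neq0 ?pnatr_eq0//.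
have tE z' tau m : Phi2_term h g (vdiv z' (line_point tau)) m *
     (C0 * F (h 0) tau) = exp_term z' m *
     (Phi2_coef h g m * (C0 * F (fun i => h 0 i + (m ord0 i)%:R) tau)).
  have -> : F (fun i => h 0 i + (m ord0 i)%:R) tau =
      F (h 0) tau * \prod_i (t tau i ^+ m ord0 i)^-1.
    rewrite /F mulrAC -big_split/=; congr (_ * _); apply: eq_bigr => i _.
    have ti : t tau i != 0 by rewrite Re_gt0_neq0.
    by rewrite opprD cpowD// [cpow _ (- _%:R)]cpowN// cpow_nat.
  rewrite Phi2_termE.
  have -> : exp_term (vdiv z' (line_point tau)) m =
      exp_term z' m * \prod_i (t tau i ^+ m ord0 i)^-1.
    rewrite /exp_term -big_split/=; apply: eq_bigr => i _.
    by rewrite !mxE expr_div_n mulrAC.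
  by ring.
have IF0 : cintegrable (lebesgue_tuple R k) (fun tau => C0 * F (h 0) tau).
  apply: cintegrableZ; have := IF 0; congr (cintegrable _ (F _)).
  by apply/funext => i; rewrite mxE addr0.
(* On the lines [|t_i|] is at least its real part [1 / (k + 1)]. *)
pose q i := k.+1%:R * cmod (z 0 i).
have q0 i : 0 <= q i by rewrite mulr_ge0 ?cmod_ge0.
have [M hM] := Phi2_box h g0 q0.
have zt tau i : cmod (vdiv z (line_point tau) 0 i) <= q i.
  rewrite !mxE cmodM cmodV /q mulrC ler_wpM2r ?cmod_ge0//.
  rewrite invf_ple ?posrE ?cmod_gt0 ?Re_gt0_neq0//.
  by rewrite (le_trans (ler_norm _))// (le_trans _ (ler_Re_cmod _)).
have mFm m : cmeasurable (fun tau => exp_term z m *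
     (Phi2_coef h g m * (C0 * F (fun i => h 0 i + (m ord0 i)%:R) tau))).
  apply: cintegrable_cmeasurable; do 3 apply: cintegrableZ; exact: IF.
have bE n tau : box_sum n (Phi2_term h g (vdiv z (line_point tau))) * (C0 * F (h 0) tau) =
    box_sum n (fun m => exp_term z m *
     (Phi2_coef h g m * (C0 * F (fun i => h 0 i + (m ord0 i)%:R) tau))).
  by rewrite /box_sum mulr_suml; apply: eq_bigr => f _; exact: tE.
have ID m : cintegrable (lebesgue_tuple R k) (fun tau => Phi2_coef h g m *
    (C0 * F (fun i => h 0 i + (m ord0 i)%:R) tau)).
  by do 2 apply: cintegrableZ; exact: IF.
have [||||_ lim] := @dominated_ccvg _ _ _ (lebesgue_tuple R k)
  (fun n tau => box_sum n (Phi2_term h g (vdiv z (line_point tau))) * (C0 * F (h 0) tau))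
  (fun tau => Phi2 h g (vdiv z (line_point tau)) * (C0 * F (h 0) tau))
  (fun tau => M * cmod (C0 * F (h 0) tau)).
- move=> n; under [X in cmeasurable X]eq_fun do rewrite bE.
  by apply: cmeasurable_sum => f; exact: mFm.
- move=> tau; apply: ccvgM; last exact: ccvg_cst.
  by have [_] := hM _ (zt tau).
- rewrite /comp; under eq_fun do rewrite EFinM.
  exact/integrableZl/cintegrable_cmod.
- move=> n tau; rewrite cmodM ler_wpM2r ?cmod_ge0//.
  by have [h' _] := hM _ (zt tau); exact: h'.
rewrite /line_integral.
under eq_cintegral do rewrite -mulrA DE.
apply: (ccvg_unique lim); apply: eq_ccvg (ccvg_box_sum_exp z) => n.
under [RHS]eq_cintegral do rewrite bE.
rewrite /box_sum cintegral_sum; last by move=> f; apply: cintegrableZ; exact: ID.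
apply: eq_bigr => f _; rewrite cintegralZ; last exact: ID.
rewrite cintegralZ; last by apply: cintegrableZ; exact: IF.
by rewrite cintegralZ ?EF ?mulr1//; exact: IF.
Qed.

Let pkerX (l : R[i]) (s : R) n : 0 < complex.Re l ->
  pker l s * s%:C ^+ n = pker (l + n%:R) s.
Proof.
move=> l0; rewrite /pker; case: ifP => s0; last by rewrite mul0r.
case: n => [|n]; first by rewrite mulr1 addr0.
have [->|s_neq0] := eqVneq s 0.
  (* The default value of [cpow] at 0 must not interfere: the exponent on the right has a positive
     real part, so both sides vanish. *)
  have /negbTE e : l + n.+1%:R - 1 != 0.
    by rewrite -natr1 addrA addrK Re_gt0_neq0// cReD Re_natr ltr_wpDr.
  by rewrite exprS mul0r mulr0 /cpow eqxx e.
have s1 : 0 < s by rewrite lt_def s_neq0.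
rewrite -cpow_nat// -cpowD ?Re_gt0_neq0//; congr cpow; ring.
Qed.

(** The kernels carry the indicator of the simplex: off it some coordinate, or the mass left over,
    is negative. On its boundary they keep the values of [cpow] at 0, so the identity holds at every
    point. *)
Lemma dirichlet_density_pker a (al : R[i]) (s : T) :
  (if s \in @simplex R k then dirichlet_density a al s else 0) =
  cgamma (vsum a + al) / ((\prod_(i < k) cgamma (a 0 i)) * cgamma al) *
  ((\prod_i pker (a 0 i) (tnth s i)) * pker al (1 - \sum_i (tnth s i : R))).
Proof.
case: ifPn => [/set_mem[s0 s1]|ns].
  rewrite /dirichlet_density -mulrA; congr (_ * (_ * _)).
    by apply: eq_bigr => i _; rewrite /pker s0 mxE.
  rewrite /pker subr_ge0 s1; congr cpow.
  rewrite rmorphB rmorph1 rmorph_sum; congr (_ - _).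
  by apply: eq_bigr => i _; rewrite mxE.
rewrite /pker subr_ge0; case: ifPn => s1; last by rewrite !mulr0.
have [/existsP[i si]|si] := boolP [exists i, (tnth s i : R) < 0].
  by rewrite [X in X * cpow _ _](bigD1 i)//= ifN ?mul0r ?mulr0// -ltNge.
exfalso; move/negP: ns; apply; apply: mem_set; split => // i.
by have := si; rewrite negb_exists => /forallP/(_ i); rewrite -leNgt.
Qed.

(** Multiplying the density by [s ^ m] replaces [a] by [a + m], and the normalized moment is the
    coefficient of [Phi2] itself. Integrability is part of the conclusion because the product of two
    such integrals is formed afterwards. *)
Lemma dirichlet_integral_Phi2 a (c : R[i]) x :
  (forall i, 0 < complex.Re (a 0 i)) -> complex.Re (vsum a) < complex.Re c ->
  let G := fun s : T => cexp (vsum (vmul x (cvec s))) *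
    (if s \in @simplex R k then dirichlet_density a (c - vsum a) s else 0) in
  cintegrable (lebesgue_tuple R k) G /\
  cintegral (lebesgue_tuple R k) setT G = Phi2 a c x.
Proof.
move=> a0 ac G.
pose al := c - vsum a.
have al0 : 0 < complex.Re al by rewrite cReD cReN subr_gt0.
have c0 : 0 < complex.Re c by apply: le_lt_trans ac; exact: Re_vsum_ge0.
pose F (l : 'I_k -> R[i]) (s : T) :=
  (\prod_i pker (l i) (tnth s i)) * pker al (1 - \sum_i (tnth s i : R)).
pose C1 := cgamma c / ((\prod_(i < k) cgamma (a 0 i)) * cgamma al).
have DE s : (if s \in @simplex R k then dirichlet_density a al s else 0) = C1 * F (a 0) s.
  by rewrite dirichlet_density_pker /C1 /al addrC subrK.
have am0 m i : 0 < complex.Re (a 0 i + (m ord0 i)%:R).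
  by rewrite cReD Re_natr ltr_wpDr.
have dir m := @cintegral_dirichlet R k (fun i => a 0 i + (m ord0 i)%:R) al 1
  (am0 m) al0 (oner_neq0 _).
have IF m : cintegrable (lebesgue_tuple R k) (F (fun i => a 0 i + (m ord0 i)%:R)).
  by have [] := dir m.
have EF m : C1 * cintegral (lebesgue_tuple R k) setT (F (fun i => a 0 i + (m ord0 i)%:R)) =
    Phi2_coef a c m.
  have [_] := dir m; rewrite -[fun s : T => _]/(F (fun i => a 0 i + (m ord0 i)%:R)).
  have -> : \sum_i (a 0 i + (m ord0 i)%:R) + al = c + (vsum m)%:R.
    by rewrite natr_vsum big_split/= /al /vsum; ring.
  rewrite -pochhammer_cgamma//.
  have -> : \prod_i cgamma (a 0 i + (m ord0 i)%:R) =
      (\prod_(i < k) pochhammer (a 0 i) (m ord0 i)) * \prod_(i < k) cgamma (a 0 i).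
    by rewrite -big_split/=; apply: eq_bigr => i _; rewrite pochhammer_cgamma.
  have -> w : pker w 1 = 1 :> R[i].
    by rewrite /pker ler01 cpow_real// ln1 mulr0 cexp0.
  rewrite /Phi2_coef /C1 mulr1.
  have Q0 : \prod_(i < k) cgamma (a 0 i) != 0.
    by rewrite prodf_seq_neq0; apply/allP => i _ /=; exact: cgamma_neq0.
  move: Q0; set I := cintegral _ _ _; set P := \prod_(i < k) pochhammer _ _.
  set Q := \prod_(i < k) cgamma _ => Q0 e.
  have p0 := pochhammer_neq0 (vsum m) c0; have A0 := cgamma_neq0 al0.
  have C0 := cgamma_neq0 c0.
  have -> : I = P * Q * cgamma al / (pochhammer c (vsum m) * cgamma c).
    by rewrite -e; field; rewrite p0 C0.
  by field; rewrite Q0 p0 A0 C0.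
have tE s m : exp_term (vmul x (cvec s)) m * (C1 * F (a 0) s) =
    exp_term x m * (C1 * F (fun i => a 0 i + (m ord0 i)%:R) s).
  have -> : F (fun i => a 0 i + (m ord0 i)%:R) s =
      F (a 0) s * \prod_i (tnth s i : R)%:C ^+ m ord0 i.
    rewrite /F mulrAC -big_split/=; congr (_ * _).
    by apply: eq_bigr => i _; rewrite pkerX.
  have -> : exp_term (vmul x (cvec s)) m =
      exp_term x m * \prod_i (tnth s i : R)%:C ^+ m ord0 i.
    rewrite /exp_term -big_split/=; apply: eq_bigr => i _.
    by rewrite !mxE exprMn mulrAC.
  by ring.
have IF0 : cintegrable (lebesgue_tuple R k) (fun s => C1 * F (a 0) s).
  apply: cintegrableZ; have := IF 0; congr (cintegrable _ (F _)).
  by apply/funext => i; rewrite mxE addr0.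
have bE n s : box_sum n (exp_term (vmul x (cvec s))) * (C1 * F (a 0) s) =
    box_sum n (fun m => exp_term x m * (C1 * F (fun i => a 0 i + (m ord0 i)%:R) s)).
  by rewrite /box_sum mulr_suml; apply: eq_bigr => f _; exact: tE.
(* The coordinates of a point of the simplex are at most 1, so [|x_i s_i| <= |x_i|]; off the simplex
   the density is 0. *)
pose M := \prod_(i < k) expR (cmod (x 0 i)).
have GE : G = fun s => cexp (vsum (vmul x (cvec s))) * (C1 * F (a 0) s).
  by apply/funext => s; rewrite /G DE.
have [||||IG lim] := @dominated_ccvg _ _ _ (lebesgue_tuple R k)
  (fun n s => box_sum n (exp_term (vmul x (cvec s))) * (C1 * F (a 0) s)) G
  (fun s => M * cmod (C1 * F (a 0) s)).
- move=> n; under [X in cmeasurable X]eq_fun do rewrite bE.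
  apply: cmeasurable_sum => f; apply: cintegrable_cmeasurable.
  by do 2 apply: cintegrableZ; exact: IF.
- move=> s; rewrite GE; apply: ccvgM; last exact: ccvg_cst.
  exact: ccvg_box_sum_exp.
- rewrite /comp; under eq_fun do rewrite EFinM.
  exact/integrableZl/cintegrable_cmod.
- move=> n s; rewrite -DE; case: ifPn => [/set_mem[s0 s1]|_]; last first.
    by rewrite mulr0 cmod0 mulr0.
  rewrite cmodM ler_wpM2r ?cmod_ge0//.
  apply: (le_trans (ler_cmod_sum _ _ _)).
  apply: le_trans (box_sum_exp_le n (fun i => cmod_ge0 (x 0 i))).
  apply: ler_sum => f _; apply: cmod_exp_term => i.
  rewrite !mxE cmodM cmod_real ger0_norm// ler_piMr ?cmod_ge0//.
  by apply: le_trans s1; rewrite (bigD1 i)//= lerDl sumr_ge0.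
split => //; apply: (ccvg_unique lim).
have [M' hM'] := @Phi2_box R k a c (fun i => cmod (x 0 i)) c0 (fun i => cmod_ge0 _).
have [_] := hM' x (fun i => lexx _); apply: eq_ccvg => n.
under [RHS]eq_cintegral do rewrite bE.
rewrite /box_sum cintegral_sum; last by move=> f; do 2 apply: cintegrableZ; exact: IF.
apply: eq_bigr => f _; rewrite cintegralZ; last by apply: cintegrableZ; exact: IF.
by rewrite cintegralZ ?EF ?Phi2_termE 1?mulrC//; exact: IF.
Qed.

End moments.

Theorem proposition3p3 (R : realType) (k : nat) (x y a b h : 'rV[R[i]]_k)
    (c d g : R[i])
    (hk : (1 <= k)%N)
    (ha : forall i, 0 < complex.Re (a 0 i))
    (hc : complex.Re (vsum a) < complex.Re c)
    (hb : forall i, 0 < complex.Re (b 0 i))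
    (hd : complex.Re (vsum b) < complex.Re d)
    (hh : forall i, 0 < complex.Re ((h - const_mx 1) 0 i))
    (hg : complex.Re (vsum h) < complex.Re (g + k%:R)) :
  Phi2 a c x * Phi2 b d y =
  cintegral (lebesgue_tuple R k \x lebesgue_tuple R k)%E
    (@simplex R k `*` @simplex R k)
    (fun uv =>
      line_integral (fun t =>
        Phi2 h g (vdiv (vmul x (cvec uv.1) + vmul y (cvec uv.2)) t)
        * line_density (h - const_mx 1) (g + k%:R - vsum h) t)
      * dirichlet_density a (c - vsum a) uv.1
      * dirichlet_density b (d - vsum b) uv.2).
Proof.
have [Ia Ea] := dirichlet_integral_Phi2 x ha hc.
have [Ib Eb] := dirichlet_integral_Phi2 y hb hd.
(* Both sides become integrals over the whole product space; the indicator of the product of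
   simplices splits into the two indicators on the left, and the integrands are compared
   pointwise. *)
rewrite -Ea -Eb -(cintegral_mul Ia Ib) [RHS]cintegral_mkcond.
apply: eq_cintegral => -[u v] /=; rewrite line_integral_Phi2//.
have -> : vsum (vmul x (cvec u) + vmul y (cvec v)) =
    vsum (vmul x (cvec u)) + vsum (vmul y (cvec v)).
  by rewrite /vsum -big_split/=; apply: eq_bigr => i _; rewrite mxE.
rewrite cexpD in_setX/=.
by case: ifP => _; case: ifP => _; rewrite ?mulr0 ?mul0r//= mulrACA !mulrA.
Qed.
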